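(* Let $q\in(0,1)$, $k_1,k_2>0$, $\varepsilon\in\frac12\mathbb Z$, and let $\mathcal T'=\mathcal T'_{k_1,k_2,\varepsilon}$ be the $\mathcal U_q(\mathfrak{su}(1,1))$-representation $$\mathcal T'=\Big((\pi^-_{k_1}\otimes\pi^{\mathrm S}_{k_2-\frac12,\varepsilon+k_2})\oplus(\pi^{\mathrm S}_{k_1-\frac12,-\varepsilon-k_1}\otimes\pi^+_{k_2})\Big)\Delta$$ on $(\ell^2(\mathbb N)\otimes\ell^2(\mathbb Z))\oplus(\ell^2(\mathbb Z)\otimes\ell^2(\mathbb N))$. Then $\mathcal T'$ is unitarily equivalent to $$\bigoplus_{m=0}^\infty\pi^{\mathrm S}_{k_1+k_2-\frac12+m,\ \varepsilon-k_1+k_2}.$$ The unitary intertwiner $(\ell^2(\mathbb N)\otimes\ell^2(\mathbb Z))\oplus(\ell^2(\mathbb Z)\otimes\ell^2(\mathbb N))\to\bigoplus_{m=0}^\infty\ell^2(\mathbb Z)$ is given by $$f^\tau_{p,n}\mapsto\sum_{m=0}^\infty(\Theta f^\tau_{p,n})(m)\,e^{\mathrm S}_p,\qquad p\in\mathbb Z,\ n\in\mathbb N,\ \tau\in\{-,+\},$$ where in the $m$-th term $e^{\mathrm S}_p$ is the basis vector of the $m$-th summand, and $$f^-_{p,n}=e_n\otimes e_{n+p}\in\ell^2(\mathbb N)\otimes\ell^2(\mathbb Z),\qquad f^+_{p,n}=e_{2\varepsilon-n+p}\otimes e_n\in\ell^2(\mathbb Z)\otimes\ell^2(\mathbb N),$$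 $$(\Theta f^-_{p,n})(m)=r_{q^{2n+4k_1}}\big(m;q^{4k_1-2},q^{4k_2-2},-q^{4k_1-2p-2\varepsilon-2};q^2\big),$$ $$(\Theta f^+_{p,n})(m)=(-1)^n r_{-q^{2n+4k_1-2p-2\varepsilon}}\big(m;q^{4k_1-2},q^{4k_2-2},-q^{4k_1-2p-2\varepsilon-2};q^2\big),$$ with $r_x(m;a,b,c;q^2)$ the normalized big $q^2$-Jacobi polynomials defined in the context.
   Context: **Quantum algebra.** $\mathbb N=\{0,1,2,\dots\}$. $\mathcal U_q=\mathcal U_q(\mathfrak{su}(1,1))$ is the unital complex algebra generated by $K,K^{-1},E,F$ with $KK^{-1}=1=K^{-1}K$, $KE=qEK$, $KF=q^{-1}FK$, $EF-FE=\frac{K^2-K^{-2}}{q-q^{-1}}$, with $*$-structure $K^*=K$, $E^*=-F$, $F^*=-E$ and comultiplication (algebra homomorphism) $\Delta(K^{\pm1})=K^{\pm1}\otimes K^{\pm1}$, $\Delta(E)=K\otimes E+E\otimes K^{-1}$, $\Delta(F)=K\otimes F+F\otimes K^{-1}$. **Representations.** All are by unbounded operators, on the domain of finite linear combinations of orthonormal basis vectors $e_n$; a direct sum acts componentwise. - $\pi^+_k$, $k>0$, on $\ell^2(\mathbb N)$: $Ke_n=q^{k+n}e_n$, $(q^{-1}-q)Ee_n=q^{-\frac12-k-n}\sqrt{(1-q^{2n+2})(1-q^{4k+2n})}\,e_{n+1}$, $(q^{-1}-q)Fe_n=-q^{\frac12-k-n}\sqrt{(1-q^{2n})(1-q^{4k+2n-2})}\,e_{n-1}$.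 - $\pi^-_k$, $k>0$, on $\ell^2(\mathbb N)$: $Ke_n=q^{-(k+n)}e_n$, $(q^{-1}-q)Ee_n=-q^{\frac12-k-n}\sqrt{(1-q^{2n})(1-q^{4k+2n-2})}\,e_{n-1}$, $(q^{-1}-q)Fe_n=q^{-\frac12-k-n}\sqrt{(1-q^{2n+2})(1-q^{4k+2n})}\,e_{n+1}$. - $\pi^{\mathrm S}_{\sigma,\varepsilon}$ on $\ell^2(\mathbb Z)$, for real $\sigma,\varepsilon$: $Ke_n=q^{n+\varepsilon}e_n$, $(q^{-1}-q)Ee_n=q^{-\frac12-n-\varepsilon}\sqrt{(1+q^{2n+2\varepsilon+2\sigma+1})(1+q^{2n+2\varepsilon-2\sigma+1})}\,e_{n+1}$, $(q^{-1}-q)Fe_n=-q^{\frac12-n-\varepsilon}\sqrt{(1+q^{2n+2\varepsilon+2\sigma-1})(1+q^{2n+2\varepsilon-2\sigma-1})}\,e_{n-1}$. **Big $q$-Jacobi polynomials (base $s\in(0,1)$).** $(x;s)_n=\prod_{k=0}^{n-1}(1-xs^k)$ for $n\in\mathbb N\cup\{\infty\}$, $(x_1,\dots,x_l;s)_n=\prod_i(x_i;s)_n$, $\theta(x;s)=(x,s/x;s)_\infty$. For $0<a,b<s^{-1}$, $c<0$, $m\in\mathbb N$ and $x\in\{as^{k+1}:k\in\mathbb N\}\cup\{cs^{k+1}:k\in\mathbb N\}$: $$P_m(x;a,b,c;s)=\sum_{k=0}^{m}\frac{(s^{-m},abs^{m+1},x;s)_k}{(s,as,cs;s)_k}s^k,\qquad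 u(x;a,b,c;s)=\frac{(x/a,x/c;s)_\infty}{(x,bx/c;s)_\infty},$$ $$v(m;a,b,c;s)=\frac{1-abs^{2m+1}}{as(1-abs)}\,\frac{(as,bs,cs,abs/c;s)_\infty}{(s,abs^2;s)_\infty\,\theta(c/a;s)}\,\frac{(as,abs,cs;s)_m}{(s,bs,abs/c;s)_m}\,(-acs^2)^{-m}s^{-\frac12m(m-1)},$$ $$r_x(m;a,b,c;s)=\sqrt{|x|\,u(x;a,b,c;s)\,v(m;a,b,c;s)}\;P_m(x;a,b,c;s).$$ (When $abs=1$, the expression for $v$ is understood by cancelling the factor $1-abs$ against $1-abs^{2m+1}$ for $m=0$, and against $(abs;s)_m$ for $m\ge1$.) *)

(* Defs.v *)
From HB Require Import structures.
From mathcomp Require Import all_boot all_order all_algebra.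
From mathcomp Require Import all_classical all_reals all_analysis.
From mathcomp Require Import complex ring lra.
From mathcomp.multinomials Require Import freeg.

Set Implicit Arguments.
Unset Strict Implicit.
Unset Printing Implicit Defensive.

Import Order.TTheory GRing.Theory Num.Theory.
Import numFieldNormedType.Exports.

Local Open Scope classical_set_scope.
Local Open Scope ring_scope.
Local Open Scope quotient_scope.
Local Open Scope complex_scope.

Inductive ugen := gK | gKinv | gE | gF.

Inductive uexpr (C : Type) : Type :=
| Uconst of C
| Ugen of ugen
| Uadd of uexpr C & uexpr C
| Umul of uexpr C & uexpr C.
Arguments Ugen {C}.

HB.instance Definition _ (C : Type) := gen_eqMixin (uexpr C).
HB.instance Definition _ (C : Type) := gen_choiceMixin (uexpr C).

Section Congruence.
Context {R : realType} (q : R).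
Local Notation C := R[i].
Local Notation "x + y" := (@Uadd C x y).
Local Notation "x * y" := (@Umul C x y).
Local Notation "c %:U" := (@Uconst C c) (at level 2, format "c %:U").
Local Notation K := (@Ugen C gK).
Local Notation Ki := (@Ugen C gKinv).
Local Notation E := (@Ugen C gE).
Local Notation F := (@Ugen C gF).
Local Reserved Notation "x ≡ y" (at level 70).

(* The least congruence for which the quotient is a unital C-algebra
   satisfying the defining relations. *)
Inductive ucong : uexpr C -> uexpr C -> Prop :=
| ucong_refl x : x ≡ x
| ucong_sym x y : x ≡ y -> y ≡ x
| ucong_trans x y z : x ≡ y -> y ≡ z -> x ≡ z
| ucong_add x x' y y' : x ≡ x' -> y ≡ y' -> x + y ≡ x' + y'
| ucong_mul x x' y y' : x ≡ x' -> y ≡ y' -> x * y ≡ x' * y'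
| ucong_addA x y z : x + (y + z) ≡ (x + y) + z
| ucong_addC x y : x + y ≡ y + x
| ucong_add0 x : 0%:U + x ≡ x
| ucong_mul0 x : 0%:U * x ≡ 0%:U
| ucong_mulA x y z : x * (y * z) ≡ (x * y) * z
| ucong_mul1 x : 1%:U * x ≡ x
| ucong_mulDl x y z : (x + y) * z ≡ x * z + y * z
| ucong_mulDr x y z : x * (y + z) ≡ x * y + x * z
| ucong_constD a b : (a + b)%R%:U ≡ a%:U + b%:U
| ucong_constM a b : (a * b)%R%:U ≡ a%:U * b%:U
| ucong_constC a x : a%:U * x ≡ x * a%:U
| ucong_KKi : K * Ki ≡ 1%:U
| ucong_KiK : Ki * K ≡ 1%:U
| ucong_KE : K * E ≡ (q%:C)%:U * (E * K)
| ucong_KF : K * F ≡ (q^-1%:C)%:U * (F * K)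
| ucong_EF : E * F + (-1)%:U * (F * E) ≡
    ((q - q^-1)^-1%:C)%R%:U * (K * K + (-1)%:U * (Ki * Ki))
where "x ≡ y" := (ucong x y).

Definition ucongb (x y : uexpr C) : bool := `[< ucong x y >].

Lemma ucongb_refl : reflexive ucongb.
Proof. by move=> x; apply/asboolP; exact: ucong_refl. Qed.

Lemma ucongb_sym : symmetric ucongb.
Proof.
by move=> x y; apply/asboolP/asboolP; exact: ucong_sym.
Qed.

Lemma ucongb_trans : transitive ucongb.
Proof.
by move=> y x z /asboolP h1 /asboolP h2; apply/asboolP; exact: ucong_trans h1 h2.
Qed.

Canonical ucong_equiv := EquivRel ucongb ucongb_refl ucongb_sym ucongb_trans.
Canonical ucong_encModRel := defaultEncModRel ucongb.

Definition Uq : Type := {eq_quot ucongb}.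

HB.instance Definition _ := Choice.on Uq.
HB.instance Definition _ := Quotient.on Uq.
HB.instance Definition _ : EqQuotient _ ucongb Uq := EqQuotient.on Uq.

Lemma Uq_eqP (x y : uexpr C) : reflect (\pi_Uq x = \pi_Uq y) `[< ucong x y >].
Proof. by apply: (iffP idP) => [?|/eqmodP//]; apply/eqmodP. Qed.

Lemma ucong_repr (x : uexpr C) : ucong (repr (\pi_Uq x)) x.
Proof. by apply/asboolP/Uq_eqP; rewrite reprK. Qed.

End Congruence.

Section LinearMaps.
Context {R : realType}.
Local Notation C := R[i].

Lemma linear_addE (V W : lmodType C) (f : V -> W) :
  linear f -> {morph f : u v / u + v}.
Proof. by move=> hf u v; have := hf 1 u v; rewrite !scale1r. Qed.

Lemma linear_scaleE (V W : lmodType C) (f : V -> W) :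
  linear f -> forall a, {morph f : u / a *: u}.
Proof.
move=> hf a u; have f0 : f 0 = 0.
  by apply: (addrI (f 0)); rewrite -linear_addE // !addr0.
by have := hf a u 0; rewrite f0 !addr0.
Qed.

Lemma linear_comp_of (V1 V2 V3 : lmodType C) (f : V2 -> V3) (g : V1 -> V2) :
  linear f -> linear g -> linear (fun v => f (g v)).
Proof. by move=> hf hg a u v; rewrite hg hf. Qed.

Lemma linear_scale_of (V1 V2 : lmodType C) c (f : V1 -> V2) :
  linear f -> linear (fun v => c *: f v).
Proof. by move=> hf a u v; rewrite hf scalerDr !scalerA [c * a]mulrC. Qed.

Lemma linear_sub_of (V1 V2 : lmodType C) (f g : V1 -> V2) :
  linear f -> linear g -> linear (fun v => f v - g v).
Proof. by move=> hf hg a u v; rewrite hf hg scalerBr opprD addrACA. Qed.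

End LinearMaps.

Section Evaluation.
Context {R : realType} (q : R) (V : lmodType R[i]).
Implicit Types (T : ugen -> V -> V) (v : V).

Fixpoint ueval T (x : uexpr R[i]) : V -> V :=
  match x with
  | Uconst c => fun v => c *: v
  | Ugen g => T g
  | Uadd x y => fun v => ueval T x v + ueval T y v
  | Umul x y => fun v => ueval T x (ueval T y v)
  end.

Record urels T : Prop := URels {
  urels_lin : forall g, linear (T g);
  urels_KKi : forall v, T gK (T gKinv v) = v;
  urels_KiK : forall v, T gKinv (T gK v) = v;
  urels_KE : forall v, T gK (T gE v) = q%:C *: T gE (T gK v);
  urels_KF : forall v, T gK (T gF v) = q^-1%:C *: T gF (T gK v);
  urels_EF : forall v, T gE (T gF v) - T gF (T gE v) =
    (q - q^-1)^-1%:C *: (T gK (T gK v) - T gKinv (T gKinv v)) }.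

Lemma ueval_linear T x : (forall g, linear (T g)) -> linear (ueval T x).
Proof.
move=> hT; elim: x => [c|g|x ihx y ihy|x ihx y ihy] a u v /=.
- by rewrite scalerDr !scalerA mulrC.
- exact: hT.
- by rewrite ihx ihy scalerDr addrACA.
- by rewrite ihy ihx.
Qed.

Lemma ueval_cong T : urels T -> forall x y, ucong q x y -> ueval T x =1 ueval T y.
Proof.
move=> [hl h1 h2 h3 h4 h5] x y.
have hlin z : linear (ueval T z) by exact: ueval_linear.
elim=> {x y} /=.
- by [].
- by move=> x y _ ih v; rewrite ih.
- by move=> x y z _ ih1 _ ih2 v; rewrite ih1.
- by move=> x x' y y' _ ih1 _ ih2 v /=; rewrite ih1 ih2.
- by move=> x x' y y' _ ih1 _ ih2 v /=; rewrite ih1 ih2.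
- by move=> x y z v /=; rewrite addrA.
- by move=> x y v /=; rewrite addrC.
- by move=> x v /=; rewrite scale0r add0r.
- by move=> x v /=; rewrite !scale0r.
- by [].
- by move=> x v /=; rewrite scale1r.
- by [].
- by move=> x y z v /=; rewrite linear_addE.
- by move=> a b v /=; rewrite scalerDl.
- by move=> a b v /=; rewrite scalerA.
- by move=> a x v /=; rewrite linear_scaleE.
- by move=> v /=; rewrite scale1r.
- by move=> v /=; rewrite scale1r.
- exact: h3.
- exact: h4.
- by move=> v /=; rewrite !scaleN1r h5.
Qed.

End Evaluation.

Section UqAlgebra.
Context {R : realType} (q : R).
Local Notation C := R[i].
Local Notation U := (Uq q).

Definition uq_const (c : C) : U := \pi_U (Uconst c).
Definition uq_gen (g : ugen) : U := \pi_U (Ugen g).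
Definition uq_add := lift_op2 U (@Uadd C).
Definition uq_mul := lift_op2 U (@Umul C).
Definition uq_opp (X : U) : U := uq_mul (uq_const (-1)) X.
Definition uq_scale (c : C) (X : U) : U := uq_mul (uq_const c) X.

Lemma uq_addE x y : uq_add (\pi_U x) (\pi_U y) = \pi_U (Uadd x y).
Proof. by unlock uq_add; apply/Uq_eqP/asboolP; apply: ucong_add; exact: ucong_repr. Qed.

Lemma uq_mulE x y : uq_mul (\pi_U x) (\pi_U y) = \pi_U (Umul x y).
Proof. by unlock uq_mul; apply/Uq_eqP/asboolP; apply: ucong_mul; exact: ucong_repr. Qed.

Lemma uq_pi x y : ucong q x y -> \pi_U x = \pi_U y.
Proof. by move=> h; apply/Uq_eqP/asboolP. Qed.

Let uqE := (uq_addE, uq_mulE).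

Lemma uq_addA : associative uq_add.
Proof.
elim/quotW=> x; elim/quotW=> y; elim/quotW=> z; rewrite !uqE.
apply: uq_pi; exact: ucong_addA.
Qed.

Lemma uq_addC : commutative uq_add.
Proof.
by elim/quotW=> x; elim/quotW=> y; rewrite !uqE; apply: uq_pi; exact: ucong_addC.
Qed.

Lemma uq_add0 : left_id (uq_const 0) uq_add.
Proof. by elim/quotW=> x; rewrite !uqE; apply: uq_pi; exact: ucong_add0. Qed.

Lemma uq_mulA : associative uq_mul.
Proof.
elim/quotW=> x; elim/quotW=> y; elim/quotW=> z; rewrite !uqE.
apply: uq_pi; exact: ucong_mulA.
Qed.

Lemma uq_constC c X : uq_mul (uq_const c) X = uq_mul X (uq_const c).
Proof. by elim/quotW: X => x; rewrite !uqE; apply: uq_pi; exact: ucong_constC. Qed.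

Lemma uq_mul1 : left_id (uq_const 1) uq_mul.
Proof. by elim/quotW=> x; rewrite !uqE; apply: uq_pi; exact: ucong_mul1. Qed.

Lemma uq_mulr1 : right_id (uq_const 1) uq_mul.
Proof. by move=> X; rewrite -uq_constC uq_mul1. Qed.

Lemma uq_mulDl : left_distributive uq_mul uq_add.
Proof.
elim/quotW=> x; elim/quotW=> y; elim/quotW=> z; rewrite !uqE.
apply: uq_pi; exact: ucong_mulDl.
Qed.

Lemma uq_mulDr : right_distributive uq_mul uq_add.
Proof.
elim/quotW=> x; elim/quotW=> y; elim/quotW=> z; rewrite !uqE.
apply: uq_pi; exact: ucong_mulDr.
Qed.

Lemma uq_constD a b : uq_const (a + b) = uq_add (uq_const a) (uq_const b).
Proof. by rewrite uq_addE; apply: uq_pi; exact: ucong_constD. Qed.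

Lemma uq_constM a b : uq_const (a * b) = uq_mul (uq_const a) (uq_const b).
Proof. by rewrite uq_mulE; apply: uq_pi; exact: ucong_constM. Qed.

Lemma uq_addN : left_inverse (uq_const 0) uq_opp uq_add.
Proof.
move=> X; rewrite /uq_opp -{2}[X]uq_mul1 -uq_mulDl -uq_constD addNr.
by elim/quotW: X => x; rewrite !uqE; apply: uq_pi; exact: ucong_mul0.
Qed.

(* 1 <> 0 because of the one-dimensional representation K, K^-1 |-> 1,
   E, F |-> 0. *)
Lemma uq_const1_neq0 : uq_const 1 != uq_const 0.
Proof.
pose T (g : ugen) : C^o -> C^o :=
  match g with gK | gKinv => id | gE | gF => fun=> 0 end.
have hT : urels q T.
  split=> //.
  - by case=> a u v //=; rewrite scaler0 addr0.
  - by move=> v /=; rewrite scaler0.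
  - by move=> v /=; rewrite scaler0.
  - by move=> v /=; rewrite !subrr scaler0.
apply/negP => /eqP/Uq_eqP/asboolP/(ueval_cong hT)/(_ 1) /=.
by rewrite scale1r scale0r => /eqP; rewrite oner_eq0.
Qed.

HB.instance Definition _ :=
  GRing.isZmodule.Build U uq_addA uq_addC uq_add0 uq_addN.
HB.instance Definition _ := GRing.Zmodule_isNzRing.Build U
  uq_mulA uq_mul1 uq_mulr1 uq_mulDl uq_mulDr uq_const1_neq0.

Lemma uq_scaleA a b X : uq_scale a (uq_scale b X) = uq_scale (a * b) X.
Proof. by rewrite /uq_scale uq_mulA -uq_constM. Qed.

Lemma uq_scale1 : left_id 1 uq_scale.
Proof. exact: uq_mul1. Qed.

Lemma uq_scaleDr : right_distributive uq_scale +%R.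
Proof. by move=> a X Y; exact: uq_mulDr. Qed.

Lemma uq_scaleDl X : {morph uq_scale^~ X : a b / a + b}.
Proof. by move=> a b; rewrite /uq_scale uq_constD; exact: uq_mulDl. Qed.

HB.instance Definition _ := GRing.Zmodule_isLmodule.Build C U
  uq_scaleA uq_scale1 uq_scaleDr uq_scaleDl.

Lemma uq_scaleAl (a : C) (X Y : U) : a *: (X * Y) = (a *: X) * Y.
Proof. exact: uq_mulA. Qed.

HB.instance Definition _ := GRing.Lmodule_isLalgebra.Build C U uq_scaleAl.

Lemma uq_scaleAr (a : C) (X Y : U) : a *: (X * Y) = X * (a *: Y).
Proof.
transitivity (uq_mul (uq_mul (uq_const a) X) Y); first exact: uq_mulA.
by rewrite uq_constC -uq_mulA.
Qed.

HB.instance Definition _ := GRing.Lalgebra_isAlgebra.Build C U uq_scaleAr.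

End UqAlgebra.

Section Representations.
Context {R : realType} (q : R).
Local Notation C := R[i].

Record urepr (V : lmodType C) := URepr {
  uact :> Uq q -> V -> V;
  uact_linear : forall X, linear (uact X);
  uact1 : forall v, uact 1 v = v;
  uactM : forall X Y v, uact (X * Y) v = uact X (uact Y v);
  uactP : forall c X Y v, uact (c *: X + Y) v = c *: uact X v + uact Y v }.

Section Universal.
Context (V : lmodType C) (T : ugen -> V -> V) (hT : urels q T).

Definition urep_act (X : Uq q) : V -> V := ueval T (repr X).

Lemma urep_actE x : urep_act (\pi_(Uq q) x) =1 ueval T x.
Proof. by move=> v; apply: (ueval_cong hT); exact: ucong_repr. Qed.

Lemma urep_gen g : urep_act (uq_gen q g) =1 T g.
Proof. exact: urep_actE. Qed.

Lemma urep_linear X : linear (urep_act X).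
Proof. by apply: ueval_linear; case: hT. Qed.

Lemma urep1 v : urep_act 1 v = v.
Proof. by rewrite [LHS]urep_actE /= scale1r. Qed.

Lemma urepM X Y v : urep_act (X * Y) v = urep_act X (urep_act Y v).
Proof.
by elim/quotW: X => x; elim/quotW: Y => y; rewrite [_ * _]uq_mulE !urep_actE.
Qed.

Lemma urepD X Y v : urep_act (X + Y) v = urep_act X v + urep_act Y v.
Proof.
by elim/quotW: X => x; elim/quotW: Y => y; rewrite [_ + _]uq_addE !urep_actE.
Qed.

Lemma urepP c X Y v :
  urep_act (c *: X + Y) v = c *: urep_act X v + urep_act Y v.
Proof.
rewrite urepD; congr (_ + _).
by elim/quotW: X => x; rewrite [_ *: _]uq_mulE !urep_actE.
Qed.

Definition urepr_of : urepr V := URepr urep_linear urep1 urepM urepP.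

End Universal.

Lemma urepr_urels (V : lmodType C) (T : urepr V) :
  urels q (fun g => T (uq_gen q g)).
Proof.
have TC c X v : T (uq_mul (\pi_(Uq q) (Uconst c)) X) v = c *: T X v.
  have T0 : T 0 v = 0.
    have := uactP T 1 0 0 v; rewrite scaler0 addr0 scale1r => h.
    by apply: (addrI (T 0 v)); rewrite addr0.
  by have := uactP T c X 0 v; rewrite T0 !addr0.
have TD X Y v : T (uq_add X Y) v = T X v + T Y v.
  by have := uactP T 1 X Y v; rewrite !scale1r.
have TM X Y v : T (uq_mul X Y) v = T X (T Y v) by exact: uactM.
split.
- by move=> g; exact: uact_linear.
- by move=> v; rewrite -TM uq_mulE (uq_pi (ucong_KKi q)); exact: uact1.
- by move=> v; rewrite -TM uq_mulE (uq_pi (ucong_KiK q)); exact: uact1.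
- by move=> v; rewrite -!TM uq_mulE (uq_pi (ucong_KE q)) -!uq_mulE TC.
- by move=> v; rewrite -!TM uq_mulE (uq_pi (ucong_KF q)) -!uq_mulE TC.
- move=> v; have /(congr1 (fun X => T X v)) := uq_pi (ucong_EF q).
  by rewrite -!(uq_mulE, uq_addE) !(TD, TC, TM) !scaleN1r.
Qed.

End Representations.

Notation fin R I := {freeg I / R[i]}.

Section Fin.
Context {R : realType}.
Local Notation C := R[i].

Lemma fglift_linear (I : choiceType) (V : lmodType C) (f : I -> V) :
  linear (fglift f : fin R I -> V).
Proof.
have fB := lift_is_additive f.
pose g := GRing.isZmodMorphism.Build (fin R I) V (fglift f) fB.
pose F : {additive fin R I -> V} := HB.pack (fglift f) g.
move=> a u v; rewrite -[fglift f]/(F : _ -> _) raddfD; congr (_ + _).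
have -> : F u = \sum_(i <- dom u) coeff i u *: f i.
  rewrite -[in LHS](freeg_sumE u) raddf_sum.
  by apply: eq_bigr => i _; exact: liftU.
rewrite -[a *: u]/(fgscale a u) /fgscale raddf_sum scaler_sumr.
by apply: eq_bigr => i _; rewrite /= !liftU scalerA.
Qed.

Lemma fin_ext (I : choiceType) (V : lmodType C) (f g : fin R I -> V) :
  linear f -> linear g -> (forall i, f << i >> = g << i >>) -> f =1 g.
Proof.
move=> hf hg fg u.
pose F : {linear fin R I -> V} :=
  HB.pack f (GRing.isLinear.Build C (fin R I) V *:%R f hf).
pose G : {linear fin R I -> V} :=
  HB.pack g (GRing.isLinear.Build C (fin R I) V *:%R g hg).
rewrite -[f]/(F : _ -> _) -[g]/(G : _ -> _) -(freeg_sumE u) !linear_sum.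
apply: eq_bigr => i _.
have -> : << coeff i u *g i >> = coeff i u *: << i >> :> fin R I.
  by apply/eqP/freeg_eqP => j; rewrite coeffZ !coeffU mul1r.
by rewrite !linearZ /= fg.
Qed.

Lemma fgliftE (I : choiceType) (V : lmodType C) (f : I -> V) i :
  fglift f (<< i >> : fin R I) = f i.
Proof. by rewrite liftU scale1r. Qed.

Definition wshift (I : choiceType) (w : I -> R) (s : I -> I) :
    fin R I -> fin R I :=
  fglift (fun i => (w i)%:C *: << s i >>).

Definition shift_gen (I : choiceType) (kap wE wF : I -> R) (s t : I -> I)
    (g : ugen) : fin R I -> fin R I :=
  match g with
  | gK => wshift kap id
  | gKinv => wshift (fun i => (kap i)^-1) id
  | gE => wshift wE s
  | gF => wshift wF t
  end.

End Fin.

Section ShiftRels.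
Context {R : realType} (q : R) (I : choiceType).
Context (kap wE wF : I -> R) (s t : I -> I).

Lemma wshift_linear (w : I -> R) (f : I -> I) : linear (wshift w f).
Proof. exact: fglift_linear. Qed.

Lemma wshiftE (w : I -> R) (f : I -> I) i :
  wshift w f << i >> = (w i)%:C *: << f i >>.
Proof. exact: fgliftE. Qed.

Lemma wshiftZ (w : I -> R) (f : I -> I) c v :
  wshift w f (c *: v) = c *: wshift w f v.
Proof. exact: (linear_scaleE (wshift_linear w f)). Qed.

Lemma shift_rels :
  (forall i, kap i != 0) ->
  (forall i, wE i * kap (s i) = q * (kap i * wE i)) ->
  (forall i, wF i * kap (t i) = q^-1 * (kap i * wF i)) ->
  (forall i, wE i = 0 \/ t (s i) = i) ->
  (forall i, wF i = 0 \/ s (t i) = i) ->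
  (forall i, wF i * wE (t i) - wE i * wF (s i) =
     (q - q^-1)^-1 * (kap i ^+ 2 - (kap i)^-1 ^+ 2)) ->
  urels q (shift_gen kap wE wF s t).
Proof.
move=> k0 hE hF hs ht hEF.
have lin := wshift_linear.
have compl := linear_comp_of; have scl := linear_scale_of.
have subl := linear_sub_of.
have idl : linear (fun v : fin R I => v) by [].
have W := (wshiftE, wshiftZ).
have rs (a b : R) (v : fin R I) : a%:C *: (b%:C *: v) = (a * b)%:C *: v.
  by rewrite scalerA rmorphM.
split.
- by case=> /=; exact: lin.
- apply: fin_ext => //=; first by apply: compl; exact: lin.
  by move=> i; rewrite !W rs mulVf ?k0 // rmorph1 scale1r.
- apply: fin_ext => //=; first by apply: compl; exact: lin.
  by move=> i; rewrite !W rs mulfV ?k0 // rmorph1 scale1r.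
- apply: fin_ext => /=; first by apply: compl; exact: lin.
    by apply: scl; apply: compl; exact: lin.
  by move=> i; rewrite !W !rs hE mulrA.
- apply: fin_ext => /=; first by apply: compl; exact: lin.
    by apply: scl; apply: compl; exact: lin.
  by move=> i; rewrite !W !rs hF mulrA.
- apply: fin_ext => /=; first by apply: subl; apply: compl; exact: lin.
    by apply: scl; apply: subl; apply: compl; exact: lin.
  move=> i; rewrite !W !rs -scalerBl -rmorphB /= rs -!expr2 -hEF rmorphB scalerBl.
  congr (_ - _).
    by case: (ht i) => [->|-> //]; rewrite mul0r !scale0r.
  by case: (hs i) => [->|-> //]; rewrite mul0r !scale0r.
Qed.

End ShiftRels.

Section Series.
Context {R : realType} (q : R).

Definition disc_up (k : R) (n : nat) : R :=
  (q^-1 - q)^-1 * (q `^ (- 2^-1 - k - n%:R) *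
    Num.sqrt ((1 - q `^ (2 * n%:R + 2)) * (1 - q `^ (4 * k + 2 * n%:R)))).

(* The weight vanishes for n = 0, so that e_{-1} (here e_(0.-1) = e_0) plays no
   role. *)
Definition disc_down (k : R) (n : nat) : R :=
  - ((q^-1 - q)^-1 * (q `^ (2^-1 - k - n%:R) *
    Num.sqrt ((1 - q `^ (2 * n%:R)) * (1 - q `^ (4 * k + 2 * n%:R - 2))))).

Definition pi_plus_gen (k : R) : ugen -> fin R nat -> fin R nat :=
  shift_gen (fun n => q `^ (k + n%:R)) (disc_up k) (disc_down k) succn predn.

Definition pi_minus_gen (k : R) : ugen -> fin R nat -> fin R nat :=
  shift_gen (fun n => q `^ (- (k + n%:R))) (disc_down k) (disc_up k) predn succn.

Definition princ_up (sigma eps : R) (n : int) : R :=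
  let x := n%:~R in
  (q^-1 - q)^-1 * (q `^ (- 2^-1 - x - eps) *
    Num.sqrt ((1 + q `^ (2 * x + 2 * eps + 2 * sigma + 1)) *
              (1 + q `^ (2 * x + 2 * eps - 2 * sigma + 1)))).

Definition princ_down (sigma eps : R) (n : int) : R :=
  let x := n%:~R in
  - ((q^-1 - q)^-1 * (q `^ (2^-1 - x - eps) *
    Num.sqrt ((1 + q `^ (2 * x + 2 * eps + 2 * sigma - 1)) *
              (1 + q `^ (2 * x + 2 * eps - 2 * sigma - 1))))).

Definition pi_S_gen (sigma eps : R) : ugen -> fin R int -> fin R int :=
  shift_gen (fun n => q `^ (n%:~R + eps)) (princ_up sigma eps)
    (princ_down sigma eps) (fun n => n + 1) (fun n => n - 1).

Context (hq : 0 < q < 1).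

Let q0 : 0 < q. Proof. by case/andP: hq. Qed.

Let pD x y : q `^ (x + y) = q `^ x * q `^ y.
Proof. by apply: powRD; rewrite (gt_eqF q0) implybT. Qed.

Let pN x : q `^ (- x) = (q `^ x)^-1.
Proof. exact: powRN. Qed.

Let p1 : q `^ 1 = q. Proof. by rewrite powRr1 // ltW. Qed.

Let p_gt0 x : 0 < q `^ x. Proof. exact: powR_gt0. Qed.

Let p_neq0 x : q `^ x != 0. Proof. by rewrite gt_eqF. Qed.

Let p2 x : q `^ (2 * x) = (q `^ x) ^+ 2.
Proof. by rewrite mulr_natl mulr2n pD expr2. Qed.

Let p4 x : q `^ (4 * x) = (q `^ x) ^+ 4.
Proof.
have -> : 4 * x = 2 * (2 * x) by rewrite mulrA -natrM.
by rewrite !p2 -exprM.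
Qed.

Let p_nat : q `^ 2 = q ^+ 2. Proof. by rewrite -[2 in LHS]mulr1 p2 p1. Qed.

Let p_half : (q `^ 2^-1) ^+ 2 = q.
Proof. by rewrite -p2 mulfV ?pnatr_eq0. Qed.

Let p_le1 x : 0 <= x -> q `^ x <= 1.
Proof.
by move=> x0; rewrite -(powRr0 q) ger_powR // q0 ltW //; case/andP: hq.
Qed.

Let q_lt1 : q < 1. Proof. by case/andP: hq. Qed.

Let qVq0 : q^-1 - q != 0.
Proof.
rewrite subr_eq0 gt_eqF //; apply: (lt_trans q_lt1).
by rewrite invf_gt1.
Qed.

Let q2_neq1 : 1 - q ^+ 2 != 0.
Proof. by rewrite subr_eq0 eq_sym lt_eqF // exprn_ilt1 // ltW. Qed.

Lemma disc_down0 k : disc_down k 0 = 0.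
Proof. by rewrite /disc_down mulr0 powRr0 subrr mul0r sqrtr0 !mulr0 oppr0. Qed.

Lemma disc_down_up (k : R) : 0 < k -> forall n, disc_down k n * disc_up k n.-1 =
  - (q^-1 - q)^-1 ^+ 2 * (q `^ (1 - 2 * k - 2 * n%:R) *
    ((1 - q `^ (2 * n%:R)) * (1 - q `^ (4 * k + 2 * n%:R - 2)))).
Proof.
move=> k0 [|n]; first by rewrite disc_down0 mul0r mulr0 powRr0 subrr mul0r !mulr0.
rewrite /disc_down /disc_up /=.
have -> : 2 * n%:R + 2 = 2 * n.+1%:R :> R by rewrite -natr1; ring.
have -> : 4 * k + 2 * n%:R = 4 * k + 2 * n.+1%:R - 2 :> R by rewrite -natr1; ring.
set A := (1 - _) * (1 - _).
have A0 : 0 <= A.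
  rewrite mulr_ge0 // subr_ge0 p_le1 //.
  by rewrite -natr1; have : 0 <= n%:R :> R by []; move: k0; lra.
have -> : 1 - 2 * k - 2 * n.+1%:R =
    (2^-1 - k - n.+1%:R) + (- 2^-1 - k - n%:R) :> R by rewrite -natr1; ring.
rewrite (pD (2^-1 - k - _)); set x := q `^ _; set y := q `^ _.
by rewrite -[A in RHS](sqr_sqrtr A0); ring.
Qed.

Lemma disc_EF (k : R) : 0 < k -> forall n,
  disc_down k n * disc_up k n.-1 - disc_up k n * disc_down k n.+1 =
  (q - q^-1)^-1 * ((q `^ (k + n%:R)) ^+ 2 - (q `^ (k + n%:R))^-1 ^+ 2).
Proof.
move=> k0 n; rewrite [disc_up k n * _]mulrC [X in _ - X](disc_down_up k0 n.+1).
rewrite disc_down_up // -natr1 !mulrDr !mulr1 !opprD !addrA.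
rewrite !(pD, pN, p1, p2, p4, p_nat).
have -> : q `^ n.+1%:R = q `^ n%:R * q by rewrite -natr1 pD p1.
have := p_neq0 k; have := p_neq0 n%:R.
set x := q `^ k; set y := q `^ n%:R => y0 x0.

have qq : 1 - q * q != 0 by rewrite -expr2.
have qq' : q * q - 1 != 0 by rewrite -opprB oppr_eq0.
by field; rewrite ?mulNr ?z0 ?y0 ?x0 ?qq ?qq' ?gt_eqF ?q0.
Qed.

Lemma princ_down_up (sigma eps : R) (n : int) :
  princ_down sigma eps n * princ_up sigma eps (n - 1) =
  - (q^-1 - q)^-1 ^+ 2 * (q `^ (1 - 2 * n%:~R - 2 * eps) *
    ((1 + q `^ (2 * n%:~R + 2 * eps + 2 * sigma - 1)) *
     (1 + q `^ (2 * n%:~R + 2 * eps - 2 * sigma - 1)))).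
Proof.
rewrite /princ_down /princ_up /= intrB; set x : R := n%:~R.
have -> : 2 * (x - 1) + 2 * eps + 2 * sigma + 1 =
  2 * x + 2 * eps + 2 * sigma - 1 by ring.
have -> : 2 * (x - 1) + 2 * eps - 2 * sigma + 1 =
  2 * x + 2 * eps - 2 * sigma - 1 by ring.
set A := (1 + _) * (1 + _).
have A0 : 0 <= A by rewrite mulr_ge0 // addr_ge0 // ltW.
have -> : 1 - 2 * x - 2 * eps =
    (2^-1 - x - eps) + (- 2^-1 - (x - 1) - eps) by field.
rewrite (pD (2^-1 - x - _)); set y := q `^ _; set z := q `^ _.
by rewrite -[A in RHS](sqr_sqrtr A0); ring.
Qed.

Lemma princ_EF (sigma eps : R) (n : int) :
  princ_down sigma eps n * princ_up sigma eps (n - 1) -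
  princ_up sigma eps n * princ_down sigma eps (n + 1) =
  (q - q^-1)^-1 * ((q `^ (n%:~R + eps)) ^+ 2 - (q `^ (n%:~R + eps))^-1 ^+ 2).
Proof.
have := princ_down_up sigma eps (n + 1); rewrite addrK => h.
rewrite [princ_up sigma eps n * _]mulrC h princ_down_up intrD.
rewrite !mulrDr !mulr1 !opprD !addrA.
rewrite !(pD, pN, p1, p2, p4, p_nat).
have := p_neq0 sigma; have := p_neq0 eps; have := p_neq0 n%:~R.
set x := q `^ sigma; set y := q `^ eps; set z := q `^ n%:~R => z0 y0 x0.

have qq : 1 - q * q != 0 by rewrite -expr2.
have qq' : q * q - 1 != 0 by rewrite -opprB oppr_eq0.
by field; rewrite ?mulNr ?z0 ?y0 ?x0 ?qq ?qq' ?gt_eqF ?q0.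
Qed.

Let pS x n : q `^ (x + n.+1%:R) = q `^ (x + n%:R) * q.
Proof. by rewrite -natr1 addrA (pD (x + n%:R)) p1. Qed.

Let pSN x n : q `^ (- (x + n.+1%:R)) = q^-1 * q `^ (- (x + n%:R)).
Proof. by rewrite !pN pS invfM mulrC. Qed.

Let pZS (n : int) x : q `^ ((n + 1)%:~R + x) = q `^ (n%:~R + x) * q.
Proof. by rewrite intrD addrAC (pD (n%:~R + x)) p1. Qed.

Let pZP (n : int) x : q `^ ((n - 1)%:~R + x) = q^-1 * q `^ (n%:~R + x).
Proof. by rewrite intrB addrAC (pD (n%:~R + x)) pN p1 mulrC. Qed.

Lemma pi_plus_urels k : 0 < k -> urels q (pi_plus_gen k).
Proof.
move=> k0; apply: shift_rels => [n|n|[|n]|n|[|n]|n] //=.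
- by rewrite pS; ring.
- by rewrite disc_down0 !(mul0r, mulr0).
- by rewrite pS; field; rewrite gt_eqF.
- by right.
- by left; exact: disc_down0.
- by right.
- exact: disc_EF.
Qed.

Lemma pi_minus_urels k : 0 < k -> urels q (pi_minus_gen k).
Proof.
move=> k0; apply: shift_rels => [n|[|n]|n|[|n]|n|n] //=.
- by rewrite disc_down0 !(mul0r, mulr0).
- by rewrite pSN; field; rewrite gt_eqF.
- by rewrite pSN; ring.
- by left; exact: disc_down0.
- by right.
- by right.
- by rewrite -opprB disc_EF // pN invrK -mulrN opprB.
Qed.

Lemma pi_S_urels sigma eps : urels q (pi_S_gen sigma eps).
Proof.
apply: shift_rels => n //=.
- by rewrite pZS; ring.
- by rewrite pZP; ring.
- by right; rewrite addrK.
- by right; rewrite subrK.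
- exact: princ_EF.
Qed.

Definition pi_plus k (k0 : 0 < k) : urepr q (fin R nat) :=
  urepr_of (pi_plus_urels k0).
Definition pi_minus k (k0 : 0 < k) : urepr q (fin R nat) :=
  urepr_of (pi_minus_urels k0).
Definition pi_S sigma eps : urepr q (fin R int) :=
  urepr_of (pi_S_urels sigma eps).

End Series.

Section Tensor.
Context {R : realType} (q : R) (I J : choiceType).
Local Notation C := R[i].

Definition fin_tens (u : fin R I) (v : fin R J) : fin R (I * J)%type :=
  fglift (fun i => fglift (fun j => << (i, j) >>) v) u.

Definition op_tens (A : fin R I -> fin R I) (B : fin R J -> fin R J) :
    fin R (I * J)%type -> fin R (I * J)%type :=
  fglift (fun ij => fin_tens (A << ij.1 >>) (B << ij.2 >>)).

(* Delta on the generators: the list of the pairs (X, Y) such that Delta(g) is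
   the sum of the elementary tensors X (x) Y.  Delta being an algebra
   homomorphism, (T1 (x) T2) Delta is the representation in which g acts as the
   sum of the T1(X) (x) T2(Y); see tens_repr. *)
Definition coproduct (g : ugen) : seq (Uq q * Uq q) :=
  let K := uq_gen q gK in let Kinv := uq_gen q gKinv in
  let E := uq_gen q gE in let F := uq_gen q gF in
  match g with
  | gK => [:: (K, K)]
  | gKinv => [:: (Kinv, Kinv)]
  | gE => [:: (K, E); (E, Kinv)]
  | gF => [:: (K, F); (F, Kinv)]
  end.

Definition tens_gen (T1 : urepr q (fin R I)) (T2 : urepr q (fin R J))
    (g : ugen) (w : fin R (I * J)%type) : fin R (I * J)%type :=
  \sum_(XY <- coproduct g) op_tens (T1 XY.1) (T2 XY.2) w.

Lemma fin_tensEl v : linear (fun u => fin_tens u v).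
Proof. exact: fglift_linear. Qed.

Lemma fin_tensEr u : linear (fin_tens u).
Proof.
move=> a v w; rewrite /fin_tens.
pose f (x : fin R J) := fun i : I => fglift (fun j => << (i, j) >>) x
  : fin R (I * J)%type.
have hf x := fglift_linear (f x).
move: u; apply: (@fin_ext _ _ _ (fglift (f (a *: v + w)))
  (fun u => a *: fglift (f v) u + fglift (f w) u)) => [||i].
- exact: hf.
- move=> b x y; rewrite !hf !scalerDr !scalerA [a * b]mulrC addrACA.
  by rewrite -!scalerA -scalerDr.
- by rewrite !fgliftE /f fglift_linear.
Qed.

Lemma fin_tens_basis i j : fin_tens << i >> << j >> = << (i, j) >>.
Proof. by rewrite /fin_tens !fgliftE. Qed.

Lemma fin_tensZl a u v : fin_tens (a *: u) v = a *: fin_tens u v.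
Proof. exact: (linear_scaleE (fin_tensEl v)). Qed.

Lemma fin_tensZr a u v : fin_tens u (a *: v) = a *: fin_tens u v.
Proof. exact: (linear_scaleE (fin_tensEr u)). Qed.

Lemma fin_tensBl u u' v : fin_tens (u - u') v = fin_tens u v - fin_tens u' v.
Proof.
by have := fin_tensEl v (-1) u' u; rewrite !scaleN1r ![- _ + _]addrC.
Qed.

Lemma fin_tensBr u v v' : fin_tens u (v - v') = fin_tens u v - fin_tens u v'.
Proof.
by have := fin_tensEr u (-1) v' v; rewrite !scaleN1r ![- _ + _]addrC.
Qed.

Lemma tens_ext (V : lmodType C) (f g : fin R (I * J)%type -> V) :
  linear f -> linear g -> (forall u v, f (fin_tens u v) = g (fin_tens u v)) ->
  f =1 g.
Proof.
by move=> hf hg h; apply: fin_ext => // -[i j]; rewrite -fin_tens_basis.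
Qed.

Lemma op_tens_linear A B : linear (op_tens A B).
Proof. exact: fglift_linear. Qed.

Lemma op_tensE A B u v : linear A -> linear B ->
  op_tens A B (fin_tens u v) = fin_tens (A u) (B v).
Proof.
move=> hA hB; move: u.
apply: (@fin_ext _ _ _ (fun u => op_tens A B (fin_tens u v))
  (fun u => fin_tens (A u) (B v))) => [||i].
- by apply: linear_comp_of; [exact: op_tens_linear|exact: fin_tensEl].
- by move=> a x y; rewrite hA fin_tensEl.
move: v; apply: (@fin_ext _ _ _ (fun v => op_tens A B (fin_tens << i >> v))
  (fun v => fin_tens (A << i >>) (B v))) => [||j].
- by apply: linear_comp_of; [exact: op_tens_linear|exact: fin_tensEr].
- by move=> a x y; rewrite hB fin_tensEr.
- by rewrite fin_tens_basis /op_tens fgliftE.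
Qed.

Context (hq : 0 < q < 1) (T1 : urepr q (fin R I)) (T2 : urepr q (fin R J)).

Lemma tens_gen_linear g : linear (tens_gen T1 T2 g).
Proof.
move=> a u v; rewrite /tens_gen scaler_sumr -big_split /=.
by apply: eq_bigr => XY _; rewrite op_tens_linear.
Qed.

Lemma urels_KiE (V : lmodType C) (T : ugen -> V -> V) : urels q T ->
  forall v, T gKinv (T gE v) = q^-1%:C *: T gE (T gKinv v).
Proof.
move=> [lin h1 h2 h3 _ _] v.
have lZ g := linear_scaleE (lin g).
have qn : q != 0 by case/andP: hq => q0 _; rewrite gt_eqF.
have := congr1 (T gKinv) (h3 (T gKinv v)); rewrite h2 h1 lZ => ->.
by rewrite scalerA -rmorphM mulVf // rmorph1 scale1r.
Qed.

Lemma urels_KiF (V : lmodType C) (T : ugen -> V -> V) : urels q T ->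
  forall v, T gKinv (T gF v) = q%:C *: T gF (T gKinv v).
Proof.
move=> [lin h1 h2 _ h4 _] v.
have lZ g := linear_scaleE (lin g).
have qn : q != 0 by case/andP: hq => q0 _; rewrite gt_eqF.
have := congr1 (T gKinv) (h4 (T gKinv v)); rewrite h2 h1 lZ => ->.
by rewrite scalerA -rmorphM mulfV // rmorph1 scale1r.
Qed.

Lemma tens_urels : urels q (tens_gen T1 T2).
Proof.
have R1 := urepr_urels T1; have R2 := urepr_urels T2.
have E1 := urels_KiE R1; have E2 := urels_KiE R2.
have F1 := urels_KiF R1; have F2 := urels_KiF R2.
case: R1 => _ a1 a2 a3 a4 a5; case: R2 => _ b1 b2 b3 b4 b5.
have l1 := uact_linear T1; have l2 := uact_linear T2.
have qn : q != 0 by case/andP: hq => q0 _; rewrite gt_eqF.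
have lin := tens_gen_linear.
have compl := linear_comp_of; have scl := linear_scale_of.
have subl := linear_sub_of.
have idl : linear (fun v : fin R (I * J)%type => v) by [].
have lD g := linear_addE (lin g).
have e g u v : tens_gen T1 T2 g (fin_tens u v) =
    \sum_(XY <- coproduct g) fin_tens (T1 XY.1 u) (T2 XY.2 v).
  by apply: eq_bigr => XY _; rewrite op_tensE.
have eK u v := e gK u v; have eKi u v := e gKinv u v.
have eE u v := e gE u v; have eF u v := e gF u v.
rewrite /coproduct !unlock /= in eK eKi eE eF.
split.
- exact: lin.
- apply: tens_ext => //=; first by apply: compl; exact: lin.
  by move=> u v; rewrite eKi addr0 eK a1 b1 addr0.
- apply: tens_ext => //=; first by apply: compl; exact: lin.
  by move=> u v; rewrite eK addr0 eKi a2 b2 addr0.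
- apply: tens_ext => /=; first by apply: compl; exact: lin.
    by apply: scl; apply: compl; exact: lin.
  move=> u v; rewrite eE !eK !addr0 lD !eK !addr0 eE addr0.
  by rewrite b3 a3 fin_tensZr fin_tensZl scalerDr b1 b2.
- apply: tens_ext => /=; first by apply: compl; exact: lin.
    by apply: scl; apply: compl; exact: lin.
  move=> u v; rewrite eF !eK !addr0 lD !eK !addr0 eF addr0.
  by rewrite b4 a4 fin_tensZr fin_tensZl scalerDr b1 b2.
- apply: tens_ext => /=; first by apply: subl; apply: compl; exact: lin.
    by apply: scl; apply: subl; apply: compl; exact: lin.
  move=> u v; rewrite eF eE eK eKi !addr0 !lD !eE !eF eK eKi !addr0.
  rewrite F2 a3 a4 E2 !(fin_tensZl, fin_tensZr).
  set A := fin_tens (T1 _ (T1 _ u)) (T2 (uq_gen q gE) (T2 _ v)).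
  set X := _ *: fin_tens _ _; set Y := _ *: fin_tens _ _.
  have zl (V : zmodType) (a x y d a' d' : V) :
      a + x + (y + d) - (a' + y + (x + d')) = (a - a') + (d - d').
    rewrite [y + d]addrC [a' + y]addrC [x + d']addrC !addrA !opprD !addrA.
    rewrite -[a + x + d + y - y]addrA subrr addr0.
    by rewrite addrAC [_ - a' - x]addrAC [a + x + d]addrAC addrK [a + d - a']addrAC.
  rewrite zl {zl} -fin_tensBr -fin_tensBl a5 b5 fin_tensZl fin_tensZr.
  by rewrite -scalerDr fin_tensBl fin_tensBr addrA subrK.
Qed.

Definition tens_repr : urepr q (fin R (I * J)%type) := urepr_of tens_urels.

End Tensor.

Section DirectSum.
Context {R : realType} (q : R) (I J : choiceType).
Local Notation C := R[i].

Definition fin_map (A B : choiceType) (f : A -> B) (u : fin R A) : fin R B :=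
  fglift (fun a => << f a >>) u.

Definition op_dsum (A : fin R I -> fin R I) (B : fin R J -> fin R J) :
    fin R (I + J)%type -> fin R (I + J)%type :=
  fglift (fun k => match k with
    | inl i => fin_map inl (A << i >>)
    | inr j => fin_map inr (B << j >>)
    end).

Context (T1 : urepr q (fin R I)) (T2 : urepr q (fin R J)).

Definition dsum_act (X : Uq q) := op_dsum (T1 X) (T2 X).

Lemma dsum_linear X : linear (dsum_act X).
Proof. exact: fglift_linear. Qed.

Lemma fin_map_linear (A B : choiceType) (f : A -> B) : linear (@fin_map A B f).
Proof. exact: fglift_linear. Qed.

Lemma dsum_inl X u : dsum_act X (fin_map inl u) = fin_map inl (T1 X u).
Proof.
move: u; apply: (@fin_ext _ _ _ (fun u => dsum_act X (fin_map inl u))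
  (fun u => fin_map inl (T1 X u))) => [||i].
- by apply: linear_comp_of; [exact: dsum_linear|exact: fin_map_linear].
- by apply: linear_comp_of; [exact: fin_map_linear|exact: uact_linear].
- by rewrite /fin_map /dsum_act /op_dsum !fgliftE.
Qed.

Lemma dsum_inr X u : dsum_act X (fin_map inr u) = fin_map inr (T2 X u).
Proof.
move: u; apply: (@fin_ext _ _ _ (fun u => dsum_act X (fin_map inr u))
  (fun u => fin_map inr (T2 X u))) => [||i].
- by apply: linear_comp_of; [exact: dsum_linear|exact: fin_map_linear].
- by apply: linear_comp_of; [exact: fin_map_linear|exact: uact_linear].
- by rewrite /fin_map /dsum_act /op_dsum !fgliftE.
Qed.

Lemma dsum_ext (V : lmodType C) (f g : fin R (I + J)%type -> V) :
  linear f -> linear g ->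
  (forall u, f (fin_map inl u) = g (fin_map inl u)) ->
  (forall u, f (fin_map inr u) = g (fin_map inr u)) -> f =1 g.
Proof.
move=> hf hg hl hr; apply: fin_ext => // -[i|j].
  by have := hl << i >>; rewrite /fin_map fgliftE.
by have := hr << j >>; rewrite /fin_map fgliftE.
Qed.

Lemma dsum1 v : dsum_act 1 v = v.
Proof.
move: v; apply: dsum_ext => [|//|u|u]; first exact: dsum_linear.
  by rewrite dsum_inl uact1.
by rewrite dsum_inr uact1.
Qed.

Lemma dsumM X Y v : dsum_act (X * Y) v = dsum_act X (dsum_act Y v).
Proof.
move: v; apply: dsum_ext => [||u|u]; first exact: dsum_linear.
- by apply: linear_comp_of; exact: dsum_linear.
- by rewrite !dsum_inl uactM.
- by rewrite !dsum_inr uactM.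
Qed.

Lemma dsumP c X Y v :
  dsum_act (c *: X + Y) v = c *: dsum_act X v + dsum_act Y v.
Proof.
move: v; apply: (@dsum_ext _ (dsum_act (c *: X + Y))
  (fun v => c *: dsum_act X v + dsum_act Y v)) => [||u|u].
- exact: dsum_linear.
- move=> a u v; rewrite !dsum_linear !scalerDr !scalerA [c * a]mulrC addrACA.
  by [].
- by rewrite !dsum_inl uactP fin_map_linear.
- by rewrite !dsum_inr uactP fin_map_linear.
Qed.

Definition dsum_repr : urepr q (fin R (I + J)%type) :=
  URepr dsum_linear dsum1 dsumM dsumP.

End DirectSum.

Section Hilbert.
Context {R : realType}.
Local Notation C := R[i].

Definition normc2 (z : C) : R := complex.Re z ^+ 2 + complex.Im z ^+ 2.

Definition sqnorm (I : choiceType) (v : I -> C) : \bar R :=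
  \esum_(i in [set: I]) (normc2 (v i))%:E.

Definition square_summable (I : choiceType) : pred (I -> C) :=
  fun v => (sqnorm v < +oo)%E.

(* l^2(I); the Hilbert space tensor product of l^2(I) and l^2(J) is l^2(I * J)
   with e_i (x) e_j = e_(i, j), the orthogonal sum of l^2(I) and l^2(J) is
   l^2(I + J), and the orthogonal sum of copies of l^2(J) indexed by M is
   l^2(M * J). *)
Definition l2 (I : choiceType) : Type := {v : I -> C | square_summable v}.

HB.instance Definition _ (I : choiceType) := SubChoice.on (l2 I).

Lemma normc2_ge0 z : 0 <= normc2 z.
Proof. by rewrite addr_ge0 ?sqr_ge0. Qed.

Lemma normc2D z w : normc2 (z + w) <= 2 * normc2 z + 2 * normc2 w.
Proof.
case: z w => a b [c d]; rewrite /normc2 /=.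
have := sqr_ge0 (a - c); have := sqr_ge0 (b - d); nra.
Qed.

Lemma normc2M z w : normc2 (z * w) = normc2 z * normc2 w.
Proof. by case: z w => a b [c d]; rewrite /normc2 /=; ring. Qed.

Lemma sqnormZ_lty (I : choiceType) (a : R) (f : I -> R) :
  0 <= a -> (forall i, 0 <= f i) ->
  (\esum_(i in [set: I]) (f i)%:E < +oo)%E ->
  (\esum_(i in [set: I]) (a * f i)%:E < +oo)%E.
Proof.
move=> a0 f0 fin_f.
apply: (@le_lt_trans _ _ (a%:E * \esum_(i in [set: I]) (f i)%:E)%E); last first.
  by rewrite lte_mul_pinfty ?lee_fin.
apply: ge_ereal_sup => _ [F [finF _] <-].
under eq_fsbigr do rewrite EFinM.
rewrite -ge0_mule_fsumr; last by move=> i; rewrite lee_fin.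
rewrite lee_wpmul2l ?lee_fin //.
by apply: ereal_sup_ubound; exists F.
Qed.

Lemma l2_closed (I : choiceType) : subsemimod_closed (@square_summable I).
Proof.
split; first split.
- rewrite /square_summable /sqnorm unfold_in /=.
  rewrite esum1 // => i _; rewrite /normc2 /=.
  by rewrite expr0n addr0.
- move=> u v hu hv; rewrite unfold_in /= in hu hv *.
  apply: (@le_lt_trans _ _ (\esum_(i in [set: I])
      ((2 * normc2 (u i))%:E + (2 * normc2 (v i))%:E))%E).
    by apply: le_esum => i _; rewrite lee_fin normc2D.
  rewrite esumD => [|i _|i _]; rewrite ?lee_fin ?mulr_ge0 ?normc2_ge0 //.
  by rewrite lte_add_pinfty // sqnormZ_lty // => i; exact: normc2_ge0.
- move=> a v hv; rewrite unfold_in /= in hv *.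
  change (\esum_(i in [set: I]) (normc2 ((a *: v) i))%:E < +oo)%E.
  rewrite (eq_esum (b := fun i => (normc2 a * normc2 (v i))%:E)); last first.
    by move=> i _; rewrite -normc2M.
  by apply: sqnormZ_lty => [|i|//]; exact: normc2_ge0.
Qed.

HB.instance Definition _ (I : choiceType) :=
  GRing.SubChoice_isSubLmodule.Build C (I -> C) (@square_summable I) (l2 I)
    (@l2_closed I).

Lemma fin_square_summable (I : choiceType) (u : fin R I) :
  square_summable (fun i => coeff i u).
Proof.
rewrite /square_summable /sqnorm.
rewrite (_ : \esum_(i in _) _ =
  \esum_(i in [set` dom u]) (normc2 (coeff i u))%:E); last first.
  rewrite [RHS]esum_mkcond; apply: eq_esum => i _.
  case: ifPn => //; rewrite notin_setE /= => /negP/coeff_outdom ->.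
  by rewrite /normc2 /= expr0n addr0.
rewrite esum_fset; last 2 first.
- exact: finite_seq.
- by move=> i _; rewrite lee_fin normc2_ge0.
by rewrite fsbig_finite ?finite_seq //= sumEFin ltry.
Qed.

Definition fin_l2 (I : choiceType) (u : fin R I) : l2 I :=
  Sub (fun i => coeff i u) (fin_square_summable u).

Definition unitary (I J : choiceType) (U : {linear l2 I -> l2 J}) : Prop :=
  (forall v, sqnorm (val (U v)) = sqnorm (val v)) /\
  (forall w, exists v, U v = w).

End Hilbert.

Section UnitaryEquivalence.
Context {R : realType} (q : R) (I M J : choiceType).
Context (T : urepr q (fin R I)) (S : M -> urepr q (fin R J)).

(* The graph of X in the orthogonal sum of the S_m: X acts componentwise on the
   v all of whose components are finite linear combinations of basis vectors and
   for which the resulting family of components is square summable.  (The domain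
   has to allow infinitely many nonzero components, since the image of a basis
   vector under the intertwiner has.) *)
Definition hsum_graph (X : Uq q) (v w : l2 (R := R) (M * J)%type) : Prop :=
  forall m, exists2 u : fin R J,
    (forall j, val v (m, j) = coeff j u) &
    (forall j, val w (m, j) = coeff j (S m X u)).

Definition unitary_intertwiner
    (U : {linear l2 (R := R) I -> l2 (R := R) (M * J)%type}) : Prop :=
  unitary U /\
  (forall X v, hsum_graph X (U (fin_l2 v)) (U (fin_l2 (T X v)))).

Definition unitarily_equivalent : Prop := exists U, unitary_intertwiner U.

End UnitaryEquivalence.

Section BigqJacobi.
Context {R : realType}.

Definition qpoch (x s : R) (n : nat) : R := \prod_(k < n) (1 - x * s ^+ k).

Definition qpochoo (x s : R) : R := limn (qpoch x s).

Definition qpochs (xs : seq R) (s : R) (n : nat) : R :=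
  \prod_(x <- xs) qpoch x s n.

Definition qpochsoo (xs : seq R) (s : R) : R := \prod_(x <- xs) qpochoo x s.

Definition qtheta (x s : R) : R := qpochsoo [:: x; s / x] s.

Context (a b c s : R).

Definition bqj_P (m : nat) (x : R) : R :=
  \sum_(k < m.+1)
    qpochs [:: s ^- m; a * b * s ^+ m.+1; x] s k /
    qpochs [:: s; a * s; c * s] s k * s ^+ k.

Definition bqj_u (x : R) : R :=
  qpochsoo [:: x / a; x / c] s / qpochsoo [:: x; b * x / c] s.

(* (1 - abs^{2m+1}) (abs; s)_m / (1 - abs), with the factor 1 - abs cancelled
   when abs = 1. *)
Definition bqj_quot (m : nat) : R :=
  let d := a * b * s in
  if d == 1 then
    if m is m'.+1 then (1 - a * b * s ^+ (2 * m).+1) * qpoch (d * s) s m' else 1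
  else (1 - a * b * s ^+ (2 * m).+1) / (1 - d) * qpoch d s m.

Definition bqj_v (m : nat) : R :=
  bqj_quot m / (a * s) *
  (qpochsoo [:: a * s; b * s; c * s; a * b * s / c] s /
   (qpochsoo [:: s; a * b * s ^+ 2] s * qtheta (c / a) s)) *
  (qpochs [:: a * s; c * s] s m / qpochs [:: s; b * s; a * b * s / c] s m) *
  (- a * c * s ^+ 2) ^- m * s ^- (m * m.-1)./2.

Definition bqj_r (x : R) (m : nat) : R :=
  Num.sqrt (`|x| * bqj_u x * bqj_v m) * bqj_P m x.

End BigqJacobi.

Section TensorProduct.
Context {R : realType} (q : R) (hq : 0 < q < 1).
Context (k1 k2 : R) (k1_gt0 : 0 < k1) (k2_gt0 : 0 < k2) (eps : R).

Definition Tprime : urepr q (fin R (nat * int + int * nat)%type) :=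
  dsum_repr
    (tens_repr hq (pi_minus hq k1_gt0) (pi_S hq (k2 - 2^-1) (eps + k2)))
    (tens_repr hq (pi_S hq (k1 - 2^-1) (- eps - k1)) (pi_plus hq k2_gt0)).

Definition Ssum (m : nat) : urepr q (fin R int) :=
  pi_S hq (k1 + k2 - 2^-1 + m%:R) (eps - k1 + k2).

End TensorProduct.

Section Coefficients.
Context {R : realType}.

Definition f_minus (p : int) (n : nat) : fin R (nat * int + int * nat)%type :=
  << inl (n, n%:Z + p) >>.

(* twoeps is the integer 2 * eps. *)
Definition f_plus (twoeps p : int) (n : nat) :
    fin R (nat * int + int * nat)%type :=
  << inr (twoeps - n%:Z + p, n) >>.

Context (q k1 k2 eps : R).

Let r (p : int) : R -> nat -> R :=
  bqj_r (q `^ (4 * k1 - 2)) (q `^ (4 * k2 - 2))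
    (- q `^ (4 * k1 - 2 * p%:~R - 2 * eps - 2)) (q ^+ 2).

Definition Theta_minus (p : int) (n m : nat) : R :=
  r p (q `^ (2 * n%:R + 4 * k1)) m.

Definition Theta_plus (p : int) (n m : nat) : R :=
  (-1) ^+ n * r p (- q `^ (2 * n%:R + 4 * k1 - 2 * p%:~R - 2 * eps)) m.

End Coefficients.

(* Main.v *)
Require Import Defs.
From HB Require Import structures.
From mathcomp Require Import all_boot all_order all_algebra.
From mathcomp Require Import all_classical all_reals all_analysis.
From mathcomp Require Import complex ring lra.
From mathcomp.multinomials Require Import freeg.

(* For fixed p the vectors f^-_{p,n}, f^+_{p,n} span a K-eigenspace, and Theta
   restricted to it is the matrix of normalized big q^2-Jacobi polynomials on
   their orthogonality grid, so it is unitary as soon as those polynomials are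
   orthogonal and complete.  Orthogonality reduces, through the q-Chu-Vandermonde
   sum, to the total mass of the weight; the mass obeys a first order recursion
   under (b, c) -> (bs, cs), obtained by telescoping, and is identified by
   letting the shift tend to infinity.  Completeness follows by approximating the
   point masses with Lagrange interpolants on the grid.  Replacing p by p + 1
   replaces c by c / s, and the contiguous relations between the parameters c and
   c / s say exactly that Theta intertwines E and F. *)

Set Implicit Arguments.
Unset Strict Implicit.
Unset Printing Implicit Defensive.

Import Order.TTheory GRing.Theory Num.Theory.
Import numFieldNormedType.Exports.

Local Open Scope ring_scope.
Local Open Scope complex_scope.

(** * q-shifted factorials *)

(** Multiplying the weight [bqj_u] by (x;s)_k (bx/c;s)_j gives again a big q-Jacobi weight, with
    parameters (as^k, bs^j, cs^k) and variable xs^k. Every such mixed moment is therefore a total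
    mass, which is why the polynomials are expanded in the basis (x;s)_k but tested against
    (bx/c;s)_j. The square roots in E and F come from the normalization: the quotients of [bqj_u]
    and of [bqj_v] under the shifts of x and c are the radicands of the tensor factors and of the
    summands. The lowest vectors e_0 of the discrete series sit at the ends of the two half-grids,
    where one coefficient of the contiguous relation vanishes. The image of a basis vector has
    infinitely many nonzero components, so intertwining is checked in each summand separately; there
    the map sends finite combinations to finite combinations, and the generators suffice. *)

Lemma eq_cvgn {R : realType} (f g : nat -> R) (l : R) :
  f =1 g -> (f @ \oo --> l)%classic -> (g @ \oo --> l)%classic.
Proof. by move=> /funext ->. Qed.

Section qPochhammer.
Context {R : realType} (s : R) (s_gt0 : 0 < s) (s_lt1 : s < 1).
Implicit Types (x y : R) (n : nat).
Local Open Scope classical_set_scope.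

Lemma qpoch0 x : qpoch x s 0 = 1.
Proof. by rewrite /qpoch big_ord0. Qed.

Lemma qpochS x n : qpoch x s n.+1 = qpoch x s n * (1 - x * s ^+ n).
Proof. by rewrite /qpoch big_ord_recr. Qed.

Lemma qpoch_recl x n : qpoch x s n.+1 = (1 - x) * qpoch (x * s) s n.
Proof.
rewrite /qpoch big_ord_recl expr0 mulr1; congr (_ * _).
by apply: eq_bigr => i _; rewrite -mulrA -exprS.
Qed.

Lemma qpochD x m n : qpoch x s (m + n) = qpoch x s m * qpoch (x * s ^+ m) s n.
Proof.
elim: m x => [|m ih] x; first by rewrite add0n qpoch0 mul1r expr0 mulr1.
by rewrite addSn !qpoch_recl ih mulrA exprS mulrA.
Qed.

Lemma exprs_le1 n : s ^+ n <= 1.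
Proof. by rewrite exprn_ile1 // ltW. Qed.

Lemma mulr_exps_lt1 x n : x < 1 -> x * s ^+ n < 1.
Proof.
move=> x1; have [x0|x0] := lerP 0 x; last first.
  by apply: le_lt_trans ltr01; rewrite mulr_le0_ge0 ?exprn_ge0 ?ltW.
by apply: le_lt_trans x1; rewrite ler_piMr // exprs_le1.
Qed.

Lemma qpoch_gt0 x n : x < 1 -> 0 < qpoch x s n.
Proof. by move=> x1; apply: prodr_gt0 => i _; rewrite subr_gt0 mulr_exps_lt1. Qed.

Lemma qpoch_anti x y n : x <= y -> y < 1 -> qpoch y s n <= qpoch x s n.
Proof.
move=> xy y1; apply: ler_prod => i _; rewrite subr_ge0 ltW ?mulr_exps_lt1 //=.
by rewrite lerD2l lerN2 ler_wpM2r // exprn_ge0 // ltW.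
Qed.

Lemma cvg_exps : s ^+ n @[n --> \oo] --> 0.
Proof. by apply: cvg_expr; rewrite gtr0_norm. Qed.

Lemma cvg_mul_exps x : x * s ^+ n @[n --> \oo] --> 0.
Proof. by rewrite -[X in _ --> X](mulr0 x); apply: cvgMr; exact: cvg_exps. Qed.

Lemma sum_exps_le n : \sum_(k < n) s ^+ k <= (1 - s)^-1.
Proof.
have s1 : 1 - s != 0 by rewrite subr_eq0 gt_eqF.
have -> : \sum_(k < n) s ^+ k = (1 - s ^+ n) / (1 - s).
  elim: n => [|n ih]; first by rewrite big_ord0 expr0 subrr mul0r.
  by rewrite big_ord_recr /= ih exprS; field.
rewrite ler_piMl ?invr_ge0 ?subr_ge0 ?(ltW s_lt1) //.
by rewrite gerBl exprn_ge0 // ltW.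
Qed.

(** The partial products increase and are bounded through 1 + y <= exp(y) and the geometric series.
    The bound [1 <= l] keeps the limit away from 0, so reciprocals of such products converge too. *)
Lemma prod_is_cvg (y : nat -> R) M : (forall k, 0 <= y k) ->
  (forall k, y k <= M * s ^+ k) ->
  exists2 l : R, 1 <= l & \prod_(k < n) (1 + y k) @[n --> \oo] --> l.
Proof.
move=> y0 yM.
have M0 : 0 <= M by have := le_trans (y0 0%N) (yM 0%N); rewrite expr0 mulr1.
pose P n := \prod_(k < n) (1 + y k).
have hP : {homo P : m n / (m <= n)%N >-> m <= n}.
  apply/nondecreasing_seqP => n; rewrite /P big_ord_recr /= ler_peMr ?lerDl //.
  by apply: prodr_ge0 => i _; rewrite addr_ge0.
have cP : cvgn P.
  apply: nondecreasing_is_cvgn => //; exists (expR (M / (1 - s))) => _ [n _ <-].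
  apply: (@le_trans _ _ (\prod_(k < n) expR (M * s ^+ k))).
    apply: ler_prod => i _; rewrite addr_ge0 //=.
    by apply: le_trans (expR_ge1Dx _); rewrite lerD2l.
  rewrite -expR_sum ler_expR -mulr_sumr ler_wpM2l //; exact: sum_exps_le.
exists (limn P); last exact: cP.
have := nondecreasing_cvgn_le hP cP 0%N.
by rewrite {1}/P big_ord0.
Qed.

Lemma qpoch_cvg x : x < 1 -> exists2 l : R, 0 < l & qpoch x s n @[n --> \oo] --> l.
Proof.
move=> x1; have [x0|x0] := lerP 0 x; last first.
  have [||l l1 hl] := @prod_is_cvg (fun k => - x * s ^+ k) (- x).
  - by move=> k; rewrite mulr_ge0 ?exprn_ge0 ?oppr_ge0 ?ltW.
  - by [].
  exists l; first exact: lt_le_trans l1.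
  by apply: eq_cvgn hl => n; apply: eq_bigr => k _; rewrite mulNr.
have hx k : 0 < 1 - x * s ^+ k by rewrite subr_gt0 mulr_exps_lt1.
(* For 0 <= x < 1 the factors are at most 1, so the criterion is applied to their reciprocals 1/(1 -
   xs^k) = 1 + xs^k/(1 - xs^k). *)
have [||l l1 hl] := @prod_is_cvg (fun k => x * s ^+ k / (1 - x * s ^+ k)) (x / (1 - x)).
- by move=> k; rewrite divr_ge0 ?(ltW (hx k)) // mulr_ge0 // exprn_ge0 // ltW.
- move=> k; rewrite [leRHS]mulrAC ler_wpM2l ?mulr_ge0 ?exprn_ge0 ?(ltW s_gt0) //.
  rewrite lef_pV2 ?posrE ?hx ?subr_gt0 // lerD2l lerN2.
  by rewrite ler_piMr // exprs_le1.
have l0 : 0 < l by exact: lt_le_trans l1.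
exists l^-1; first by rewrite invr_gt0.
apply: eq_cvgn (cvgV _ hl); last by rewrite gt_eqF.
move=> n; rewrite /= -prodfV.
apply: eq_bigr => k _; rewrite -[X in X + _](divff (lt0r_neq0 (hx k))) -mulrDl.
by rewrite subrK div1r invrK.
Qed.

Lemma cvg_qpoch x : x < 1 -> qpoch x s n @[n --> \oo] --> qpochoo x s.
Proof. by move=> /qpoch_cvg[l _ hl]; rewrite /qpochoo; apply/cvg_ex; exists l. Qed.

Lemma qpochoo_gt0 x : x < 1 -> 0 < qpochoo x s.
Proof. by move=> /qpoch_cvg[l l0 hl]; rewrite /qpochoo (cvg_lim _ hl). Qed.

Lemma qpochoo_neq0 x : x < 1 -> qpochoo x s != 0.
Proof. by move=> x1; rewrite gt_eqF // qpochoo_gt0. Qed.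

Lemma qpochoo_anti x y : x <= y -> y < 1 -> qpochoo y s <= qpochoo x s.
Proof.
move=> xy y1; have x1 := le_lt_trans xy y1.
apply: ler_cvg_to (cvg_qpoch y1) (cvg_qpoch x1) _.
by apply: nearW => n; exact: qpoch_anti.
Qed.

Lemma qpochoo0 : qpochoo 0 s = 1.
Proof.
apply: cvg_lim => //; apply: eq_cvgn (@cvg_cst _ (1 : R) nat \oo _) => n.
by rewrite /qpoch big1 // => i _; rewrite mul0r subr0.
Qed.

Lemma qpochoo_le1 x : 0 <= x -> x < 1 -> qpochoo x s <= 1.
Proof. by move=> x0 x1; rewrite -qpochoo0 qpochoo_anti. Qed.

Lemma qpochoo_ge1 x : x <= 0 -> 1 <= qpochoo x s.
Proof. by move=> x0; rewrite -qpochoo0 qpochoo_anti. Qed.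

Lemma qpochoo_qpoch x n : x < 1 -> qpochoo x s = qpoch x s n * qpochoo (x * s ^+ n) s.
Proof.
move=> x1; apply: cvg_lim => //.
have h : qpoch x s n * qpoch (x * s ^+ n) s m @[m --> \oo] -->
    qpoch x s n * qpochoo (x * s ^+ n) s.
  by apply: cvgMr; apply: cvg_qpoch; exact: mulr_exps_lt1.
by rewrite -(cvg_shiftn n); apply: eq_cvgn h => m; rewrite /= addnC qpochD.
Qed.

Lemma qpochoo_recl x : x < 1 -> qpochoo x s = (1 - x) * qpochoo (x * s) s.
Proof. by move=> x1; rewrite (qpochoo_qpoch 1%N) // qpochS qpoch0 mul1r mulr1. Qed.

(** The tail (xs^n;s)_oo is (x;s)_oo / (x;s)_n, whose numerator and denominator have the same
    nonzero limit. *)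
Lemma cvg_qpochoo x : x < 1 -> qpochoo (x * s ^+ n) s @[n --> \oo] --> (1 : R).
Proof.
move=> x1; rewrite -[X in _ --> X](divff (qpochoo_neq0 x1)).
have h : qpochoo x s / qpoch x s n @[n --> \oo] --> qpochoo x s / qpochoo x s.
  by apply: cvgMr; apply: cvgV (cvg_qpoch x1); exact: qpochoo_neq0.
apply: eq_cvgn h => n /=.
by rewrite (qpochoo_qpoch n x1) mulrAC divff ?mul1r // gt_eqF // qpoch_gt0.
Qed.

End qPochhammer.

(** * Total mass of the big q-Jacobi weight *)

Section JacksonSums.
Context {R : realType} (s : R) (s_gt0 : 0 < s) (s_lt1 : s < 1).
Implicit Types (z : R) (f g : R -> R).
Local Open Scope classical_set_scope.

Lemma geometric_dominated_cvg (h : nat -> R) M :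
  (forall k, `|h k| <= M * s ^+ k) -> cvgn (series h).
Proof.
move=> hM; apply: normed_cvg.
apply: (series_le_cvg _ _ hM) => //.
  by move=> k; exact: le_trans (hM k).
by apply: (is_cvg_geometric_series (a := M)); rewrite gtr0_norm.
Qed.

(** Up to the factor 1 - s, the series of these terms is the Jackson integral of f from 0 to zs. The
    grid starts at zs, like both halves of the big q-Jacobi grid. *)
Definition jackson_term z f (k : nat) : R := z * s ^+ k.+1 * f (z * s ^+ k.+1).

Definition jackson z f : R := limn (series (jackson_term z f)).

(** A limit along the grid makes f bounded there, hence the Jackson series absolutely convergent;
    the condition is stable under products and holds for the weight and for polynomials. *)
Definition grid_cvg z f := cvgn (fun k => f (z * s ^+ k.+1)).

Lemma grid_cvg_bounded z f : grid_cvg z f ->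
  exists2 M, 0 <= M & forall k, `|f (z * s ^+ k.+1)| <= M.
Proof.
move=> /cvg_seq_bounded[M [_ hM]]; exists (`|M| + 1); first by rewrite addr_ge0.
move=> k; apply: hM => //.
by apply: le_lt_trans (ler_norm M) _; rewrite ltrDl.
Qed.

Lemma jackson_cvg z f : grid_cvg z f ->
  series (jackson_term z f) @ \oo --> jackson z f.
Proof.
move=> /grid_cvg_bounded[M M0 hM].
apply: (@geometric_dominated_cvg _ (`|z| * M)) => k.
rewrite /jackson_term !normrM (ger0_norm (exprn_ge0 _ (ltW s_gt0))).
rewrite -!mulrA ler_wpM2l // mulrC ler_pM //.
  by rewrite exprn_ge0 // ltW.
by rewrite exprS ler_piMl ?exprn_ge0 // ltW.
Qed.

Lemma eq_jackson z f g : (forall k, f (z * s ^+ k.+1) = g (z * s ^+ k.+1)) ->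
  jackson z f = jackson z g.
Proof.
move=> fg; rewrite /jackson (_ : jackson_term z f = jackson_term z g) //.
by apply/funext => k; rewrite /jackson_term fg.
Qed.

Lemma jackson_lin z f g r : grid_cvg z f -> grid_cvg z g ->
  jackson z (fun x => f x + r * g x) = jackson z f + r * jackson z g.
Proof.
move=> hf hg; apply: cvg_lim => //.
have h : series (jackson_term z f) n + r * series (jackson_term z g) n @[n --> \oo]
    --> jackson z f + r * jackson z g.
  by apply: cvgD; [exact: jackson_cvg|apply: cvgMr; exact: jackson_cvg].
apply: eq_cvgn h => n; rewrite /series /= mulr_sumr -big_split /=.
by apply: eq_bigr => k _; rewrite /jackson_term; ring.
Qed.

Lemma jackson_recl z f : grid_cvg z f ->
  jackson (z * s) f = jackson z f - z * s * f (z * s).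
Proof.
move=> hf; apply: cvg_lim => //.
have h : series (jackson_term z f) n.+1 - z * s * f (z * s) @[n --> \oo]
    --> jackson z f - z * s * f (z * s).
  apply: cvgB; last exact: cvg_cst.
  by rewrite cvg_shiftS; exact: jackson_cvg.
apply: eq_cvgn h => n; rewrite /series /= big_nat_recl // /jackson_term expr1.
rewrite addrAC subrr add0r; apply: eq_bigr => k _.
by rewrite -(mulrA z s) -exprS.
Qed.

Lemma jackson_le z f (M : R) : grid_cvg z f -> (forall k, `|f (z * s ^+ k.+1)| <= M) ->
  `|jackson z f| <= `|z| * M / (1 - s).
Proof.
move=> hf hM; have M0 : 0 <= M := le_trans (normr_ge0 _) (hM 0%N).
apply: ler_cvg_to (cvg_norm (jackson_cvg hf)) (cvg_cst _) _.
apply: nearW => n; apply: le_trans (ler_norm_sum _ _ _) _.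
apply: (@le_trans _ _ (\sum_(0 <= k < n) `|z| * M * s ^+ k)).
  apply: ler_sum => k _; rewrite /jackson_term !normrM.
  rewrite (ger0_norm (exprn_ge0 _ (ltW s_gt0))) -!mulrA ler_wpM2l // mulrC.
  rewrite ler_pM ?exprn_ge0 ?(ltW s_gt0) // exprS.
  by rewrite ler_piMl ?exprn_ge0 // ltW.
by rewrite -mulr_sumr big_mkord ler_wpM2l ?mulr_ge0 // sum_exps_le.
Qed.

Lemma grid_cvgM z f g : grid_cvg z f -> grid_cvg z g -> grid_cvg z (fun x => f x * g x).
Proof. by move=> hf hg; exact: (is_cvgM hf hg). Qed.

Lemma grid_cvg_shift z f : grid_cvg z f -> grid_cvg (z * s) f.
Proof.
move=> /cvg_ex[l]; rewrite -(cvg_shiftS (fun k => f (z * s ^+ k.+1))) => hl.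
apply/cvg_ex; exists l; apply: eq_cvgn hl => k /=.
by rewrite -(mulrA z s) -exprS.
Qed.

Lemma cvg_grid z : z * s ^+ k.+1 @[k --> \oo] --> (0 : R).
Proof. by rewrite (cvg_shiftS (fun k => z * s ^+ k)); exact: cvg_mul_exps. Qed.

Lemma grid_cvg_id z : grid_cvg z id.
Proof. by apply/cvg_ex; exists 0; exact: cvg_grid. Qed.

Lemma grid_cvg_poly z (p : {poly R}) : grid_cvg z (horner p).
Proof.
have := cvg_grid z; move/(continuous_cvg _ (@continuous_horner _ p 0)) => h0.
by apply/cvg_ex; exists p.[0].
Qed.

End JacksonSums.

(** * The big q-Jacobi weight, its Pearson equation and the evaluation of its mass *)

Section Mass.
Context {R : realType} (s : R) (s_gt0 : 0 < s) (s_lt1 : s < 1).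
Local Open Scope classical_set_scope.

Local Notation "x `oo" := (qpochoo x s) (at level 1, format "x `oo").

Definition bqj_params (a b c : R) :=
  [/\ 0 < a, a * s < 1, 0 < b, b * s < 1 & c < 0].

(** Exactly the arguments of the four infinite products in [bqj_u]; below 1 these products are
    positive. *)
Definition bqj_domain (a b c x : R) :=
  [/\ x / a < 1, x / c < 1, x < 1 & b * x / c < 1].

(** Since c < 0, the Jackson terms on the second half-grid carry the factor x = -|x|, so the
    difference is the sum of |x| u(x) over the whole grid. *)
Definition bqj_mass a b c : R :=
  jackson s a (bqj_u a b c s) - jackson s c (bqj_u a b c s).

Definition bqj_mass_prod a b c : R :=
  a * s * (s`oo * (a * b * s ^+ 2)`oo * ((c / a)`oo * (a * s / c)`oo)) /
  ((a * s)`oo * (b * s)`oo * (c * s)`oo * (a * b * s / c)`oo).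

Lemma bqj_uE a b c x :
  bqj_u a b c s x = (x / a)`oo * (x / c)`oo / (x`oo * (b * x / c)`oo).
Proof. by rewrite /bqj_u /qpochsoo !big_cons !big_nil !mulr1. Qed.

(** The q-Pearson equation: replacing x by xs removes the first factor of each of the four
    products. *)
Lemma bqj_u_shift a b c x : bqj_domain a b c x ->
  bqj_u a b c s (x * s) * ((1 - x / a) * (1 - x / c)) =
  bqj_u a b c s x * ((1 - x) * (1 - b * x / c)).
Proof.
case=> h1 h2 h3 h4; rewrite !bqj_uE.
rewrite (qpochoo_recl s_gt0 s_lt1 h1) (qpochoo_recl s_gt0 s_lt1 h2).
rewrite (qpochoo_recl s_gt0 s_lt1 h3) (qpochoo_recl s_gt0 s_lt1 h4).
have -> : x * s / a = x / a * s by rewrite mulrAC.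
have -> : x * s / c = x / c * s by rewrite mulrAC.
have -> : b * (x * s) / c = b * x / c * s by rewrite mulrA mulrAC.
have n3 : 1 - x != 0 by rewrite subr_eq0 gt_eqF.
have n4 : 1 - b * x / c != 0 by rewrite subr_eq0 gt_eqF.
have m3 : (x * s)`oo != 0.
  by rewrite qpochoo_neq0 // -[s in x * s]expr1 mulr_exps_lt1.
have m4 : (b * x / c * s)`oo != 0.
  by rewrite qpochoo_neq0 // -[X in _ * X]expr1 mulr_exps_lt1.
move: n3 n4 m3 m4; move: (x / a) (b * x / c) (x / c) => y w t n3 n4 m3 m4.
by field; rewrite ?n3 ?n4 ?m3 ?m4.
Qed.

Section Params.
Context (a b c : R) (hp : bqj_params a b c).
Let a_gt0 : 0 < a. Proof. by case: hp. Qed.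
Let as_lt1 : a * s < 1. Proof. by case: hp. Qed.
Let b_gt0 : 0 < b. Proof. by case: hp. Qed.
Let bs_lt1 : b * s < 1. Proof. by case: hp. Qed.
Let c_lt0 : c < 0. Proof. by case: hp. Qed.
Let a_neq0 : a != 0. Proof. by rewrite gt_eqF. Qed.
Let c_neq0 : c != 0. Proof. by rewrite lt_eqF. Qed.
Let s_neq0 : s != 0. Proof. by rewrite gt_eqF. Qed.
Let sX_gt0 k : 0 < s ^+ k. Proof. by rewrite exprn_gt0. Qed.
Let sX_lt1 k : s ^+ k.+1 < 1. Proof. by rewrite exprn_ilt1 // ltW. Qed.
Let neg_lt1 (x : R) : x <= 0 -> x < 1.
Proof. by move=> x0; exact: le_lt_trans x0 ltr01. Qed.
Let div_c_lt1 x : 0 <= x -> x / c < 1.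
Proof. by move=> x0; apply/neg_lt1; rewrite mulr_ge0_le0 ?invr_le0 // ltW. Qed.
Let mul_c_lt1 x : 0 <= x -> c * x < 1.
Proof. by move=> x0; apply/neg_lt1; rewrite mulr_le0_ge0 // ltW. Qed.

Lemma bqj_domain_pos k : bqj_domain a b c (a * s ^+ k.+1).
Proof.
split.
- by rewrite mulrAC divff // mul1r.
- by apply/neg_lt1; rewrite mulr_ge0_le0 ?invr_le0 ?mulr_ge0 // ltW.
- by rewrite exprS mulrA mulr_exps_lt1.
- by apply/neg_lt1; rewrite mulr_ge0_le0 ?invr_le0 ?mulr_ge0 // ltW.
Qed.

Lemma bqj_domain_neg k : bqj_domain a b c (c * s ^+ k.+1).
Proof.
split.
- apply/neg_lt1; rewrite mulr_le0_ge0 ?invr_ge0 ?(ltW a_gt0) //.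
  by rewrite mulr_le0_ge0 // ltW.
- by rewrite mulrAC divff // mul1r.
- by apply/neg_lt1; rewrite mulr_le0_ge0 // ltW.
- by rewrite mulrCA mulrAC divff // mul1r exprS mulrA mulr_exps_lt1.
Qed.

Lemma bqj_u_ge0 x : bqj_domain a b c x -> 0 < bqj_u a b c s x.
Proof.
by case=> h1 h2 h3 h4; rewrite bqj_uE divr_gt0 // mulr_gt0 // qpochoo_gt0.
Qed.

Lemma cvg_bqj_u z : (forall k, bqj_domain a b c (z * s ^+ k.+1)) ->
  bqj_u a b c s (z * s ^+ k.+1) @[k --> \oo] --> (1 : R).
Proof.
move=> hz; have [h1 h2 h3 h4] := hz 0%N.
have h y : y * s < 1 -> (y * s ^+ k.+1)`oo @[k --> \oo] --> (1 : R).
  move=> ys; apply: eq_cvgn (cvg_qpochoo s_gt0 s_lt1 ys) => k /=.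
  by rewrite -mulrA -exprS.
have e (y : R) : z * s ^+ 1 / y = z / y * s by rewrite expr1 mulrAC.
rewrite e in h1; rewrite e in h2; rewrite expr1 in h3.
have {}h4 : b * z / c * s < 1 by move: h4; rewrite expr1 mulrA mulrAC.
have E : (z / a * s ^+ k.+1)`oo * (z / c * s ^+ k.+1)`oo /
    ((z * s ^+ k.+1)`oo * (b * z / c * s ^+ k.+1)`oo) @[k --> \oo] -->
    (1 * 1 / (1 * 1) : R).
  apply: cvgM; first by apply: cvgM; exact: h.
  apply: cvgV; first by rewrite mulr1 oner_neq0.
  by apply: cvgM; exact: h.
rewrite !mul1r invr1 in E.
apply: eq_cvgn E => k; rewrite bqj_uE.
by rewrite [z * _ / a]mulrAC [z * _ / c]mulrAC [b * (z * _)]mulrA [b * z * _ / c]mulrAC.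
Qed.

Lemma grid_cvg_bqj_u z : (forall k, bqj_domain a b c (z * s ^+ k.+1)) ->
  grid_cvg s z (bqj_u a b c s).
Proof. by move=> /cvg_bqj_u h; apply/cvg_ex; exists 1. Qed.

Let A := 1 + b / c - (a * s)^-1 - (c * s)^-1.
Let B := (a * c * s ^+ 2)^-1 - b / c.

(* [x u(x) (A + B x)] is the difference [g(x) - g(sx)] for
   [g(x) = u(x) (1 - x/(as)) (1 - x/(cs))], which vanishes at [as] and [cs] and
   tends to [1] at [0]. *)
Lemma jackson_pearson z : (forall k, bqj_domain a b c (z * s ^+ k.+1)) ->
  (1 - z / a) * (1 - z / c) = 0 ->
  jackson s z (fun x => bqj_u a b c s x * (A + B * x)) = -1.
Proof.
move=> hz z0.
(* [g k] is the boundary term at x = zs^(k+1), so x/s = zs^k appears in the linear factors, and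
   [g 0] contains the product assumed to vanish. *)
pose g (k : nat) := bqj_u a b c s (z * s ^+ k.+1) *
  ((1 - z * s ^+ k / a) * (1 - z * s ^+ k / c)).
have g1 : g @ \oo --> (1 : R).
  rewrite -[X in _ --> X]mul1r; apply: cvgM; first exact: cvg_bqj_u.
  have h y : 1 - z * s ^+ k / y @[k --> \oo] --> (1 : R).
    rewrite -[X in _ --> X]subr0; apply: cvgB; first exact: cvg_cst.
    rewrite -[X in _ --> X](mul0r y^-1); apply: cvgMl.
    exact: cvg_mul_exps.
  by rewrite -[X in _ --> X]mul1r; apply: cvgM; exact: h.
apply: cvg_lim => //.
apply: eq_cvgn (cvgN g1) => n; rewrite /series /=.
have g0 : g 0%N = 0 by rewrite /g expr0 mulr1 z0 mulr0.
have -> : (- g) n = g 0%N - g n by rewrite g0 sub0r.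
rewrite -[LHS]opprB -telescope_sumr // -sumrN; apply: eq_bigr => k _.
rewrite opprB /jackson_term /g.
have -> : z * s ^+ k.+2 = z * s ^+ k.+1 * s by rewrite -mulrA -exprSr.
rewrite (bqj_u_shift (hz k)).
have -> : z * s ^+ k = z * s ^+ k.+1 / s by rewrite exprSr mulrA mulfK.
by rewrite /A /B; field; rewrite s_neq0 c_neq0 a_neq0.
Qed.

(** [jackson_pearson] gives the same value -1 on both half-grids. In the difference the constants
    cancel, which leaves a linear relation between the mass and the first moment. *)
Lemma bqj_mass_moment :
  A * bqj_mass a b c +
  B * (jackson s a (fun x => bqj_u a b c s x * x) -
       jackson s c (fun x => bqj_u a b c s x * x)) = 0.
Proof.
have h z : (forall k, bqj_domain a b c (z * s ^+ k.+1)) ->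
    (1 - z / a) * (1 - z / c) = 0 ->
    A * jackson s z (bqj_u a b c s) + B * jackson s z (fun x => bqj_u a b c s x * x) = -1.
  move=> hz z0; rewrite -(jackson_pearson hz z0).
  have hu := grid_cvg_bqj_u hz.
  have hux := grid_cvgM hu (@grid_cvg_id _ _ s_gt0 s_lt1 z).
  have h0 : grid_cvg s z (fun=> 0) by exact: is_cvg_cst.
  have huA : grid_cvg s z (fun x => 0 + A * bqj_u a b c s x).
    by apply: is_cvgD; [exact: is_cvg_cst|apply: is_cvgMr].
  have j0 : jackson s z (fun=> 0) = 0.
    apply: cvg_lim => //; apply: eq_cvgn (@cvg_cst _ (0 : R) nat \oo _) => n.
    by rewrite /series /= big1 // => k _; rewrite /jackson_term mulr0.
  rewrite -[A * _]add0r -{1}j0 -jackson_lin // -jackson_lin //.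
  by apply: eq_jackson => k; ring.
have := h a bqj_domain_pos; rewrite divff // subrr mul0r => /(_ erefl) ha.
have := h c bqj_domain_neg; rewrite divff // subrr mulr0 => /(_ erefl) hc.
rewrite /bqj_mass !mulrBr addrACA -opprD ha hc; ring.
Qed.

Lemma bqj_params_shift : bqj_params a (b * s) (c * s).
Proof.
split=> //; first exact: mulr_gt0.
- apply: le_lt_trans bs_lt1; rewrite ler_piMr ?(ltW s_lt1) //.
  by rewrite ltW // mulr_gt0.
- by rewrite nmulr_rlt0.
Qed.

Lemma abs2_lt1 : a * b * s ^+ 2 < 1.
Proof.
have -> : a * b * s ^+ 2 = (a * s) * (b * s) by ring.
by rewrite mulr_ilt1 // ltW // mulr_gt0.
Qed.

(** The quotient b/c does not change, so the shifted weight only gains the factor 1 - x/(cs). Its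
    mass is thus a combination of the mass and the first moment of the original weight. *)
Let u_shift x : x / (c * s) < 1 ->
  bqj_u a (b * s) (c * s) s x = bqj_u a b c s x + (- (c * s)^-1) * (bqj_u a b c s x * x).
Proof.
move=> h; rewrite !bqj_uE (qpochoo_recl s_gt0 s_lt1 h).
have -> : x / (c * s) * s = x / c by field; rewrite s_neq0 c_neq0.
have -> : b * s * x / (c * s) = b * x / c by field; rewrite s_neq0 c_neq0.
by ring.
Qed.

Let div_cs_neg k : c * s ^+ k.+2 / (c * s) < 1.
Proof.
have -> : c * s ^+ k.+2 / (c * s) = s ^+ k.+1.
  by rewrite exprS; field; rewrite s_neq0 c_neq0.
exact: sX_lt1.
Qed.

Lemma bqj_mass_shift : bqj_mass a (b * s) (c * s) =
  - (a / c) * ((1 - b * s) * (1 - c * s) / (1 - a * b * s ^+ 2)) * bqj_mass a b c.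
Proof.
have hua := grid_cvg_bqj_u bqj_domain_pos.
have huc := grid_cvg_bqj_u bqj_domain_neg.
have huxa := grid_cvgM hua (@grid_cvg_id _ _ s_gt0 s_lt1 a).
have huxc := grid_cvgM huc (@grid_cvg_id _ _ s_gt0 s_lt1 c).
set ma := jackson s a (fun x => bqj_u a b c s x * x) in huxa *.
set mc := jackson s c (fun x => bqj_u a b c s x * x) in huxc *.
have -> : bqj_mass a (b * s) (c * s) = bqj_mass a b c - (ma - mc) / (c * s).
  rewrite /bqj_mass; have -> : jackson s a (bqj_u a (b * s) (c * s) s) =
      jackson s a (bqj_u a b c s) + (- (c * s)^-1) * ma.
    rewrite -jackson_lin //; apply: eq_jackson => k; apply: u_shift.
    apply/neg_lt1; rewrite mulr_ge0_le0 ?invr_le0 ?mulr_ge0 ?(ltW a_gt0) //.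
      by rewrite ltW.
    by rewrite ltW // nmulr_rlt0.
  have hl := @grid_cvg_shift _ _ c _ huc; have hlx := @grid_cvg_shift _ _ c _ huxc.
  have -> : jackson s (c * s) (bqj_u a (b * s) (c * s) s) =
      jackson s (c * s) (bqj_u a b c s) +
      (- (c * s)^-1) * jackson s (c * s) (fun x => bqj_u a b c s x * x).
    rewrite -jackson_lin //; apply: eq_jackson => k; apply: u_shift.
    by rewrite -mulrA -exprS div_cs_neg.
  (* The grid of cs lacks the point x = cs, but there 1 - x/(cs) is 0, so the two correction terms
     cancel. *)
  rewrite !jackson_recl // -/mc.
  by field; rewrite s_neq0 c_neq0.
have := bqj_mass_moment; rewrite -/ma -/mc.
have nz : 1 - a * b * s ^+ 2 != 0 by rewrite subr_eq0 gt_eqF // abs2_lt1.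
have e : B = (1 - a * b * s ^+ 2) / (a * c * s ^+ 2).
  by rewrite /B; field; rewrite s_neq0 c_neq0 a_neq0.
have nB : B != 0.
  by rewrite e !mulf_neq0 ?invr_neq0 ?mulf_neq0 ?expf_neq0.
move=> /eqP; rewrite addrC addr_eq0 => /eqP h.
have -> : ma - mc = - (A * bqj_mass a b c) / B by rewrite -h mulrAC divff ?mul1r.
rewrite e /A; field; rewrite s_neq0 c_neq0 a_neq0 ?nz //=.
Qed.

Lemma bqj_mass_prod_shift : bqj_mass_prod a (b * s) (c * s) =
  - (a / c) * ((1 - b * s) * (1 - c * s) / (1 - a * b * s ^+ 2)) *
  bqj_mass_prod a b c.
Proof.
have ca : c / a < 1 by apply: mul_c_lt1; rewrite invr_ge0 ltW.
have ac : a / c < 1 by apply: div_c_lt1; exact: ltW.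
have cs : c * s < 1 by apply: mul_c_lt1; exact: ltW.
rewrite /bqj_mass_prod.
have -> : a * (b * s) * s ^+ 2 = a * b * s ^+ 2 * s by ring.
have -> : c * s / a = c / a * s by ring.
have -> : a * s / (c * s) = a / c by field; rewrite s_neq0 c_neq0.
have -> : a * (b * s) * s / (c * s) = a * b * s / c by field; rewrite s_neq0 c_neq0.
have -> : a * s / c = a / c * s by ring.
rewrite (qpochoo_recl s_gt0 s_lt1 ca) (qpochoo_recl s_gt0 s_lt1 ac).
rewrite (qpochoo_recl s_gt0 s_lt1 abs2_lt1).
rewrite (qpochoo_recl s_gt0 s_lt1 cs) (qpochoo_recl s_gt0 s_lt1 bs_lt1).
have abc : a * b * s / c < 1.
  by apply: div_c_lt1; rewrite ltW // !mulr_gt0.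
have lt1s x : x < 1 -> x * s < 1 by move/(mulr_exps_lt1 s_gt0 s_lt1 1); rewrite expr1.
have n1 := qpochoo_neq0 s_gt0 s_lt1 abc.
have n2 := qpochoo_neq0 s_gt0 s_lt1 as_lt1.
have n3 := qpochoo_neq0 s_gt0 s_lt1 (lt1s _ cs).
have n4 := qpochoo_neq0 s_gt0 s_lt1 (lt1s _ bs_lt1).
have m1 : 1 - a * b * s ^+ 2 != 0 by rewrite subr_eq0 gt_eqF // abs2_lt1.
have m2 : 1 - b * s != 0 by rewrite subr_eq0 gt_eqF.
have m3 : 1 - c * s != 0 by rewrite subr_eq0 gt_eqF.
move: n1 n2 n3 n4.
move: (a * b * s / c)`oo (a * s)`oo (c * s * s)`oo (b * s * s)`oo => y1 y2 y3 y4.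
move: (a * b * s ^+ 2 * s)`oo (c / a * s)`oo (a / c * s)`oo => y5 y6 y7.
move=> n1 n2 n3 n4.
by field; rewrite c_neq0 a_neq0 m1 m2 m3 n1 n2 n3 n4.
Qed.

End Params.
Lemma bqj_params_iter a b c n : bqj_params a b c ->
  bqj_params a (b * s ^+ n) (c * s ^+ n).
Proof.
move=> hp; elim: n => [|n ih]; first by rewrite !expr0 !mulr1.
by rewrite exprSr !mulrA; exact: bqj_params_shift.
Qed.

(** Both sequences satisfy the same first order recursion, so their quotient does not depend on n;
    this is stated in cross-multiplied form. *)
Lemma bqj_mass_iter a b c n : bqj_params a b c ->
  bqj_mass a (b * s ^+ n) (c * s ^+ n) * bqj_mass_prod a b c =
  bqj_mass_prod a (b * s ^+ n) (c * s ^+ n) * bqj_mass a b c.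
Proof.
move=> hp; elim: n => [|n ih]; first by rewrite !expr0 !mulr1 mulrC.
have h := bqj_params_iter n hp.
rewrite exprSr ![_ * (s ^+ n * s)]mulrA bqj_mass_shift // bqj_mass_prod_shift //.
by rewrite -[LHS]mulrA ih mulrA.
Qed.

Lemma bqj_mass_prod_gt0 a b c : bqj_params a b c -> 0 < bqj_mass_prod a b c.
Proof.
move=> hp; have [a0 as1 b0 bs1 c0] := hp.
rewrite /bqj_mass_prod.
rewrite divr_gt0 // !mulr_gt0 ?qpochoo_gt0 //.
- exact: abs2_lt1 hp.
- by apply: lt_trans ltr01; rewrite pmulr_llt0 ?invr_gt0.
- by apply: lt_trans ltr01; rewrite nmulr_llt0 ?mulr_gt0 // invr_lt0.
- by apply: lt_trans ltr01; rewrite nmulr_rlt0.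
- by apply: lt_trans ltr01; rewrite nmulr_llt0 ?mulr_gt0 // invr_lt0.
Qed.

(* Along [b s^n, c s^n] all of the mass concentrates at the point [as]. *)
Lemma bqj_mass_ratio_cvg a b c : bqj_params a b c ->
  bqj_mass a (b * s ^+ n) (c * s ^+ n) / bqj_mass_prod a (b * s ^+ n) (c * s ^+ n)
    @[n --> \oo] --> (1 : R).
Proof.
move=> hp; have [a0 as1 b0 bs1 c0] := hp.
have sX n : 0 < s ^+ n by rewrite exprn_gt0.
have sX1 n : s ^+ n <= 1 by exact: exprs_le1.
have sXS n : s ^+ n.+1 < 1 by rewrite exprn_ilt1 // ltW.
have na : a != 0 by rewrite gt_eqF.
have nc : c != 0 by rewrite lt_eqF.
have ns : s != 0 by rewrite gt_eqF.
have nsX n : s ^+ n != 0 by rewrite gt_eqF.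
pose p n := bqj_mass_prod a (b * s ^+ n) (c * s ^+ n).
pose u n := bqj_u a (b * s ^+ n) (c * s ^+ n) s.
have hpn n := bqj_params_iter n hp.
have p_gt0 n : 0 < p n by exact: bqj_mass_prod_gt0.
have ua n : grid_cvg s a (u n) by apply: grid_cvg_bqj_u => // k; exact: bqj_domain_pos.
have uc n : grid_cvg s (c * s ^+ n) (u n).
  by apply: grid_cvg_bqj_u => // k; exact: bqj_domain_neg.
have upos n k : 0 < u n (a * s ^+ k.+1).
  by apply: bqj_u_ge0 => //; exact: bqj_domain_pos.
have uneg n k : 0 < u n (c * s ^+ n * s ^+ k.+1).
  by apply: bqj_u_ge0 => //; exact: bqj_domain_neg.
(* [d n] is the value of x/c at x = as for the parameter cs^n. It tends to -oo, and the growing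
   factor (d n;s)_oo is the scale against which all terms are measured. *)
pose d n := a * s / (c * s ^+ n).
have d_lt0 n : d n < 0.
  by rewrite /d nmulr_llt0 ?mulr_gt0 // invr_lt0 nmulr_rlt0.
have c1 n : c * s ^+ n < 1 by apply: lt_trans ltr01; rewrite nmulr_rlt0.
(* At x = as the factor (d n;s)_oo and all factors independent of n cancel against [p n]; the
   remaining arguments are multiples of s^n, so each remaining product tends to 1. *)
have first_term : a * s * u n (a * s) / p n @[n --> \oo] --> (1 : R).
  have e n : a * s * u n (a * s) / p n =
      (b * s * s ^+ n)`oo * (c * s * s ^+ n)`oo /
      ((a * b * s ^+ 2 * s ^+ n)`oo * (c / a * s ^+ n)`oo).
    rewrite /u /p bqj_uE /bqj_mass_prod.
    have -> : a * s / a = s by field.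
    have -> : b * s ^+ n * (a * s) / (c * s ^+ n) = a * b * s / c.
      by field; rewrite nsX nc.
    have -> : a * (b * s ^+ n) * s / (c * s ^+ n) = a * b * s / c.
      by field; rewrite nsX nc.
    have -> : a * (b * s ^+ n) * s ^+ 2 = a * b * s ^+ 2 * s ^+ n by ring.
    have -> : c * s ^+ n / a = c / a * s ^+ n by rewrite mulrAC.
    rewrite [b * s ^+ n * s]mulrAC [c * s ^+ n * s]mulrAC -/(d n).
    have m1 : (a * b * s / c)`oo != 0.
      apply: (qpochoo_neq0 s_gt0 s_lt1); apply: lt_trans ltr01.
      by rewrite nmulr_llt0 ?mulr_gt0 // invr_lt0.
    have m2 := qpochoo_neq0 s_gt0 s_lt1 as1.
    have m3 := qpochoo_neq0 s_gt0 s_lt1 s_lt1.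
    have m4 : (d n)`oo != 0.
      by apply: (qpochoo_neq0 s_gt0 s_lt1); exact: lt_trans (d_lt0 n) ltr01.
    have m5 : (a * b * s ^+ 2 * s ^+ n)`oo != 0.
      by rewrite qpochoo_neq0 // mulr_exps_lt1 // (abs2_lt1 hp).
    have m6 : (c / a * s ^+ n)`oo != 0.
      rewrite qpochoo_neq0 // mulr_exps_lt1 //; apply: lt_trans ltr01.
      by rewrite nmulr_rlt0 // invr_gt0.
    have m7 : (b * s * s ^+ n)`oo != 0 by rewrite qpochoo_neq0 // mulr_exps_lt1.
    have m8 : (c * s * s ^+ n)`oo != 0.
      rewrite qpochoo_neq0 // mulr_exps_lt1 //; apply: lt_trans ltr01.
      by rewrite nmulr_rlt0.
    move: m1 m2 m3 m4 m5 m6 m7 m8.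
    move: (a * b * s / c)`oo (a * s)`oo s`oo (d n)`oo (a * b * s ^+ 2 * s ^+ n)`oo
      => y1 y2 y3 y4 y5.
    move: (c / a * s ^+ n)`oo (b * s * s ^+ n)`oo (c * s * s ^+ n)`oo => y6 y7 y8.
    move=> m1 m2 m3 m4 m5 m6 m7 m8.
    by field; rewrite na ns m1 m2 m3 m4 m5 m6 m7 m8.
  have E : (b * s * s ^+ n)`oo * (c * s * s ^+ n)`oo /
      ((a * b * s ^+ 2 * s ^+ n)`oo * (c / a * s ^+ n)`oo) @[n --> \oo]
      --> (1 * 1 / (1 * 1) : R).
    apply: cvgM.
      apply: cvgM; apply: cvg_qpochoo => //; apply: lt_trans ltr01.
      by rewrite nmulr_rlt0.
    apply: cvgV; first by rewrite mulr1 oner_neq0.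
    apply: cvgM; apply: cvg_qpochoo => //; first exact: abs2_lt1 hp.
    by apply: lt_trans ltr01; rewrite nmulr_rlt0 // invr_gt0.
  rewrite !mul1r invr1 in E.
  by apply: eq_cvgn E => n; rewrite e.
(* [K] bounds p n / (d n;s)_oo from below: (abs^(n+2);s)_oo and (cs^(n+1);s)_oo are replaced by
   their values at n = 0, (cs^n/a;s)_oo is at least 1, and the other two products in the denominator
   are at most 1. *)
pose K := a * s * (s`oo * (a * b * s ^+ 2)`oo) / ((c * s)`oo * (a * b * s / c)`oo).
have K_gt0 : 0 < K.
  rewrite /K divr_gt0 ?mulr_gt0 ?qpochoo_gt0 ?(abs2_lt1 hp) //.
    by apply: lt_trans ltr01; rewrite nmulr_rlt0.
  by apply: lt_trans ltr01; rewrite nmulr_llt0 ?mulr_gt0 // invr_lt0.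
have p_ge n : K * (d n)`oo <= p n.
  rewrite /p /bqj_mass_prod -/(d n).
  have -> : K * (d n)`oo = a * s * (s`oo * ((a * b * s ^+ 2)`oo * (d n)`oo)) /
      ((c * s)`oo * (a * b * s / c)`oo) by rewrite /K; ring.
  have -> : a * (b * s ^+ n) * s / (c * s ^+ n) = a * b * s / c.
    by field; rewrite nsX nc.
  have abc1 : a * b * s / c < 1.
    by apply: lt_trans ltr01; rewrite nmulr_llt0 ?mulr_gt0 // invr_lt0.
  have d1 := lt_trans (d_lt0 n) ltr01.
  have cs1 : c * s ^+ n * s < 1.
    by apply: lt_trans ltr01; rewrite nmulr_rlt0 // nmulr_rlt0.
  have cs0 : c * s < 1 by apply: lt_trans ltr01; rewrite nmulr_rlt0.
  have bs1' : b * s ^+ n * s < 1 by rewrite mulrAC mulr_exps_lt1.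
  have q0 x : x < 1 -> 0 <= x`oo by move=> x1; rewrite ltW // qpochoo_gt0.
  have ab0 : 0 < a * b * s ^+ 2 by rewrite !mulr_gt0 // exprn_gt0.
  apply: ler_pM.
  - by rewrite !mulr_ge0 ?q0 ?(ltW a0) ?(ltW s_gt0) // (abs2_lt1 hp).
  - by rewrite invr_ge0 mulr_ge0 // q0.
  - rewrite ler_wpM2l ?mulr_ge0 ?(ltW a0) ?(ltW s_gt0) // -[leRHS]mulrA.
    rewrite ler_wpM2l ?q0 // ler_pM ?q0 ?(abs2_lt1 hp) //.
      rewrite qpochoo_anti ?(abs2_lt1 hp) //.
      have -> : a * (b * s ^+ n) * s ^+ 2 = a * b * s ^+ 2 * s ^+ n by ring.
      by rewrite ler_piMr // ltW.
    rewrite ler_peMl ?q0 // qpochoo_ge1 // mulr_le0_ge0 ?invr_ge0 ?(ltW a0) //.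
    by rewrite mulr_le0_ge0 // ltW.
  - rewrite lef_pV2 ?posrE ?mulr_gt0 ?qpochoo_gt0 //.
    rewrite ler_wpM2r ?q0 //; apply: (@le_trans _ _ (1 * 1 * (c * s)`oo)).
      rewrite ler_pM ?mulr_ge0 ?q0 // ?ler_pM ?q0 // ?qpochoo_le1 //.
      - by rewrite mulr_ge0 // ltW.
      - by rewrite !mulr_ge0 // ltW.
      - rewrite qpochoo_anti // mulrAC ler_nMr // ?nmulr_rlt0 //.
    by rewrite !mul1r.
(* On the positive points after as, x/c is at least s d n, and (s d n;s)_oo = (d n;s)_oo / (1 - d
   n): a factor of order s^n is gained over the first point. *)
pose C2 := a / (1 - s) / (a * s)`oo.
(* On the negative half-grid the weight is bounded uniformly in n, and the points themselves
   contribute the factor s^n. *)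
pose C3 := - c / (1 - s) * (c * s / a)`oo / (b * s)`oo.
have bound2 n : `|jackson s (a * s) (u n)| <= C2 * ((d n)`oo / (1 - d n)).
  have d1 := lt_trans (d_lt0 n) ltr01.
  have gu := @grid_cvg_shift _ _ a _ (ua n).
  have dd : (d n * s)`oo = (d n)`oo / (1 - d n).
    by rewrite [in RHS]qpochoo_recl // [RHS]mulrAC divff ?mul1r // subr_eq0 gt_eqF.
  have := @jackson_le _ _ s_gt0 s_lt1 _ _ ((d n * s)`oo / (a * s)`oo) gu.
  rewrite -dd => h; apply: le_trans (h _) _.
    move=> k; rewrite -mulrA -exprS ger0_norm; last exact: ltW.
    have [h1 h2 h3 h4] := bqj_domain_pos (hpn n) k.+1.
    have ds1 : d n * s < 1 by apply: lt_trans ltr01; rewrite nmulr_rlt0.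
    rewrite /u bqj_uE; apply: ler_pM.
    - by rewrite mulr_ge0 // ltW // qpochoo_gt0.
    - by rewrite invr_ge0 mulr_ge0 // ltW // qpochoo_gt0.
    - rewrite -[leRHS]mul1r ler_pM ?(ltW (qpochoo_gt0 _ _ _)) //.
        by rewrite qpochoo_le1 // mulrAC divff // mul1r ltW.
      rewrite qpochoo_anti //.
      have -> : a * s ^+ k.+2 / (c * s ^+ n) = d n * s ^+ k.+1.
        by rewrite /d exprS; ring.
      by rewrite ler_nM2l // exprS ler_piMr // ltW.
    - rewrite lef_pV2 ?posrE ?mulr_gt0 ?qpochoo_gt0 //.
      rewrite -[leLHS]mulr1 ler_pM ?(ltW (qpochoo_gt0 _ _ _)) //.
        by rewrite qpochoo_anti // exprS mulrA ler_piMr // ?mulr_ge0 // ltW.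
      rewrite qpochoo_ge1 // mulr_ge0_le0 ?invr_le0 ?nmulr_rle0 ?(ltW (sX _)) //.
      by apply: mulr_ge0; apply: mulr_ge0; apply: ltW.
  rewrite ger0_norm ?mulr_ge0 ?(ltW a0) ?(ltW s_gt0) // /C2.
  have -> : a * s * ((d n * s)`oo / (a * s)`oo) / (1 - s) =
    s * (a / (1 - s) / (a * s)`oo * (d n * s)`oo) by ring.
  rewrite ler_piMl ?(ltW s_lt1) // !mulr_ge0 ?invr_ge0 ?subr_ge0 ?(ltW s_lt1) //.
  - exact: ltW.
  - by rewrite ltW // qpochoo_gt0.
  - by rewrite ltW // qpochoo_gt0 //; apply: lt_trans ltr01; rewrite nmulr_rlt0.
have bound3 n : `|jackson s (c * s ^+ n) (u n)| <= C3 * s ^+ n.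
  have csa : c * s / a < 1.
    by apply: lt_trans ltr01; rewrite pmulr_llt0 ?invr_gt0 // nmulr_rlt0.
  have := @jackson_le _ _ s_gt0 s_lt1 _ _ ((c * s / a)`oo / (b * s)`oo) (uc n).
  move=> h; apply: le_trans (h _) _.
    move=> k; rewrite ger0_norm; last exact: ltW.
    have [h1 h2 h3 h4] := bqj_domain_neg (hpn n) k.
    rewrite /u bqj_uE; apply: ler_pM.
    - by rewrite mulr_ge0 // ltW // qpochoo_gt0.
    - by rewrite invr_ge0 mulr_ge0 // ltW // qpochoo_gt0.
    - rewrite -[leRHS]mulr1 ler_pM ?(ltW (qpochoo_gt0 _ _ _)) //.
        rewrite qpochoo_anti // ler_wpM2r ?invr_ge0 ?(ltW a0) //.
        rewrite -mulrA ler_wnM2l ?(ltW c0) // -exprD addnS exprS.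
        by rewrite ler_piMr // ltW.
      rewrite qpochoo_le1 // mulrAC divff ?mul1r ?(ltW (sX _)) //.
      by rewrite mulf_neq0.
    - rewrite lef_pV2 ?posrE ?mulr_gt0 ?qpochoo_gt0 //.
      rewrite -[leLHS]mul1r ler_pM ?(ltW (qpochoo_gt0 _ _ _)) //.
        by rewrite qpochoo_ge1 // mulr_le0_ge0 ?nmulr_rle0 // ltW.
      have -> : b * s ^+ n * (c * s ^+ n * s ^+ k.+1) / (c * s ^+ n) =
          b * s * (s ^+ n * s ^+ k).
        by rewrite exprS; field; rewrite nsX nc.
      rewrite qpochoo_anti // ler_piMr ?mulr_ge0 ?(ltW b0) ?(ltW s_gt0) //.
      by rewrite mulr_ile1 // ltW.
  rewrite ltr0_norm ?nmulr_rlt0 // /C3 le_eqVlt; apply/orP; left; apply/eqP.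
  ring.
have rest : (jackson s (a * s) (u n) - jackson s (c * s ^+ n) (u n)) / p n
    @[n --> \oo] --> (0 : R).
  pose C := (C2 * (- c / (a * s)) + C3) / K.
  have C2_ge0 : 0 <= C2.
    by rewrite /C2 !mulr_ge0 ?invr_ge0 ?subr_ge0 ?(ltW a0) ?(ltW s_lt1) // ltW // qpochoo_gt0.
  have C3_ge0 : 0 <= C3 * s ^+ 0 by apply: le_trans (bound3 0%N).
  rewrite expr0 mulr1 in C3_ge0.
  have h n : `|(jackson s (a * s) (u n) - jackson s (c * s ^+ n) (u n)) / p n| <=
      C * s ^+ n.
    rewrite normrM (gtr0_norm (x := (p n)^-1)) ?invr_gt0 // ler_pdivrMr //.
    have dn1 := lt_trans (d_lt0 n) ltr01.
    have D1 : 1 <= (d n)`oo by rewrite qpochoo_ge1 // ltW.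
    apply: le_trans (ler_normB _ _) _.
    apply: (@le_trans _ _ (C * s ^+ n * (K * (d n)`oo))); last first.
      rewrite ler_wpM2l // mulr_ge0 ?(ltW (sX n)) // /C divr_ge0 ?(ltW K_gt0) //.
      by rewrite addr_ge0 // mulr_ge0 // divr_ge0 ?oppr_ge0 ?mulr_ge0 // ltW.
    apply: le_trans (lerD (bound2 n) (bound3 n)) _.
    have -> : C * s ^+ n * (K * (d n)`oo) =
        C2 * ((d n)`oo * (- c / (a * s) * s ^+ n)) + C3 * s ^+ n * (d n)`oo.
      by rewrite /C; field; rewrite ?(gt_eqF K_gt0) ?na ?ns.
    apply: lerD; last by rewrite ler_peMr // mulr_ge0 // ltW.
    rewrite ler_wpM2l // ler_wpM2l ?(le_trans ler01) //.
    have -> : - c / (a * s) * s ^+ n = (- d n)^-1.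
      by rewrite /d; field; rewrite na ns nc nsX.
    rewrite lef_pV2 ?posrE ?oppr_gt0 ?subr_gt0 //.
    by rewrite lerDr.
  have C0 := cvg_mul_exps s_gt0 s_lt1 C.
  apply: (@squeeze_cvgr _ _ _ _ (fun n => - (C * s ^+ n)) (fun n => C * s ^+ n)).
  - by apply: nearW => n; rewrite -ler_norml.
  - by rewrite -oppr0; apply: cvgN.
  - exact: C0.
have E : a * s * u n (a * s) / p n +
    (jackson s (a * s) (u n) - jackson s (c * s ^+ n) (u n)) / p n
    @[n --> \oo] --> (1 + 0 : R) by exact: cvgD.
rewrite addr0 in E; apply: eq_cvgn E => n.
rewrite /= -mulrDl /bqj_mass -/(p n) -/(u n) jackson_recl //.
by congr (_ / _); ring.
Qed.

Lemma bqj_massE a b c : bqj_params a b c -> bqj_mass a b c = bqj_mass_prod a b c.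
Proof.
move=> hp; have p_gt0 := bqj_mass_prod_gt0 hp.
suff h : bqj_mass a b c / bqj_mass_prod a b c = 1 :> R.
  by rewrite -[LHS](divfK (lt0r_neq0 p_gt0)) h mul1r.
apply: cvg_unique (bqj_mass_ratio_cvg hp) => //.
apply: eq_cvgn (cvg_cst _) => n.
have pn_gt0 := bqj_mass_prod_gt0 (bqj_params_iter n hp).
apply/eqP; rewrite eq_sym eqr_div ?(gt_eqF p_gt0) ?(gt_eqF pn_gt0) //.
by rewrite bqj_mass_iter // mulrC.
Qed.

End Mass.

(** * Orthogonality of the big q-Jacobi polynomials *)

Section QChuVandermonde.
Context {R : realType} (s : R) (s_gt0 : 0 < s) (s_lt1 : s < 1).
Let s_neq0 : s != 0. Proof. by rewrite gt_eqF. Qed.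
Let sX_neq0 n : s ^+ n != 0. Proof. by rewrite expf_neq0. Qed.

Lemma qpoch_neq0 x n : x < 1 -> qpoch x s n != 0.
Proof. by move=> x1; rewrite gt_eqF // qpoch_gt0. Qed.

Lemma qpoch_negexp_eq0 m n : (m < n)%N -> qpoch (s ^- m) s n = 0.
Proof.
move=> mn; rewrite /qpoch (bigD1 (Ordinal mn)) //=.
by rewrite mulVf // subrr mul0r.
Qed.

Let expVS m : s ^- m.+1 * s = s ^- m.
Proof. by rewrite exprS; field; rewrite s_neq0 sX_neq0. Qed.

(** Each factor 1 - s^(-j) is -s^(-j) (1 - s^j) for 1 <= j <= m; the exponents add up to a
    triangular number. *)
Lemma qpoch_negexp m :
  qpoch (s ^- m) s m * s ^+ (m * m.+1)./2 = (-1) ^+ m * qpoch s s m.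
Proof.
elim: m => [|m ih]; first by rewrite !qpoch0 mulr1.
have -> : ((m.+1 * m.+2)./2 = (m * m.+1)./2 + m.+1)%N.
  by rewrite -addn2 mulnDr [(m.+1 * m)%N]mulnC muln2 halfD odd_double andbF doubleK.
rewrite qpoch_recl expVS qpochS exprD.
rewrite [RHS]mulrA [(-1) ^+ m.+1]exprS -[- 1 * _ * _]mulrA -ih exprS.
set t := s ^+ (_./2).
by field; rewrite s_neq0 sX_neq0.
Qed.

(** The first n terms of the 2phi1 series with upper parameters s^(-m), B, lower parameter C and
    argument s. Its terms vanish for k > m; the separate length allows padding by a zero term when
    consecutive m are compared. *)
Definition qhyp2 (B C : R) (m n : nat) : R :=
  \sum_(k < n) qpoch (s ^- m) s k * qpoch B s k /
    (qpoch s s k * qpoch C s k) * s ^+ k.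

(** Induction on m with B and C free. The difference (s^(-m-1);s)_k - (s^(-m);s)_k contains 1 - s^k,
    which cancels the last factor of (s;s)_k; after reindexing, the difference of the two sums is a
    multiple of the sum for m with Bs and Cs. *)
Lemma q_chu_vandermonde (B C : R) m : B != 0 -> C < 1 ->
  qhyp2 B C m m.+1 = qpoch (C / B) s m * B ^+ m / qpoch C s m.
Proof.
elim: m B C => [|m ih] B C B0 C1.
  by rewrite /qhyp2 big_ord_recl big_ord0 !qpoch0; field.
have ss : s * s ^+ m = s ^+ m.+1 by rewrite -exprS.
have Cs : C * s < 1 by have := mulr_exps_lt1 s_gt0 s_lt1 1 C1; rewrite expr1.
have step : qhyp2 B C m.+1 m.+2 - qhyp2 B C m m.+1 =
    - s ^- m * ((1 - B) / (1 - C)) * qhyp2 (B * s) (C * s) m m.+1.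
  have -> : qhyp2 B C m m.+1 = qhyp2 B C m m.+2.
    by rewrite /qhyp2 [RHS]big_ord_recr /= qpoch_negexp_eq0 // !mul0r addr0.
  rewrite /qhyp2 -sumrB big_ord_recl !qpoch0 subrr add0r mulr_sumr.
  apply: eq_bigr => k _; rewrite lift0.
  rewrite (qpoch_recl s (s ^- m.+1)) expVS (qpochS s (s ^- m)) (qpoch_recl s B).
  rewrite (qpoch_recl s C) (qpochS s s).
  have := qpoch_neq0 k s_lt1; have := qpoch_neq0 k Cs.
  have : 1 - s * s ^+ k != 0 by rewrite -exprS subr_eq0 gt_eqF // exprn_ilt1 // ltW.
  have : 1 - C != 0 by rewrite subr_eq0 gt_eqF.
  move: (qpoch (s ^- m) s k) (qpoch (B * s) s k) (qpoch s s k) (qpoch (C * s) s k).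
  move=> X Y Z W n1 n2 n3 n4; rewrite !exprS; have := sX_neq0 m.
  move: (s ^+ k) (s ^+ m) n2 => u v n2 n5.
  by field; rewrite n1 n2 n3 n4 n5 s_neq0.
have Bs : B * s != 0 by rewrite mulf_neq0.
have e1 : C * s / (B * s) = C / B by field; rewrite B0 s_neq0.
have := step; rewrite !ih // e1 => /(canRL (subrK _)) ->.
have n1 : 1 - C != 0 by rewrite subr_eq0 gt_eqF.
have n2 : 1 - C * s ^+ m != 0 by rewrite subr_eq0 gt_eqF // mulr_exps_lt1.
have -> : qpoch (C * s) s m = qpoch C s m * (1 - C * s ^+ m) / (1 - C).
  by rewrite -qpochS qpoch_recl mulrAC divff // mul1r.
rewrite !qpochS exprMn exprS; move: n2 (sX_neq0 m) (qpoch_neq0 m C1).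
move: (qpoch (C / B) s m) (qpoch C s m) (s ^+ m) => X Y u n2 n3 n4.
by field; rewrite n1 n2 n3 n4 B0.
Qed.

End QChuVandermonde.

(** A family with one member of each degree spans, by elimination of the top coefficient. It is
    applied to (bx/c;s)_j for orthogonality and to the Jacobi polynomials themselves for
    completeness. *)
Lemma poly_graded_ind {R : fieldType} (pi_ : nat -> {poly R}) (Q : {poly R} -> Prop) :
  (forall j, size (pi_ j) = j.+1) -> Q 0 ->
  (forall c p r, Q p -> Q r -> Q (c *: p + r)) ->
  forall m, (forall j, (j < m)%N -> Q (pi_ j)) ->
  forall p : {poly R}, (size p <= m)%N -> Q p.
Proof.
move=> sz Q0 QD; elim=> [|m ih] hQ p hp.
  by move: hp; rewrite leqn0 size_poly_eq0 => /eqP ->.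
have lm : lead_coef (pi_ m) != 0 by rewrite lead_coef_eq0 -size_poly_eq0 sz.
pose c := p`_m / lead_coef (pi_ m).
rewrite -[p](subrK (c *: pi_ m)) addrC; apply: QD; first exact: hQ.
apply: ih => [j jm|]; first exact: hQ (ltnW jm).
apply/leq_sizeP => j; rewrite leq_eqVlt => /predU1P[<-|mj].
  rewrite coefB coefZ /c -[X in _ * X]/((pi_ m)`_(m.+1.-1)) -(sz m).
  by rewrite -lead_coefE divfK // subrr.
rewrite coefB coefZ !nth_default ?mulr0 ?subrr ?sz //.
exact: leq_trans hp mj.
Qed.

(** * Mixed moments, orthogonality and norms *)

Section Orthogonality.
Context {R : realType} (s : R) (s_gt0 : 0 < s) (s_lt1 : s < 1).
Let s_neq0 : s != 0. Proof. by rewrite gt_eqF. Qed.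
Let sX_neq0 n : s ^+ n != 0. Proof. by rewrite expf_neq0. Qed.

(** This is (tX;s)_k. The value t = 1 gives the basis defining the polynomials and t = b/c the basis
    they are tested against: the arguments x and bx/c are those in the denominator of [bqj_u]. *)
Definition qpoch_poly (t : R) (k : nat) : {poly R} :=
  \prod_(i < k) (1 - (t * s ^+ i) *: 'X).

Lemma horner_qpoch_poly t k x : (qpoch_poly t k).[x] = qpoch (t * x) s k.
Proof.
rewrite /qpoch_poly horner_prod; apply: eq_bigr => i _.
by rewrite !hornerE mulrAC.
Qed.

Lemma size_lead_qpoch_poly t k : t != 0 ->
  size (qpoch_poly t k) = k.+1 /\
  lead_coef (qpoch_poly t k) = \prod_(i < k) (- (t * s ^+ i)).
Proof.
move=> t0.
have lin i : size (1 - (t * s ^+ i) *: 'X : {poly R}) = 2 /\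
    lead_coef (1 - (t * s ^+ i) *: 'X) = - (t * s ^+ i).
  have ti : - (t * s ^+ i) != 0 by rewrite oppr_eq0 mulf_neq0.
  have sz : size (- (t * s ^+ i) *: 'X : {poly R}) = 2 by rewrite size_scale // size_polyX.
  rewrite -scaleNr addrC size_polyDl ?sz ?size_poly1 //.
  by rewrite lead_coefDl ?sz ?size_poly1 // lead_coefZ lead_coefX mulr1.
elim: k => [|k [ih1 ih2]].
  by rewrite /qpoch_poly !big_ord0 size_poly1 lead_coef1.
have -> : qpoch_poly t k.+1 = qpoch_poly t k * (1 - (t * s ^+ k) *: 'X).
  by rewrite /qpoch_poly big_ord_recr.
have [l1 l2] := lin k; split.
  rewrite size_mul ?ih1 ?l1 ?addn2 //; first by rewrite -size_poly_eq0 ih1.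
  by rewrite -size_poly_eq0 l1.
by rewrite lead_coefM ih2 l2 [RHS]big_ord_recr.
Qed.

Definition bqj_coef (a b c : R) (m k : nat) : R :=
  qpochs [:: s ^- m; a * b * s ^+ m.+1] s k / qpochs [:: s; a * s; c * s] s k * s ^+ k.

Definition bqj_poly (a b c : R) (m : nat) : {poly R} :=
  \sum_(k < m.+1) bqj_coef a b c m k *: qpoch_poly 1 k.

Lemma bqj_coefE a b c m k : bqj_coef a b c m k =
  qpoch (s ^- m) s k * qpoch (a * b * s ^+ m.+1) s k /
  (qpoch s s k * (qpoch (a * s) s k * qpoch (c * s) s k)) * s ^+ k.
Proof. by rewrite /bqj_coef /qpochs !big_cons !big_nil !mulr1. Qed.

Lemma bqj_PE a b c m x : bqj_P a b c s m x =
  \sum_(k < m.+1) bqj_coef a b c m k * qpoch x s k.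
Proof.
rewrite /bqj_P; apply: eq_bigr => k _; rewrite /bqj_coef /qpochs.
by rewrite !big_cons !big_nil !mulr1; ring.
Qed.

Lemma horner_bqj_poly a b c m x : (bqj_poly a b c m).[x] = bqj_P a b c s m x.
Proof.
rewrite bqj_PE /bqj_poly horner_sum; apply: eq_bigr => k _.
by rewrite hornerZ horner_qpoch_poly mul1r.
Qed.

Definition bqj_int a b c (p : {poly R}) : R :=
  jackson s a (fun x => bqj_u a b c s x * p.[x]) -
  jackson s c (fun x => bqj_u a b c s x * p.[x]).

Section Params.
Context (a b c : R) (hp : bqj_params s a b c).
Let a_gt0 : 0 < a. Proof. by case: hp. Qed.
Let as_lt1 : a * s < 1. Proof. by case: hp. Qed.
Let b_gt0 : 0 < b. Proof. by case: hp. Qed.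
Let bs_lt1 : b * s < 1. Proof. by case: hp. Qed.
Let c_lt0 : c < 0. Proof. by case: hp. Qed.
Let a_neq0 : a != 0. Proof. by rewrite gt_eqF. Qed.
Let b_neq0 : b != 0. Proof. by rewrite gt_eqF. Qed.
Let c_neq0 : c != 0. Proof. by rewrite lt_eqF. Qed.
Let cs_lt1 : c * s < 1.
Proof. by apply: lt_trans ltr01; rewrite nmulr_rlt0. Qed.
Let abc_lt1 : a * b * s / c < 1.
Proof. by apply: lt_trans ltr01; rewrite nmulr_llt0 ?mulr_gt0 // invr_lt0. Qed.

Lemma abs_lt1 m : a * b * s ^+ m.+2 < 1.
Proof.
rewrite -[m.+2]add2n exprD mulrA; apply: mulr_exps_lt1 => //.
exact: abs2_lt1 hp.
Qed.

Lemma grid_cvg_up p z : (forall k, bqj_domain a b c (z * s ^+ k.+1)) ->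
  grid_cvg s z (fun x => bqj_u a b c s x * p.[x]).
Proof.
move=> hz; apply: grid_cvgM; first exact: grid_cvg_bqj_u.
exact: grid_cvg_poly.
Qed.

Lemma bqj_int_lin r p1 p2 :
  bqj_int a b c (r *: p1 + p2) = r * bqj_int a b c p1 + bqj_int a b c p2.
Proof.
have h z : (forall k, bqj_domain a b c (z * s ^+ k.+1)) ->
    jackson s z (fun x => bqj_u a b c s x * (r *: p1 + p2).[x]) =
    jackson s z (fun x => bqj_u a b c s x * p2.[x]) +
    r * jackson s z (fun x => bqj_u a b c s x * p1.[x]).
  move=> hz; rewrite -jackson_lin //; [|exact: grid_cvg_up|exact: grid_cvg_up].
  by apply: eq_jackson => k; rewrite hornerD hornerZ; ring.
rewrite /bqj_int (h a) ?(h c); [ring| |] => k.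
  exact: bqj_domain_neg.
exact: bqj_domain_pos.
Qed.

Lemma bqj_int0 : bqj_int a b c 0 = 0.
Proof.
have := bqj_int_lin 1 0 0; rewrite scale1r addr0 mul1r => /(congr1 (fun x => x - bqj_int a b c 0)).
by rewrite subrr addrK.
Qed.

Lemma bqj_int_sum (I : eqType) (r : seq I) (F : I -> R) (G : I -> {poly R}) :
  bqj_int a b c (\sum_(i <- r) F i *: G i) = \sum_(i <- r) F i * bqj_int a b c (G i).
Proof.
elim: r => [|i r ih]; first by rewrite !big_nil bqj_int0.
by rewrite !big_cons bqj_int_lin ih.
Qed.

Lemma jackson_scale z k f : grid_cvg s (z * s ^+ k) f ->
  jackson s (z * s ^+ k) f = s ^+ k * jackson s z (fun x => f (x * s ^+ k)).
Proof.
move=> hf; have e i : z * s ^+ i.+1 * s ^+ k = z * s ^+ k * s ^+ i.+1.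
  by rewrite mulrAC.
apply: cvg_lim => //.
have hg : grid_cvg s z (fun x => f (x * s ^+ k)).
  apply: cvgP; apply: eq_cvgn hf => i /=; first by rewrite e.
have E : (s ^+ k * series (jackson_term s z (fun x => f (x * s ^+ k))) n
    @[n --> \oo] --> s ^+ k * jackson s z (fun x => f (x * s ^+ k)))%classic.
  by apply: cvgMr; exact: jackson_cvg.
apply: eq_cvgn E => n; rewrite /series /= mulr_sumr; apply: eq_bigr => i _.
by rewrite /jackson_term e; ring.
Qed.

Lemma bqj_params_scale k j : bqj_params s (a * s ^+ k) (b * s ^+ j) (c * s ^+ k).
Proof.
split; rewrite ?mulr_gt0 ?nmulr_rlt0 ?exprn_gt0 // mulrAC mulr_exps_lt1 //.
Qed.

(** The two factors shorten the denominator of the weight. The substitution of xs^k for x then gives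
    s^(-k) times the mass for (as^k, bs^j, cs^k), which [bqj_massE] evaluates; c/a is unchanged, so
    the theta factor is too. *)
Lemma bqj_int_qpoch k j :
  bqj_int a b c (qpoch_poly 1 k * qpoch_poly (b / c) j) =
  bqj_mass_prod s a b c * (qpoch (a * s) s k * qpoch (c * s) s k) *
  (qpoch (b * s) s j * qpoch (a * b * s / c) s j) / qpoch (a * b * s ^+ 2) s (j + k).
Proof.
have hs := bqj_params_scale k j.
have shift z : (forall i, bqj_domain a b c (z * s ^+ i.+1)) ->
    (forall i, bqj_domain (a * s ^+ k) (b * s ^+ j) (c * s ^+ k) (z * s ^+ k * s ^+ i.+1)) ->
    jackson s z (fun x => bqj_u a b c s x * (qpoch_poly 1 k * qpoch_poly (b / c) j).[x]) =
    s ^- k * jackson s (z * s ^+ k) (bqj_u (a * s ^+ k) (b * s ^+ j) (c * s ^+ k) s).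
  move=> hz hz'; rewrite jackson_scale; last exact: grid_cvg_bqj_u.
  rewrite mulrA mulVf // mul1r; apply: eq_jackson => i.
  have [h1 h2 h3 h4] := hz i; set x := z * s ^+ i.+1 in h1 h2 h3 h4 *.
  rewrite hornerM !horner_qpoch_poly mul1r !bqj_uE.
  have -> : x * s ^+ k / (a * s ^+ k) = x / a by field; rewrite a_neq0 sX_neq0.
  have -> : x * s ^+ k / (c * s ^+ k) = x / c by field; rewrite c_neq0 sX_neq0.
  have -> : b * s ^+ j * (x * s ^+ k) / (c * s ^+ k) = b * x / c * s ^+ j.
    by field; rewrite c_neq0 sX_neq0.
  have -> : b / c * x = b * x / c by rewrite mulrAC.
  rewrite (qpochoo_qpoch s_gt0 s_lt1 k h3) (qpochoo_qpoch s_gt0 s_lt1 j h4).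
  have n1 := qpoch_neq0 s_gt0 s_lt1 k h3; have n2 := qpoch_neq0 s_gt0 s_lt1 j h4.
  have n3 : qpochoo (x * s ^+ k) s != 0 by rewrite qpochoo_neq0 // mulr_exps_lt1.
  have n4 : qpochoo (b * x / c * s ^+ j) s != 0.
    by rewrite qpochoo_neq0 // mulr_exps_lt1.
  by field; rewrite n1 n2 n3 n4.
rewrite /bqj_int !shift; try by move=> i; first [exact: bqj_domain_pos|exact: bqj_domain_neg].
rewrite -mulrBr -/(bqj_mass s _ _ _) bqj_massE // /bqj_mass_prod.
have -> : a * s ^+ k * s = a * s * s ^+ k by rewrite mulrAC.
have -> : b * s ^+ j * s = b * s * s ^+ j by rewrite mulrAC.
have -> : c * s ^+ k * s = c * s * s ^+ k by rewrite mulrAC.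
have -> : a * s ^+ k * (b * s ^+ j) * s ^+ 2 = a * b * s ^+ 2 * s ^+ (j + k).
  by rewrite exprD; ring.
have -> : c * s ^+ k / (a * s ^+ k) = c / a by field; rewrite a_neq0 sX_neq0.
have -> : a * s * s ^+ k / (c * s ^+ k) = a * s / c by field; rewrite c_neq0 sX_neq0.
have -> : a * s ^+ k * (b * s ^+ j) * s / (c * s ^+ k) = a * b * s / c * s ^+ j.
  by field; rewrite c_neq0 sX_neq0.
have abs1 := abs2_lt1 s_gt0 hp.
rewrite (qpochoo_qpoch s_gt0 s_lt1 k as_lt1) (qpochoo_qpoch s_gt0 s_lt1 k cs_lt1).
rewrite (qpochoo_qpoch s_gt0 s_lt1 j bs_lt1) (qpochoo_qpoch s_gt0 s_lt1 j abc_lt1).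
rewrite (qpochoo_qpoch s_gt0 s_lt1 (j + k)%N abs1).
have n1 := qpoch_neq0 s_gt0 s_lt1 k as_lt1; have n2 := qpoch_neq0 s_gt0 s_lt1 k cs_lt1.
have n3 := qpoch_neq0 s_gt0 s_lt1 j bs_lt1; have n4 := qpoch_neq0 s_gt0 s_lt1 j abc_lt1.
have n5 := qpoch_neq0 s_gt0 s_lt1 (j + k)%N abs1.
have oo_neq0 x i : x < 1 -> qpochoo (x * s ^+ i) s != 0.
  by move=> x1; rewrite qpochoo_neq0 // mulr_exps_lt1.
have n6 := oo_neq0 _ k as_lt1; have n7 := oo_neq0 _ k cs_lt1.
have n8 := oo_neq0 _ j bs_lt1; have n9 := oo_neq0 _ j abc_lt1.
move: (qpochoo (a * b * s ^+ 2 * s ^+ (j + k)) s) => X.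
by field; rewrite n1 n2 n3 n4 n5 n6 n7 n8 n9 sX_neq0.
Qed.

(** Against (bx/c;s)_j the factors (as;s)_k and (cs;s)_k of the k-th moment cancel those in the
    coefficients, and the sum over k is the q-Chu-Vandermonde sum with B = abs^(m+1) and C =
    abs^(j+2). *)
Lemma bqj_int_poly_qpoch m j :
  bqj_int a b c (bqj_poly a b c m * qpoch_poly (b / c) j) =
  bqj_mass_prod s a b c *
  (qpoch (b * s) s j * qpoch (a * b * s / c) s j / qpoch (a * b * s ^+ 2) s j) *
  (qpoch (s ^+ j.+1 / s ^+ m) s m * (a * b * s ^+ m.+1) ^+ m /
   qpoch (a * b * s ^+ j.+2) s m).
Proof.
have B0 : a * b * s ^+ m.+1 != 0 by rewrite !mulf_neq0.
have -> : s ^+ j.+1 / s ^+ m = a * b * s ^+ j.+2 / (a * b * s ^+ m.+1).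
  by rewrite !exprS; field; rewrite a_neq0 b_neq0 s_neq0 sX_neq0.
rewrite -q_chu_vandermonde ?abs_lt1 // /qhyp2 mulr_sumr.
rewrite /bqj_poly mulr_suml.
under eq_bigr do rewrite -scalerAl.
rewrite bqj_int_sum; apply: eq_bigr => k _; rewrite bqj_int_qpoch bqj_coefE qpochD.
have -> : a * b * s ^+ 2 * s ^+ j = a * b * s ^+ j.+2 by rewrite -mulrA -exprD.
have n1 := qpoch_neq0 s_gt0 s_lt1 k as_lt1; have n2 := qpoch_neq0 s_gt0 s_lt1 k cs_lt1.
have n3 := qpoch_neq0 s_gt0 s_lt1 k s_lt1.
have n4 := qpoch_neq0 s_gt0 s_lt1 j (abs2_lt1 s_gt0 hp).
have n5 := qpoch_neq0 s_gt0 s_lt1 k (abs_lt1 j).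
by field; rewrite n1 n2 n3 n4 n5.
Qed.

Lemma bqj_int_poly_qpoch_lt m j : (j < m)%N ->
  bqj_int a b c (bqj_poly a b c m * qpoch_poly (b / c) j) = 0.
Proof.
move=> jm; rewrite bqj_int_poly_qpoch.
suff -> : qpoch (s ^+ j.+1 / s ^+ m) s m = 0 by rewrite !mul0r mulr0.
(* The factor of index m - j - 1 in (s^(j+1-m);s)_m is 1 - s^0 = 0. *)
have h : (m - j.+1 < m)%N by rewrite ltn_subrL /= (leq_ltn_trans (leq0n j) jm).
rewrite /qpoch (bigD1 (Ordinal h)) //= mulrAC -exprD subnKC // divff //.
by rewrite subrr mul0r.
Qed.

Let bc_neq0 : b / c != 0. Proof. by rewrite mulf_neq0 // invr_neq0. Qed.

Lemma bqj_int_poly_lt m (p : {poly R}) : (size p <= m)%N -> bqj_int a b c (bqj_poly a b c m * p) = 0.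
Proof.
apply: (@poly_graded_ind _ (qpoch_poly (b / c)) (fun p => bqj_int a b c (_ * p) = 0)).
- by move=> j; case: (size_lead_qpoch_poly j bc_neq0).
- by rewrite mulr0 bqj_int0.
- by move=> r p1 p2 h1 h2; rewrite mulrDr -scalerAr bqj_int_lin h1 h2 mulr0 addr0.
- by move=> j jm; exact: bqj_int_poly_qpoch_lt.
Qed.

Lemma qpoch_abs_neq0 m : qpoch (a * b * s ^+ m.+1) s m != 0.
Proof. by case: m => [|m]; rewrite ?qpoch0 ?oner_neq0 // qpoch_neq0 // abs_lt1. Qed.

Lemma qpoch_negexp_neq0 m : qpoch (s ^- m) s m != 0.
Proof.
apply/eqP => h; have := qpoch_negexp s_gt0 m; rewrite h mul0r => /esym/eqP.
by rewrite mulf_eq0 signr_eq0 (negPf (qpoch_neq0 s_gt0 s_lt1 m s_lt1)).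
Qed.

Lemma bqj_coef_neq0 m : bqj_coef a b c m m != 0.
Proof.
rewrite bqj_coefE; apply: mulf_neq0 => //; apply: mulf_neq0.
  by rewrite mulf_neq0 // ?qpoch_negexp_neq0 // qpoch_abs_neq0.
by rewrite invr_neq0 // !mulf_neq0 // qpoch_neq0.
Qed.

(** The leading coefficients of (x;s)_m and (bx/c;s)_m differ by the factor (c/b)^m. Modulo lower
    degrees, which are orthogonal to P_m, one factor P_m of the squared norm may be replaced by a
    multiple of (bx/c;s)_m, so the norm is the case j = m of [bqj_int_poly_qpoch]. *)
Lemma bqj_poly_lead m :
  (size (bqj_poly a b c m -
    (bqj_coef a b c m m * (c / b) ^+ m) *: qpoch_poly (b / c) m)%R <= m)%N /\
  size (bqj_poly a b c m) = m.+1.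
Proof.
have [s1 l1] := size_lead_qpoch_poly m (oner_neq0 R).
have [s2 l2] := size_lead_qpoch_poly m bc_neq0.
have lE : lead_coef (qpoch_poly 1 m) = (c / b) ^+ m * lead_coef (qpoch_poly (b / c) m).
  rewrite l1 l2; transitivity (\prod_(i < m) (c / b * - (b / c * s ^+ i))).
    by apply: eq_bigr => i _ /=; field; rewrite b_neq0 c_neq0.
  by rewrite big_split /= prodr_const card_ord.
have low : (size (\sum_(k < m) bqj_coef a b c m k *: qpoch_poly 1 k)%R <= m)%N.
  apply: (leq_trans (size_sum _ _ _)); apply/bigmax_leqP => k _.
  by rewrite (leq_trans (size_scale_leq _ _)) // (size_lead_qpoch_poly _ _).1 ?oner_neq0.
rewrite /bqj_poly big_ord_recr /=; split; last first.
  by rewrite addrC size_polyDl size_scale ?bqj_coef_neq0 // s1 ltnS.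
rewrite -addrA (leq_trans (size_polyD _ _)) // geq_max low /=.
rewrite -scalerA -scalerBr (leq_trans (size_scale_leq _ _)) //.
apply/leq_sizeP => i; rewrite leq_eqVlt => /predU1P[<-|mi].
  rewrite coefB coefZ; move: lE; rewrite !lead_coefE s1 s2 /= => ->.
  by rewrite subrr.
by rewrite coefB coefZ !nth_default ?s1 ?s2 // mulr0 subr0.
Qed.

(** The number abs may equal or exceed 1, so the sign of [bqj_quot] is not visible from its
    definition. After multiplication by the positive (abs^(m+1);s)_m both branches give the same
    product of positive factors. *)
Lemma bqj_quotE m : bqj_quot a b s m * qpoch (a * b * s ^+ m.+1) s m =
  qpoch (a * b * s ^+ 2) s m * qpoch (a * b * s ^+ m.+2) s m.
Proof.
have E : bqj_quot a b s m =
    if m is m'.+1 then (1 - a * b * s ^+ (2 * m).+1) * qpoch (a * b * s ^+ 2) s m' else 1.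
  rewrite /bqj_quot; have e : a * b * s * s = a * b * s ^+ 2 by rewrite -mulrA.
  case: ifPn => [_|d1]; first by rewrite e.
  have {}d1 : 1 - a * b * s != 0 by rewrite subr_eq0 eq_sym.
  case: m => [|m]; first by rewrite muln0 expr1 divff // qpoch0 mulr1.
  by rewrite qpoch_recl e mulrA divfK.
case: m E => [|m] -> ; first by rewrite !qpoch0 !mulr1.
rewrite (qpoch_recl s (a * b * s ^+ m.+2)) (qpochS s (a * b * s ^+ 2)).
rewrite (qpochS s (a * b * s ^+ m.+3)).
have -> : a * b * s ^+ m.+2 * s = a * b * s ^+ m.+3 by rewrite -mulrA -exprSr.
have -> : a * b * s ^+ 2 * s ^+ m = a * b * s ^+ m.+2 by rewrite -mulrA -exprD.
have -> : a * b * s ^+ m.+3 * s ^+ m = a * b * s ^+ (2 * m.+1).+1.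
  by rewrite -mulrA -exprD; congr (_ * s ^+ _); rewrite mul2n -addnn !addSn addnS.
ring.
Qed.

Lemma bqj_norm m : bqj_int a b c (bqj_poly a b c m * bqj_poly a b c m) * bqj_v a b c s m = 1.
Proof.
have [hl _] := bqj_poly_lead m.
have := bqj_int_poly_lt hl; rewrite mulrBr -scalerAr addrC -scaleNr bqj_int_lin.
rewrite mulNr addrC => /eqP; rewrite subr_eq0 => /eqP ->.
rewrite bqj_int_poly_qpoch bqj_coefE /bqj_v /bqj_mass_prod /qpochsoo /qtheta.
rewrite /qpochsoo /qpochs !big_cons !big_nil !mulr1.
have -> : s / (c / a) = a * s / c by field; rewrite a_neq0 c_neq0.
have -> : s ^+ m.+1 / s ^+ m = s by rewrite exprS mulfK.
have T1 : ((m * m.+1)./2 = (m * m.-1)./2 + m)%N.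
  case: (m) => // n; rewrite -addn2 mulnDr muln2 halfD odd_double andbF doubleK.
  by rewrite add0n mulnC.
have T0 : (m * m = (m * m.-1)./2 + (m * m.-1)./2 + m)%N.
  by case: (m) => // n; rewrite addnn halfK oddM /= andNb subn0 mulnS addnC.
have h1 : qpoch (s ^- m) s m =
    (-1) ^+ m * qpoch s s m / (s ^+ (m * m.-1)./2 * s ^+ m).
  by rewrite -qpoch_negexp // T1 exprD mulfK // mulf_neq0.
have h2 : bqj_quot a b s m = qpoch (a * b * s ^+ 2) s m *
    qpoch (a * b * s ^+ m.+2) s m / qpoch (a * b * s ^+ m.+1) s m.
  by rewrite -bqj_quotE mulfK // qpoch_abs_neq0.
have e1 : (a * b * s ^+ m.+1) ^+ m = a ^+ m * b ^+ m *
    (s ^+ m * (s ^+ (m * m.-1)./2 * s ^+ (m * m.-1)./2 * s ^+ m)).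
  by rewrite !exprMn -exprM mulSn exprD T0 !exprD.
have e2 : (- a * c * s ^+ 2) ^+ m =
    (-1) ^+ m * a ^+ m * c ^+ m * (s ^+ m * s ^+ m).
  by rewrite !exprMn [(- a) ^+ m]exprNn.
have e3 : (c / b) ^+ m = c ^+ m / b ^+ m by rewrite exprMn exprVn.
rewrite h1 h2 e1 e2 e3.
have n1 := qpoch_neq0 s_gt0 s_lt1 m as_lt1; have n2 := qpoch_neq0 s_gt0 s_lt1 m cs_lt1.
have n3 := qpoch_neq0 s_gt0 s_lt1 m bs_lt1; have n4 := qpoch_neq0 s_gt0 s_lt1 m abc_lt1.
have n5 := qpoch_neq0 s_gt0 s_lt1 m s_lt1; have n6 := qpoch_abs_neq0 m.
have n7 := qpoch_neq0 s_gt0 s_lt1 m (abs2_lt1 s_gt0 hp).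
have n8 := qpoch_neq0 s_gt0 s_lt1 m (abs_lt1 m).
have m1 := qpochoo_neq0 s_gt0 s_lt1 as_lt1; have m2 := qpochoo_neq0 s_gt0 s_lt1 cs_lt1.
have m3 := qpochoo_neq0 s_gt0 s_lt1 bs_lt1; have m4 := qpochoo_neq0 s_gt0 s_lt1 abc_lt1.
have m5 := qpochoo_neq0 s_gt0 s_lt1 s_lt1.
have m6 := qpochoo_neq0 s_gt0 s_lt1 (abs2_lt1 s_gt0 hp).
have m7 : qpochoo (c / a) s != 0.
  by rewrite qpochoo_neq0 //; apply: lt_trans ltr01; rewrite nmulr_rlt0 // invr_gt0.
have m8 : qpochoo (a * s / c) s != 0.
  rewrite qpochoo_neq0 //; apply: lt_trans ltr01.
  by rewrite nmulr_llt0 ?mulr_gt0 // invr_lt0.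
have e0 : (-1) ^+ m != 0 :> R by rewrite signr_eq0.
have am : a ^+ m != 0 by rewrite expf_neq0.
have bm : b ^+ m != 0 by rewrite expf_neq0.
have cm : c ^+ m != 0 by rewrite expf_neq0.
have sm := sX_neq0 m; have st := sX_neq0 (m * m.-1)./2.
move: n1 n2 n3 n4 n5 n6 n7 n8 m1 m2 m3 m4 m5 m6 m7 m8 e0 am bm cm sm st.
move: (qpochoo (a * s) s) (qpochoo (b * s) s) (qpochoo (c * s) s)
  (qpochoo (a * b * s / c) s) (qpochoo s s) (qpochoo (a * b * s ^+ 2) s)
  (qpochoo (c / a) s) (qpochoo (a * s / c) s) => w1 w2 w3 w4 w5 w6 w7 w8.
move: (qpoch (a * s) s m) (qpoch (b * s) s m) (qpoch (c * s) s m)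
  (qpoch (a * b * s / c) s m) (qpoch s s m) (qpoch (a * b * s ^+ 2) s m)
  (qpoch (a * b * s ^+ m.+1) s m) (qpoch (a * b * s ^+ m.+2) s m)
  => v1 v2 v3 v4 v5 v6 v7 v8.
move: ((-1) ^+ m) (a ^+ m) (b ^+ m) (c ^+ m) (s ^+ m) (s ^+ (m * m.-1)./2)
  => e x y z u t n1 n2 n3 n4 n5 n6 n7 n8 m1 m2 m3 m4 m5 m6 m7 m8 e0 am bm cm sm st.
by field; rewrite a_neq0 s_neq0 n1 n2 n3 n4 n5 n6 n7 n8 m1 m2 m3 m4 m5 m6 m7 m8
  e0 am bm cm sm st.
Qed.

Lemma bqj_v_gt0 m : 0 < bqj_v a b c s m.
Proof.
have h := bqj_quotE m.
rewrite /bqj_v /qpochsoo /qtheta /qpochsoo /qpochs !big_cons !big_nil !mulr1.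
have e : s / (c / a) = a * s / c by field; rewrite a_neq0 c_neq0.
have ca1 : c / a < 1 by apply: lt_trans ltr01; rewrite nmulr_rlt0 // invr_gt0.
have ac1 : a * s / c < 1.
  by apply: lt_trans ltr01; rewrite nmulr_llt0 ?mulr_gt0 // invr_lt0.
have w_gt0 : 0 < qpoch (a * b * s ^+ m.+1) s m.
  by case: (m) => [|n]; rewrite ?qpoch0 // qpoch_gt0 // abs_lt1.
have qt : 0 < bqj_quot a b s m.
  by rewrite -(pmulr_lgt0 _ w_gt0) h mulr_gt0 // qpoch_gt0 // abs_lt1.
have ac : 0 < - a * c * s ^+ 2.
  by rewrite mulr_gt0 ?exprn_gt0 // mulNr oppr_gt0 pmulr_rlt0.
rewrite e; move: (- a * c * s ^+ 2) ac => z ac.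
rewrite !(mulr_gt0, divr_gt0) ?invr_gt0 ?exprn_gt0 ?mulr_gt0 ?qpochoo_gt0 ?qpoch_gt0 //.
exact: abs2_lt1 hp.
Qed.

Lemma bqj_int_orth m n :
  bqj_int a b c (bqj_poly a b c m * bqj_poly a b c n) = (m == n)%:R / bqj_v a b c s m.
Proof.
have [->|mn] := eqVneq m n.
  by rewrite -[LHS](mulfK (lt0r_neq0 (bqj_v_gt0 n))) bqj_norm.
rewrite mul0r; have sz k := (bqj_poly_lead k).2.
case: (ltngtP m n) mn => // h _; last by rewrite bqj_int_poly_lt // sz.
by rewrite mulrC bqj_int_poly_lt // sz.
Qed.

End Params.
End Orthogonality.

(** * Orthogonal infinite matrices *)

Section RealSequences.
Context {R : realType}.
Implicit Types (x y z : nat -> R).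
Local Open Scope classical_set_scope.

Definition ell2 x := cvgn (series (fun k => x k ^+ 2)).

Definition dot x y : R := limn (series (fun k => x k * y k)).

Lemma ell2_dot_cvg x y : ell2 x -> ell2 y ->
  series (fun k => x k * y k) @ \oo --> dot x y.
Proof.
move=> hx hy; apply: normed_cvg.
apply: (series_le_cvg _ _ _ (is_cvg_seriesD hx hy)) => k //=.
  by rewrite addr_ge0 // sqr_ge0.
rewrite -[leRHS]/(x k ^+ 2 + y k ^+ 2) normrM.
rewrite -(real_normK (num_real (x k))) -(real_normK (num_real (y k))).
have := sqr_ge0 (`|x k| - `|y k|); have := normr_ge0 (x k); have := normr_ge0 (y k).
by nra.
Qed.

Lemma dotC x y : dot x y = dot y x.
Proof. by rewrite /dot (_ : (fun k => _) = (fun k => y k * x k)) //; apply/funext => k; rewrite mulrC. Qed.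

Lemma ell2_bounded x M : (forall n, \sum_(k < n) x k ^+ 2 <= M) ->
  ell2 x /\ dot x x <= M.
Proof.
move=> h; have nd : {homo series (fun k => x k ^+ 2) : m n / (m <= n)%N >-> m <= n}.
  by apply/nondecreasing_seqP => n; rewrite seriesSr lerDl sqr_ge0.
have hb n : series (fun k => x k ^+ 2) n <= M by rewrite /series /= big_mkord.
have hx : ell2 x by apply: nondecreasing_is_cvgn => //; exists M => _ [n _ <-].
split=> //; rewrite /dot (_ : (fun k => _) = (fun k => x k ^+ 2)); last first.
  by apply/funext => k; rewrite expr2.
by apply: limr_le => //; exact: nearW.
Qed.

Lemma sum_sqr_le_dot x n : ell2 x -> \sum_(k < n) x k ^+ 2 <= dot x x.
Proof.
move=> hx; have nd : {homo series (fun k => x k ^+ 2) : m n / (m <= n)%N >-> m <= n}.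
  by apply/nondecreasing_seqP => m; rewrite seriesSr lerDl sqr_ge0.
rewrite /dot (_ : (fun k => _ * _) = (fun k => x k ^+ 2)); last first.
  by apply/funext => k; rewrite expr2.
by have := nondecreasing_cvgn_le nd hx n; rewrite {1}/series /= big_mkord.
Qed.

Lemma dot_ge0 x : ell2 x -> 0 <= dot x x.
Proof. by move=> hx; have := sum_sqr_le_dot 0 hx; rewrite big_ord0. Qed.

Lemma ell2_sqr_le x k : ell2 x -> x k ^+ 2 <= dot x x.
Proof.
move=> hx; apply: le_trans (sum_sqr_le_dot k.+1 hx).
by rewrite big_ord_recr /= lerDr sumr_ge0 // => i _; exact: sqr_ge0.
Qed.

Lemma ell2_lin r x y : ell2 x -> ell2 y -> ell2 (fun k => r * x k + y k).
Proof.
move=> hx hy.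
have h : cvgn (series (fun k => (2 * r ^+ 2) * x k ^+ 2 + 2 * y k ^+ 2)).
  have hx' := @is_cvg_seriesZ _ _ (2 * r ^+ 2) hx; have hy' := @is_cvg_seriesZ _ _ 2 hy.
  by have := is_cvg_seriesD hx' hy'.
apply: (series_le_cvg _ _ _ h) => k /=; first exact: sqr_ge0.
  have := sqr_ge0 (r * x k); have := sqr_ge0 (y k); rewrite exprMn.
  by lra.
have := sqr_ge0 (r * x k - y k).
by nra.
Qed.

Lemma dot_lin r x y z : ell2 x -> ell2 y -> ell2 z ->
  dot (fun k => r * x k + y k) z = r * dot x z + dot y z.
Proof.
move=> hx hy hz; apply: cvg_lim => //.
have h : r * series (fun k => x k * z k) n + series (fun k => y k * z k) n
    @[n --> \oo] --> r * dot x z + dot y z.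
  by apply: cvgD; [apply: cvgMr|]; exact: ell2_dot_cvg.
apply: eq_cvgn h => n; rewrite /series /= mulr_sumr -big_split /=.
by apply: eq_bigr => k _; ring.
Qed.

Lemma ell20 : ell2 (fun=> 0).
Proof.
have [|//] := @ell2_bounded (fun=> 0) 0 => n.
by rewrite big1 // => k _; rewrite expr0n.
Qed.

Lemma dot0 z : dot (fun=> 0) z = 0.
Proof.
apply: cvg_lim => //; apply: eq_cvgn (@cvg_cst _ (0 : R) nat \oo _) => n.
by rewrite /series /= big1 // => k _; rewrite mul0r.
Qed.

Lemma dot_sum (F : nat -> nat -> R) (c : nat -> R) n z :
  (forall i, ell2 (F i)) -> ell2 z ->
  ell2 (fun k => \sum_(i < n) c i * F i k) /\
  dot (fun k => \sum_(i < n) c i * F i k) z = \sum_(i < n) c i * dot (F i) z.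
Proof.
move=> hF hz; elim: n => [|n [ih1 ih2]].
  have -> : (fun k => \sum_(i < 0) c i * F i k) = (fun=> 0).
    by apply/funext => k; rewrite big_ord0.
  by rewrite dot0 big_ord0; split=> //; exact: ell20.
have -> : (fun k => \sum_(i < n.+1) c i * F i k) =
    (fun k => c n * F n k + \sum_(i < n) c i * F i k).
  by apply/funext => k; rewrite big_ord_recr addrC.
by split; [exact: ell2_lin|rewrite dot_lin // ih2 big_ord_recr addrC].
Qed.

Lemma dot_cauchy_schwarz x y : ell2 x -> ell2 y -> dot x y ^+ 2 <= dot x x * dot y y.
Proof.
move=> hx hy.
have pos t : 0 <= t ^+ 2 * dot y y + 2 * t * dot x y + dot x x.
  have h := @ell2_lin t _ _ hy hx; have := dot_ge0 h.
  rewrite dot_lin // (dotC y) (dotC x) !dot_lin // (dotC y x).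
  by congr (_ <= _); ring.
have [y0|y0] := eqVneq (dot y y) 0; last first.
  have {}y0 : 0 < dot y y by rewrite lt0r y0 dot_ge0.
  have := pos (- dot x y / dot y y).
  rewrite (_ : _ + _ = (dot x x * dot y y - dot x y ^+ 2) / dot y y); last first.
    by field; rewrite gt_eqF.
  by rewrite pmulr_lge0 ?invr_gt0 // subr_ge0.
have [->|xy0] := eqVneq (dot x y) 0; first by rewrite expr0n mulr_ge0 // dot_ge0.
(* When <y, y> = 0 the quadratic in t is affine, and this t gives it the value -1, against its
   nonnegativity. *)
have := pos (- (dot x x + 1) / (2 * dot x y)).
rewrite y0 mulr0 add0r (_ : _ + _ = -1) ?oppr_ge0 ?ler10 //.
by field.
Qed.

Definition delta_seq (i k : nat) : R := (k == i)%:R.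

Lemma sum_delta_seq i n (F : nat -> R) :
  \sum_(k < n) delta_seq i k * F k = if (i < n)%N then F i else 0.
Proof.
rewrite -(big_mkord xpredT (fun k => delta_seq i k * F k)).
case: ifPn => [hi|]; last first.
  rewrite -leqNgt => hi; rewrite big_nat big1 // => k /andP[_ kn].
  by rewrite /delta_seq ltn_eqF ?mul0r // (leq_trans kn).
rewrite (bigD1_seq i) ?mem_index_iota ?iota_uniq //= /delta_seq eqxx mul1r.
by rewrite big1 ?addr0 // => k /negPf ->; rewrite mul0r.
Qed.

Lemma dot_delta i y : dot (delta_seq i) y = y i.
Proof.
apply: cvg_lim => //; apply: cvg_near_cst; exists i.+1 => // n /= hn.
by rewrite /series /= big_mkord (sum_delta_seq i n y) hn.
Qed.

Lemma ell2_delta i : ell2 (delta_seq i).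
Proof.
have [|//] := @ell2_bounded (delta_seq i) 1 => n.
under eq_bigr do rewrite expr2.
by rewrite sum_delta_seq; case: ifP => _; rewrite /delta_seq ?eqxx.
Qed.

Definition trunc_seq x n : nat -> R := fun k => \sum_(i < n) x i * delta_seq i k.

Lemma trunc_seqE x n k : trunc_seq x n k = if (k < n)%N then x k else 0.
Proof.
rewrite -(sum_delta_seq k n x); apply: eq_bigr => i _.
by rewrite mulrC /delta_seq eq_sym.
Qed.

Lemma dot_tail x : ell2 x ->
  dot (fun k => -1 * trunc_seq x n k + x k) (fun k => -1 * trunc_seq x n k + x k)
    @[n --> \oo] --> (0 : R).
Proof.
move=> hx.
have e n : dot (fun k => -1 * trunc_seq x n k + x k) (fun k => -1 * trunc_seq x n k + x k)
    = dot x x - series (fun k => x k * x k) n.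
  have ht z : ell2 z -> ell2 (trunc_seq x n) /\
      dot (trunc_seq x n) z = \sum_(i < n) x i * z i.
    move=> hz; have [h1 h2] := dot_sum x n ell2_delta hz; split=> //.
    by rewrite h2; apply: eq_bigr => i _; rewrite dot_delta.
  have [t1 t2] := ht _ hx; have [_ t3] := ht _ t1.
  have hl := @ell2_lin (-1) _ _ t1 hx.
  rewrite dot_lin // (dotC (trunc_seq x n)) (dotC x) !dot_lin // (dotC x) t2 t3.
  have -> : \sum_(i < n) x i * trunc_seq x n i = \sum_(i < n) x i * x i.
    by apply: eq_bigr => i _; rewrite trunc_seqE ltn_ord.
  by rewrite /series /= big_mkord; ring.
have h : dot x x - series (fun k => x k * x k) n @[n --> \oo] --> dot x x - dot x x.
  by apply: cvgB; [exact: cvg_cst|exact: ell2_dot_cvg].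
by rewrite subrr in h; apply: eq_cvgn h => n; rewrite e.
Qed.

End RealSequences.

(** * Infinite matrices with orthonormal rows and columns *)

Section OrthogonalMatrix.
Context {R : realType}.
Implicit Types (v w : nat -> R).
Local Open Scope classical_set_scope.

Definition rows_orthonormal (T : nat -> nat -> R) :=
  (forall k, ell2 (T k)) /\ (forall k l, dot (T k) (T l) = (k == l)%:R).

(** The transpose of T acting on v: the basis vector e_k goes to the row [T k], as basis vectors do
    under the intertwiner. *)
Definition mx_act (T : nat -> nat -> R) v : nat -> R := fun m => dot v (T ^~ m).

Section Contraction.
Context (T : nat -> nat -> R) (hrow : rows_orthonormal T) (hcol : forall m, ell2 (T ^~ m)).

(** A finite combination of orthonormal rows has norm exactly that of its coefficients. The bound
    survives the limit because only the first M coordinates are kept while the number of rows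
    grows. *)
Lemma mx_act_contraction v : ell2 v ->
  ell2 (mx_act T v) /\ dot (mx_act T v) (mx_act T v) <= dot v v.
Proof.
move=> hv; apply: ell2_bounded => M.
have [h1 h2] := hrow.
pose S n m := \sum_(k < n) v k * T k m.
have norm_S n : ell2 (S n) /\ dot (S n) (S n) = \sum_(k < n) v k ^+ 2.
  have hS z : ell2 z -> ell2 (S n) /\ dot (S n) z = \sum_(k < n) v k * dot (T k) z.
    by move=> hz; exact: dot_sum.
  have [l1 _] := hS _ ell20; have [_ ->] := hS _ l1; split=> //.
  apply: eq_bigr => k _; rewrite dotC (hS _ (h1 k)).2 expr2; congr (_ * _).
  under eq_bigr do rewrite h2 mulrC.
  by have := sum_delta_seq k n v; rewrite ltn_ord.
have cvgS m : S n m @[n --> \oo] --> mx_act T v m.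
  apply: eq_cvgn (ell2_dot_cvg hv (@hcol m)) => n.
  by rewrite /series /= big_mkord.
have cvgM : \sum_(m < M) S n m ^+ 2 @[n --> \oo] --> \sum_(m < M) mx_act T v m ^+ 2.
  elim: M => [|M ih].
    by under eq_fun do rewrite big_ord0; rewrite big_ord0; exact: cvg_cst.
  rewrite big_ord_recr /=; under eq_fun do rewrite big_ord_recr /=.
  by apply: cvgD => //; rewrite expr2; under eq_fun do rewrite expr2; exact: cvgM.
apply: ler_cvg_to cvgM (cvg_cst _) _; apply: nearW => n.
have [l1 l2] := norm_S n.
apply: le_trans (sum_sqr_le_dot M l1) _; rewrite l2; exact: sum_sqr_le_dot.
Qed.

Lemma mx_act_lin r v w m : ell2 v -> ell2 w ->
  mx_act T (fun k => r * v k + w k) m = r * mx_act T v m + mx_act T w m.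
Proof. by move=> hv hw; exact: dot_lin. Qed.

Lemma mx_act_trunc v n m : mx_act T (trunc_seq v n) m = \sum_(k < n) v k * T k m.
Proof.
have [_ h] := dot_sum v n (@ell2_delta R) (@hcol m).
by rewrite /mx_act /trunc_seq h; apply: eq_bigr => k _; rewrite dot_delta.
Qed.

(** For truncations of v this is the orthonormality of the rows. The contraction property and the
    Cauchy-Schwarz inequality bound the error by the norm of the tail of v. *)
Lemma mx_actK v : ell2 v -> mx_act (fun m k => T k m) (mx_act T v) = v.
Proof.
move=> hv; apply/funext => l.
have [h1 h2] := hrow.
pose t n k := -1 * trunc_seq v n k + v k.
have ht n : ell2 (trunc_seq v n) by case: (dot_sum v n (@ell2_delta R) hv).
have htl n : ell2 (t n) by exact: ell2_lin.
pose B w := dot w (T l).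
have Btrunc n : (l < n)%N -> B (mx_act T (trunc_seq v n)) = v l.
  move=> ln; have -> : mx_act T (trunc_seq v n) = fun m => \sum_(k < n) v k * T k m.
    by apply/funext => m; rewrite mx_act_trunc.
  rewrite /B (dot_sum v n h1 (h1 l)).2; under eq_bigr do rewrite h2 mulrC.
  by have := sum_delta_seq l n v; rewrite ln.
have BtE n : (l < n)%N -> B (mx_act T (t n)) = B (mx_act T v) - v l.
  move=> ln; rewrite -(Btrunc n ln) /B.
  have -> : mx_act T (t n) = fun m => -1 * mx_act T (trunc_seq v n) m + mx_act T v m.
    by apply/funext => m; rewrite mx_act_lin.
  by rewrite dot_lin ?mulN1r 1?addrC //; [case: (mx_act_contraction (ht n))|
    case: (mx_act_contraction hv)].
have le n : (l < n)%N -> (B (mx_act T v) - v l) ^+ 2 <= dot (t n) (t n).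
  move=> ln; rewrite -(BtE n) //; have [c1 c2] := mx_act_contraction (@htl n).
  apply: le_trans (dot_cauchy_schwarz c1 (h1 l)) _.
  by rewrite h2 eqxx mulr1.
have h0 : (B (mx_act T v) - v l) ^+ 2 <= 0.
  apply: ler_cvg_to (cvg_cst _) (dot_tail hv) _.
  by exists l.+1 => // n /= ln; exact: le.
have /eqP : (B (mx_act T v) - v l) ^+ 2 = 0 by apply/eqP; rewrite eq_le h0 sqr_ge0.
by rewrite sqrf_eq0 subr_eq0 => /eqP.
Qed.

End Contraction.

(** Both T and its transpose contract, and one undoes the other. *)
Lemma mx_act_isometry (T : nat -> nat -> R) v :
  rows_orthonormal T -> rows_orthonormal (fun m k => T k m) -> ell2 v ->
  dot (mx_act T v) (mx_act T v) = dot v v.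
Proof.
move=> hr hc hv; have [c1 c2] := mx_act_contraction hr hc.1 hv.
have [d1 d2] := mx_act_contraction hc hr.1 c1.
by apply/eqP; rewrite eq_le c2 -{1 2}(mx_actK hr hc.1 hv).
Qed.

(** As the columns are orthonormal, the expression in the hypothesis is the squared distance from
    e_k to a combination of columns, so every e_k lies in their closed span. *)
Lemma rows_orthonormal_complete (T : nat -> nat -> R) :
  rows_orthonormal (fun m k => T k m) ->
  (forall k e, 0 < e -> exists M (c : nat -> R),
    1 - 2 * (\sum_(m < M) c m * T k m) + \sum_(m < M) c m ^+ 2 <= e) ->
  rows_orthonormal T.
Proof.
move=> [h1 h2] dens.
(* [P k M] is the projection of e_k to the span of the first M columns. The squared norm of the
   residual is 1 minus a partial sum of the squared row, and coordinate l of the residual measures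
   the inner product of rows k and l. *)
pose P k M := fun l => \sum_(m < M) T k m * T l m.
have res k M : ell2 (fun l => -1 * P k M l + delta_seq k l) /\
    dot (fun l => -1 * P k M l + delta_seq k l) (fun l => -1 * P k M l + delta_seq k l) =
    1 - \sum_(m < M) T k m ^+ 2.
  have hP z : ell2 z -> ell2 (P k M) /\
      dot (P k M) z = \sum_(m < M) T k m * dot (T ^~ m) z.
    by move=> hz; exact: (dot_sum (F := fun m l => T l m)).
  have [p1 p2] := hP _ (@ell2_delta R k); have [_ p3] := hP _ p1.
  have hd := @ell2_delta R k; have hl := @ell2_lin _ (-1) _ _ p1 hd.
  split=> //; rewrite dot_lin // (dotC (P k M)) (dotC (delta_seq k)) !dot_lin //.
  rewrite (dotC (delta_seq k) (P k M)) p2 p3 dot_delta /delta_seq eqxx.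
  have -> : \sum_(m < M) T k m * dot (T ^~ m) (delta_seq k) = \sum_(m < M) T k m ^+ 2.
    by apply: eq_bigr => m _; rewrite dotC dot_delta expr2.
  have -> : \sum_(m < M) T k m * dot (T ^~ m) (P k M) = \sum_(m < M) T k m ^+ 2.
    apply: eq_bigr => m _; rewrite dotC (hP _ (h1 m)).2 expr2; congr (_ * _).
    under eq_bigr do rewrite h2 mulrC.
    by have := sum_delta_seq m M (T k); rewrite ltn_ord.
  by rewrite mulr1n; ring.
have bessel k M : \sum_(m < M) T k m ^+ 2 <= 1.
  by have [r1 r2] := res k M; rewrite -subr_ge0 -r2 dot_ge0.
have hrow k : ell2 (T k) by case: (ell2_bounded (bessel k)).
have near1 k : \sum_(m < M) T k m ^+ 2 @[M --> \oo] --> (1 : R).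
  have : series (fun m => T k m * T k m) @ \oo --> dot (T k) (T k).
    exact: ell2_dot_cvg.
  suff -> : dot (T k) (T k) = 1.
    by apply: eq_cvgn => M; rewrite /series /= big_mkord; apply: eq_bigr => m _; rewrite expr2.
  apply/eqP; rewrite eq_le; apply/andP; split.
    by case: (ell2_bounded (bessel k)).
  apply/ler_addgt0Pr => e e0; have [M [c hc]] := dens k e e0.
  rewrite -lerBlDr; apply: le_trans (sum_sqr_le_dot M (hrow k)).
  (* The projection coefficients T k m do at least as well as the given c m; completing the square
     says so. *)
  have : 0 <= \sum_(m < M) (c m - T k m) ^+ 2 by apply: sumr_ge0 => m _; exact: sqr_ge0.
  have -> : \sum_(m < M) (c m - T k m) ^+ 2 = \sum_(m < M) c m ^+ 2 -
      2 * (\sum_(m < M) c m * T k m) + \sum_(m < M) T k m ^+ 2.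
    by rewrite mulr_sumr -sumrB -big_split; apply: eq_bigr => m _ /=; ring.
  by move: hc; lra.
split=> // k l.
have le M : (delta_seq k l - series (fun m => T k m * T l m) M) ^+ 2 <=
    1 - \sum_(m < M) T k m ^+ 2.
  have [r1 r2] := res k M; rewrite -r2; apply: le_trans (ell2_sqr_le l r1).
  by rewrite /P /series /= big_mkord mulN1r addrC.
have h0 : (delta_seq k l - dot (T k) (T l)) ^+ 2 <= 0.
  have L : (delta_seq k l - series (fun m => T k m * T l m) M) ^+ 2 @[M --> \oo] -->
      (delta_seq k l - dot (T k) (T l)) ^+ 2.
    rewrite expr2; under eq_fun do rewrite expr2.
    by apply: cvgM; (apply: cvgB; [exact: cvg_cst|exact: ell2_dot_cvg]).
  have Rt : 1 - \sum_(m < M) T k m ^+ 2 @[M --> \oo] --> (0 : R).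
    by rewrite -[X in _ --> X](subrr 1); apply: cvgB; [exact: cvg_cst|exact: (@near1 k)].
  by apply: ler_cvg_to L Rt _; exact: nearW.
have /eqP : (delta_seq k l - dot (T k) (T l)) ^+ 2 = 0.
  by apply/eqP; rewrite eq_le h0 sqr_ge0.
by rewrite sqrf_eq0 subr_eq0 /delta_seq eq_sym [l == k]eq_sym => /eqP.
Qed.

End OrthogonalMatrix.

(** * Completeness *)

Section Interleaving.
Context {R : realType}.
Local Open Scope classical_set_scope.

(** Merges the two half-grids into one sequence indexed by the naturals, the form required by the
    matrix lemmas. *)
Definition interleave (f g : nat -> R) (n : nat) : R := if odd n then g n./2 else f n./2.

Lemma series_interleave (f g : nat -> R) n :
  series (interleave f g) n = series f (uphalf n) + series g n./2.
Proof.
elim: n => [|n ih]; first by rewrite /series /= !big_geq // addr0.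
rewrite seriesSr ih /interleave /= uphalf_half; case: (odd n); rewrite ?add1n ?add0n !seriesSr.
  by rewrite addrA.
by rewrite addrAC.
Qed.

Lemma cvg_half : (fun n => n./2) @ \oo --> \oo.
Proof.
apply/cvgnyPge => m; exists (m.*2) => // n /= mn.
by rewrite -[m]doubleK half_leq.
Qed.

Lemma cvg_uphalf : (fun n => uphalf n) @ \oo --> \oo.
Proof.
apply/cvgnyPge => m; exists (m.*2) => // n /= mn.
by rewrite uphalf_half (leq_trans _ (leq_addl _ _)) // -[m]doubleK half_leq.
Qed.

Lemma cvg_interleave (f g : nat -> R) (l1 l2 : R) :
  series f @ \oo --> l1 -> series g @ \oo --> l2 ->
  series (interleave f g) @ \oo --> l1 + l2.
Proof.
move=> h1 h2.
have h : series f (uphalf n) + series g n./2 @[n --> \oo] --> l1 + l2.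
  by apply: cvgD; [exact: cvg_comp cvg_uphalf h1|exact: cvg_comp cvg_half h2].
by apply: eq_cvgn h => n; rewrite series_interleave.
Qed.

End Interleaving.

(** * The matrix of normalized polynomials and its completeness *)

Section OrthogonalMatrixOfPolynomials.
Context {R : realType} (s : R) (s_gt0 : 0 < s) (s_lt1 : s < 1).
Context (a b c : R) (hp : bqj_params s a b c).
Local Open Scope classical_set_scope.
Let a_gt0 : 0 < a. Proof. by case: hp. Qed.
Let c_lt0 : c < 0. Proof. by case: hp. Qed.
Let sX_gt0 n : 0 < s ^+ n. Proof. by rewrite exprn_gt0. Qed.
Let sX_ge0 n : 0 <= s ^+ n. Proof. by rewrite ltW. Qed.

Definition bqj_grid : nat -> R :=
  interleave (fun n => a * s ^+ n.+1) (fun n => c * s ^+ n.+1).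

Definition bqj_weight (k : nat) : R := `|bqj_grid k| * bqj_u a b c s (bqj_grid k).

(** The sign in [Theta_plus]. On the negative half-grid, where also x < 0, it turns the difference
    in the contiguous relations into the sum prescribed by the coproduct. *)
Definition bqj_sign (k : nat) : R := interleave (fun=> 1) (fun n => (-1) ^+ n) k.

Definition bqj_mx (k m : nat) : R := bqj_sign k * bqj_r a b c s (bqj_grid k) m.

Lemma bqj_grid_domain k : bqj_domain a b c (bqj_grid k).
Proof.
by rewrite /bqj_grid /interleave; case: odd; [exact: bqj_domain_neg|exact: bqj_domain_pos].
Qed.

Lemma bqj_grid_neq0 k : bqj_grid k != 0.
Proof.
rewrite /bqj_grid /interleave; case: odd; rewrite mulf_neq0 ?expf_neq0 ?(gt_eqF s_gt0) //.
  by rewrite lt_eqF.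
by rewrite gt_eqF.
Qed.

Lemma bqj_weight_gt0 k : 0 < bqj_weight k.
Proof.
by rewrite mulr_gt0 ?normr_gt0 ?bqj_grid_neq0 // bqj_u_ge0 //; exact: bqj_grid_domain.
Qed.

Lemma bqj_sign_sqr k : bqj_sign k * bqj_sign k = 1.
Proof.
rewrite /bqj_sign /interleave; case: odd; rewrite ?mulr1 //.
by rewrite -exprMn mulrNN mulr1 expr1n.
Qed.

Lemma bqj_mxE k m : bqj_mx k m =
  bqj_sign k * (Num.sqrt (bqj_weight k) * Num.sqrt (bqj_v a b c s m)) *
  (bqj_poly s a b c m).[bqj_grid k].
Proof.
rewrite /bqj_mx /bqj_r horner_bqj_poly -sqrtrM; last exact/ltW/bqj_weight_gt0.
by rewrite mulrA.
Qed.

Lemma cvg_bqj_int (p : {poly R}) :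
  series (fun k => bqj_weight k * p.[bqj_grid k]) @ \oo --> bqj_int s a b c p.
Proof.
have h z : (forall k, bqj_domain a b c (z * s ^+ k.+1)) ->
    series (jackson_term s z (fun x => bqj_u a b c s x * p.[x])) @ \oo -->
    jackson s z (fun x => bqj_u a b c s x * p.[x]).
  by move=> hz; apply: jackson_cvg => //; exact: grid_cvg_up hz.
have ha := h a (bqj_domain_pos s_gt0 s_lt1 hp).
have hc : - series (jackson_term s c (fun x => bqj_u a b c s x * p.[x])) n @[n --> \oo] -->
    - jackson s c (fun x => bqj_u a b c s x * p.[x]).
  by apply: cvgN; exact: h c (bqj_domain_neg s_gt0 s_lt1 hp).
have hc' : series (fun k => - jackson_term s c (fun x => bqj_u a b c s x * p.[x]) k) @ \oo -->
    - jackson s c (fun x => bqj_u a b c s x * p.[x]).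
  by apply: eq_cvgn hc => n; rewrite /series /= sumrN.
apply: eq_cvgn (cvg_interleave ha hc') => n.
congr (series _ n); apply/funext => k; rewrite /bqj_weight /bqj_grid /interleave.
case: odd; rewrite /jackson_term.
  by rewrite ltr0_norm ?nmulr_rlt0 // !mulNr mulrA.
by rewrite gtr0_norm ?mulr_gt0 // mulrA.
Qed.

Lemma bqj_mx_cols : rows_orthonormal (fun m k => bqj_mx k m).
Proof.
have v_gt0 := bqj_v_gt0 s_gt0 s_lt1 hp.
have h m n : series (fun k => bqj_mx k m * bqj_mx k n) @ \oo --> ((m == n)%:R : R).
  have -> : (m == n)%:R = Num.sqrt (bqj_v a b c s m) * Num.sqrt (bqj_v a b c s n) *
      bqj_int s a b c (bqj_poly s a b c m * bqj_poly s a b c n) :> R.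
    rewrite (bqj_int_orth s_gt0 s_lt1 hp); have [<-|_] := eqVneq m n; last by rewrite mul0r mulr0.
    by rewrite -expr2 sqr_sqrtr ?(ltW (v_gt0 m)) // mul1r divff // gt_eqF.
  have E : Num.sqrt (bqj_v a b c s m) * Num.sqrt (bqj_v a b c s n) *
      series (fun k => bqj_weight k *
        (bqj_poly s a b c m * bqj_poly s a b c n).[bqj_grid k]) N @[N --> \oo] -->
      Num.sqrt (bqj_v a b c s m) * Num.sqrt (bqj_v a b c s n) *
      bqj_int s a b c (bqj_poly s a b c m * bqj_poly s a b c n).
    by apply: cvgMr; exact: cvg_bqj_int.
  apply: eq_cvgn E => N; rewrite /= /series /= mulr_sumr; apply: eq_bigr => k _.
  rewrite !bqj_mxE hornerM.
  have hw := sqr_sqrtr (ltW (bqj_weight_gt0 k)).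
  rewrite -{1}hw; have hs := bqj_sign_sqr k.
  transitivity (bqj_sign k * bqj_sign k * (Num.sqrt (bqj_v a b c s m) *
    Num.sqrt (bqj_v a b c s n) * (Num.sqrt (bqj_weight k) ^+ 2 *
    ((bqj_poly s a b c m).[bqj_grid k] * (bqj_poly s a b c n).[bqj_grid k])))).
    by rewrite hs mul1r.
  by ring.
split=> [m|m n]; last by apply: cvg_lim => //; exact: h.
apply/cvg_ex; exists 1; have := h m m; rewrite eqxx.
by apply: eq_cvgn => N; congr (series _ N); apply/funext => k; rewrite expr2.
Qed.

(** On one half-grid the nearest neighbour of a point is the next one, closer to 0 by the factor s;
    points of opposite sign are at least |x_k0| away. *)
Lemma bqj_grid_sep k0 k : k != k0 ->
  `|bqj_grid k0| * (1 - s) <= `|bqj_grid k0 - bqj_grid k|.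
Proof.
have sl i j : (i < j)%N -> s ^+ i * (1 - s) <= s ^+ i - s ^+ j.
  move=> ij; rewrite mulrBr mulr1 lerD2l lerN2 -exprSr.
  by rewrite ler_wiXn2l // ltW.
have sep i j : i != j -> s ^+ i * (1 - s) <= `|s ^+ i - s ^+ j|.
  rewrite neq_ltn => /orP[ij|ji].
    by rewrite (le_trans (sl _ _ ij)) // ler_norm.
  rewrite distrC; apply: le_trans (ler_norm _); apply: le_trans (sl _ _ ji).
  by rewrite ler_wpM2r ?subr_ge0 ?(ltW s_lt1) // ler_wiXn2l ?ltW // ltnW.
have s1 : 1 - s <= 1 by rewrite gerBl ltW.
move=> kk; rewrite /bqj_grid /interleave.
have hne : odd k = odd k0 -> (k0./2).+1 != (k./2).+1.
  move=> o; rewrite eqSS; apply: contra kk => /eqP h.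
  by rewrite -[k]odd_double_half -[k0]odd_double_half o h.
case: (boolP (odd k)) hne => ok; case: (boolP (odd k0)) => ok0 hne.
- by rewrite -mulrBr !normrM (ger0_norm (sX_ge0 _)) -mulrA ler_wpM2l // sep // hne.
- rewrite [leRHS]ger0_norm; last first.
    by rewrite subr_ge0 (@le_trans _ _ 0) ?mulr_ge0 ?(ltW a_gt0) // mulr_le0_ge0 // ltW.
  rewrite ger0_norm ?mulr_ge0 ?(ltW a_gt0) // (le_trans (ler_piMr _ s1)) ?mulr_ge0 ?(ltW a_gt0) //.
  by rewrite lerDl oppr_ge0 mulr_le0_ge0 // ltW.
- rewrite distrC [leRHS]ger0_norm; last first.
    by rewrite subr_ge0 (@le_trans _ _ 0) ?mulr_ge0 ?(ltW a_gt0) // mulr_le0_ge0 // ltW.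
  rewrite (le_trans (ler_piMr (normr_ge0 _) s1)) // ltr0_norm ?nmulr_rlt0 //.
  by rewrite lerDr mulr_ge0 // ltW.
- by rewrite -mulrBr !normrM (ger0_norm (sX_ge0 _)) -mulrA ler_wpM2l // sep // hne.
Qed.

Lemma bqj_grid_le k : `|bqj_grid k| <= (a - c) * s ^+ k./2.
Proof.
have sS n : s ^+ n.+1 <= s ^+ n by rewrite ler_wiXn2l // ltW.
rewrite /bqj_grid /interleave; case: odd; rewrite normrM (ger0_norm (sX_ge0 _)).
  by rewrite (ltr0_norm c_lt0) ler_pM ?oppr_ge0 ?(ltW c_lt0) // lerDr ltW.
by rewrite (gtr0_norm a_gt0) ler_pM ?(ltW a_gt0) // lerDl oppr_ge0 ltW.
Qed.

Lemma sum_exps_half_le n : \sum_(k < n) s ^+ k./2 <= 2 / (1 - s).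
Proof.
have := series_interleave (fun k => s ^+ k) (fun k => s ^+ k) n.
rewrite /series /= !big_mkord => h.
have -> : \sum_(k < n) s ^+ k./2 =
    \sum_(k < n) interleave (fun k => s ^+ k) (fun k => s ^+ k) k.
  by apply: eq_bigr => k _; rewrite /interleave; case: odd.
have -> : 2 / (1 - s) = (1 - s)^-1 + (1 - s)^-1 by rewrite mulr_natl mulr2n.
by rewrite h lerD // sum_exps_le.
Qed.

(* Lagrange-type products, so that the point mass at [bqj_grid k0] is a bounded
   limit of polynomials. *)
Lemma bqj_delta_poly k0 : exists C : R, forall N, exists f : {poly R},
  [/\ f.[bqj_grid k0] = 1, forall k, (k < N)%N -> k != k0 -> f.[bqj_grid k] = 0 &
   forall k, (N <= k)%N -> `|f.[bqj_grid k]| <= C].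
Proof.
pose d := `|bqj_grid k0| * (1 - s).
have d_gt0 : 0 < d by rewrite mulr_gt0 ?normr_gt0 ?bqj_grid_neq0 // subr_gt0.
have ac : 0 < a - c by rewrite subr_gt0 (lt_trans c_lt0).
(* For i < N <= k the points x_i and x_k both have modulus at most (a - c) [s ^+ i./2], and every
   denominator is at least d. The i-th factor is therefore at most M [s ^+ i./2], hence at most its
   exponential, and the product is bounded independently of N. *)
pose M := 2 * (a - c) / d.
have M_ge0 : 0 <= M.
  by apply: divr_ge0; [apply: mulr_ge0 => //|]; apply: ltW.
exists (expR (M * (2 / (1 - s)))) => N.
pose f : {poly R} := \prod_(k < N | nat_of_ord k != k0)
  ((bqj_grid k0 - bqj_grid k)^-1 *: ('X - (bqj_grid k)%:P)).
exists f; split.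
- rewrite horner_prod big1 // => k kk; rewrite !hornerE mulVf //.
  by rewrite -normr_gt0 (lt_le_trans d_gt0) // bqj_grid_sep.
- move=> k kN kk; rewrite horner_prod (bigD1 (Ordinal kN)) //=.
  by rewrite !hornerE subrr mulr0 mul0r.
- move=> k Nk; rewrite horner_prod normr_prod.
  apply: (@le_trans _ _ (\prod_(i < N) expR (M * s ^+ i./2))); last first.
    by rewrite -expR_sum ler_expR -mulr_sumr ler_wpM2l // sum_exps_half_le.
  rewrite big_mkcond /=; apply: ler_prod => i _; case: ifPn => ik; last first.
    by rewrite ler01 -expR0 ler_expR mulr_ge0.
  rewrite normr_ge0 !hornerE normrM normfV /=.
  apply: le_trans (expR_ge1Dx _); apply: (@le_trans _ _ (M * s ^+ i./2)); last by rewrite lerDr.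
  have -> : M * s ^+ i./2 = d^-1 * (2 * ((a - c) * s ^+ i./2)) by rewrite /M; ring.
  apply: ler_pM; rewrite ?invr_ge0 //.
    rewrite lef_pV2 ?posrE // ?bqj_grid_sep //.
    by rewrite (lt_le_trans d_gt0) // bqj_grid_sep.
  apply: le_trans (ler_normB _ _) _; rewrite mulr_natl mulr2n lerD ?bqj_grid_le //.
  apply: le_trans (bqj_grid_le k) _; rewrite ler_wpM2l ?(ltW ac) //.
  by rewrite ler_wiXn2l ?ltW // half_leq // (leq_trans _ Nk) // ltnW.
Qed.

Lemma bqj_poly_span m (p : {poly R}) : (size p <= m)%N ->
  exists f : nat -> R, p = \sum_(j < m) f j *: bqj_poly s a b c j.
Proof.
apply: (@poly_graded_ind _ (bqj_poly s a b c)
  (fun p => exists f : nat -> R, p = \sum_(j < m) f j *: bqj_poly s a b c j)).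
- by move=> j; case: (bqj_poly_lead s_gt0 s_lt1 hp j).
- by exists (fun=> 0); rewrite big1 // => j _; rewrite scale0r.
- move=> r p1 p2 [f1 ->] [f2 ->]; exists (fun j => r * f1 j + f2 j).
  by rewrite scaler_sumr -big_split; apply: eq_bigr => j _; rewrite scalerDl scalerA.
- move=> j jm; exists (fun i => (i == j)%:R); rewrite (bigD1 (Ordinal jm)) //= eqxx scale1r.
  rewrite big1 ?addr0 // => i ij.
  by rewrite (_ : (i == j :> nat) = false) ?scale0r //; apply: negbTE.
Qed.

Lemma bqj_int_sqr (f : nat -> R) m :
  bqj_int s a b c ((\sum_(j < m) f j *: bqj_poly s a b c j) *
    (\sum_(j < m) f j *: bqj_poly s a b c j)) =
  \sum_(j < m) f j ^+ 2 / bqj_v a b c s j.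
Proof.
set g := \sum_(j < m) _; rewrite {1}/g mulr_suml.
under eq_bigr do rewrite -scalerAl.
rewrite bqj_int_sum //; apply: eq_bigr => i _; rewrite expr2 -mulrA; congr (_ * _).
rewrite /g mulr_sumr; under eq_bigr do rewrite -scalerAr.
rewrite bqj_int_sum // (bigD1 i) //= bqj_int_orth // eqxx mul1r big1 ?addr0 //.
move=> j ji; rewrite bqj_int_orth // [_ == _ :> nat](_ : _ = false) ?mul0r ?mulr0 //.
by apply: negbTE; rewrite eq_sym.
Qed.

(** The interpolants approximate the point mass at x_k0 in the weighted L^2 norm: they vanish at the
    other points of index below N, and beyond N they stay below C while the tail of the weight tends
    to 0. *)
Lemma bqj_mx_rows : rows_orthonormal bqj_mx.
Proof.
apply: rows_orthonormal_complete; first exact: bqj_mx_cols.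
move=> k0 e e0; have [C hC] := bqj_delta_poly k0.
have w0 := bqj_weight_gt0 k0.
pose W := bqj_int s a b c 1.
have cW : series bqj_weight @ \oo --> W.
  apply: eq_cvgn (@cvg_bqj_int 1) => n; rewrite /series /=; apply: eq_bigr => k _.
  by rewrite hornerC mulr1.
have ndW : {homo series bqj_weight : m n / (m <= n)%N >-> m <= n}.
  by apply/nondecreasing_seqP => n; rewrite seriesSr lerDl ltW // bqj_weight_gt0.
have leW n : series bqj_weight n <= W.
  by rewrite -(cvg_lim _ cW) //; apply: nondecreasing_cvgn_le => //; apply: cvgP cW.
have [N [kN hN]] : exists N, (k0 < N)%N /\
    C ^+ 2 * (W - series bqj_weight N) <= e * bqj_weight k0.
  have h : C ^+ 2 * (W - series bqj_weight N) @[N --> \oo] --> (0 : R).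
    rewrite -[X in _ --> X](mulr0 (C ^+ 2)); apply: cvgMr.
    by rewrite -[X in _ --> X](subrr W); apply: cvgB => //; exact: cvg_cst.
  have ew : 0 < e * bqj_weight k0 by rewrite mulr_gt0.
  have [n _ hn] := cvgr_le _ h _ ew.
  exists (maxn n k0.+1); rewrite leq_maxr; split=> //.
  by apply: hn; rewrite /= leq_maxl.
have [f [f1 f2 f3]] := hC N.
have intf : bqj_int s a b c (f * f) <= (1 + e) * bqj_weight k0.
  apply: ler_cvg_to (@cvg_bqj_int (f * f)) (cvg_cst _) _.
  exists N => // n /= Nn; rewrite /series /= (big_cat_nat (leq0n N) Nn) //=.
  rewrite mulrDl mul1r; apply: lerD.
    rewrite big_mkord (bigD1 (Ordinal kN)) //= hornerM f1 !mulr1 big1 ?addr0 // => k kk.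
    by rewrite hornerM f2 ?mulr0.
  apply: le_trans hN; apply: (@le_trans _ _ (\sum_(N <= k < n) C ^+ 2 * bqj_weight k)).
    rewrite big_nat [leRHS]big_nat; apply: ler_sum => k /andP[Nk _].
    rewrite mulrC ler_wpM2r ?(ltW (bqj_weight_gt0 k)) // hornerM -expr2.
    by rewrite -(real_normK (num_real _)) lerXn2r ?nnegrE ?f3 // (le_trans _ (f3 k Nk)).
  rewrite -mulr_sumr ler_wpM2l ?sqr_ge0 // lerBrDr.
  apply: le_trans (leW n); rewrite /series /= [leRHS](big_cat_nat (leq0n N) Nn) //=.
  by rewrite addrC.
have [g hg] := bqj_poly_span (leqnn (size f)).
have v_gt0 := bqj_v_gt0 s_gt0 s_lt1 hp.
(* These are the coordinates of f, divided by the square root of the weight at x_k0, in the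
   orthonormal columns. Their product with row k0 is f(x_k0) = 1 and their squares sum to the
   integral of f^2 over that weight, at most 1 + e; hence 1 - 2 + (1 + e) = e. *)
exists (size f), (fun m => bqj_sign k0 * g m /
  (Num.sqrt (bqj_weight k0) * Num.sqrt (bqj_v a b c s m))).
have sw : Num.sqrt (bqj_weight k0) != 0 by rewrite sqrtr_eq0 -ltNge.
have sv m : Num.sqrt (bqj_v a b c s m) != 0 by rewrite sqrtr_eq0 -ltNge.
have -> : \sum_(m < size f) bqj_sign k0 * g m /
    (Num.sqrt (bqj_weight k0) * Num.sqrt (bqj_v a b c s m)) * bqj_mx k0 m = 1.
  rewrite -f1 [in RHS]hg horner_sum; apply: eq_bigr => m _.
  rewrite bqj_mxE hornerZ -[g m in RHS]mul1r -(bqj_sign_sqr k0).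
  by field; rewrite sw sv.
have -> : \sum_(m < size f) (bqj_sign k0 * g m /
    (Num.sqrt (bqj_weight k0) * Num.sqrt (bqj_v a b c s m))) ^+ 2 =
    bqj_int s a b c (f * f) / bqj_weight k0.
  have -> : bqj_int s a b c (f * f) = \sum_(j < size f) g j ^+ 2 / bqj_v a b c s j.
    by rewrite [in LHS]hg bqj_int_sqr.
  rewrite mulr_suml; apply: eq_bigr => m _.
  rewrite !exprMn exprVn exprMn !sqr_sqrtr ?ltW // expr2 bqj_sign_sqr mul1r.
  by rewrite invfM mulrA mulrAC.
by rewrite mulr1 addrC -lerBrDr ler_pdivrMr // (le_trans intf) // ler_wpM2r ?(ltW w0) //; lra.
Qed.

End OrthogonalMatrixOfPolynomials.

(** * Contiguous relations *)

Section Contiguity.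
Context {R : realType} (s : R) (s_gt0 : 0 < s) (s_lt1 : s < 1).
Context (a b c : R) (hp : bqj_params s a b c).
Let a_gt0 : 0 < a. Proof. by case: hp. Qed.
Let as_lt1 : a * s < 1. Proof. by case: hp. Qed.
Let b_gt0 : 0 < b. Proof. by case: hp. Qed.
Let c_lt0 : c < 0. Proof. by case: hp. Qed.
Let a_neq0 : a != 0. Proof. by rewrite gt_eqF. Qed.
Let c_neq0 : c != 0. Proof. by rewrite lt_eqF. Qed.
Let s_neq0 : s != 0. Proof. by rewrite gt_eqF. Qed.
Let sX_neq0 n : s ^+ n != 0. Proof. by rewrite expf_neq0. Qed.
Let neg_neq1 (x : R) : x < 0 -> 1 - x != 0.
Proof. by move=> x0; rewrite subr_eq0 gt_eqF // (lt_trans x0). Qed.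
Let c1_neq0 n : 1 - c * s ^+ n != 0.
Proof. by apply: neg_neq1; rewrite nmulr_rlt0 // exprn_gt0. Qed.

Lemma bqj_params_div : bqj_params s a b (c / s).
Proof. by case: hp => *; split=> //; rewrite nmulr_rlt0 // invr_gt0. Qed.

Lemma bqj_coef_div m k :
  bqj_coef s a b (c / s) m k * (1 - c) = bqj_coef s a b c m k * (1 - c * s ^+ k).
Proof.
have cs1 : c * s < 1 by apply: lt_trans ltr01; rewrite nmulr_rlt0.
have c1 : c < 1 by exact: lt_trans ltr01.
rewrite !bqj_coefE divfK //.
have h : qpoch c s k * (1 - c * s ^+ k) = (1 - c) * qpoch (c * s) s k.
  by rewrite -qpochS qpoch_recl.
have n1 := qpoch_neq0 s_gt0 s_lt1 k cs1; have n2 := qpoch_neq0 s_gt0 s_lt1 k c1.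
have n3 := qpoch_neq0 s_gt0 s_lt1 k s_lt1; have n4 := qpoch_neq0 s_gt0 s_lt1 k as_lt1.
have e : 1 - c * s ^+ k = (1 - c) * qpoch (c * s) s k / qpoch c s k.
  by rewrite -h mulrAC divff // mul1r.
by rewrite e; field; rewrite n1 n2 n3 n4.
Qed.

(** Holds term by term in the basis (x;s)_k: (1 - x)(xs;s)_k is (x;s)_k (1 - xs^k), and the
    remaining factor -(x/c)(1 - cs^k) is what [bqj_coef_div] converts to the parameter c/s. *)
Lemma bqj_P_contiguous_up m x :
  (1 - x / c) * bqj_P a b c s m x - (1 - x) * bqj_P a b c s m (x * s) =
  (1 - c^-1) * x * bqj_P a b (c / s) s m x.
Proof.
rewrite !bqj_PE !mulr_sumr -sumrB; apply: eq_bigr => k _.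
have h := bqj_coef_div m k; have c10 := c1_neq0 0; rewrite expr0 mulr1 in c10.
have -> : bqj_coef s a b (c / s) m k = bqj_coef s a b c m k * (1 - c * s ^+ k) / (1 - c).
  by rewrite -h mulfK.
have e : (1 - x) * qpoch (x * s) s k = qpoch x s k * (1 - x * s ^+ k).
  by rewrite -qpoch_recl qpochS.
rewrite (mulrCA (1 - x)) e.
by field; rewrite c_neq0 c10.
Qed.

(** Here the k-th term on the left involves both (x;s)_k and (x;s)_(k-1); these parts are [D k] and
    [U k]. Moving each [U k] to index k - 1 restores a term by term identity; nothing is lost at the
    ends, since [U 0] is 0 and (s^(-m);s)_(m+1) = 0. *)
Lemma bqj_P_contiguous_down m x :
  (1 - b * x / c) * bqj_P a b (c / s) s m x -
  (1 - x / (a * s)) * bqj_P a b (c / s) s m (x / s) =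
  (1 - a * b * s ^+ m.+1 / c) * (1 - c * s ^+ m) / (a * s ^+ m.+1 * (1 - c)) *
  x * bqj_P a b c s m x.
Proof.
have c10 := c1_neq0 0; rewrite expr0 mulr1 in c10.
rewrite !bqj_PE.
pose be := bqj_coef s a b (c / s) m.
pose U k := if k is j.+1 then
  be k * ((1 - s ^+ k) / s + (1 - (s ^+ k)^-1) / (a * s)) * x * qpoch x s j else 0.
pose D k := be k * ((s ^+ k)^-1 / (a * s) - b / c) * x * qpoch x s k.
have T k : be k * ((1 - b * x / c) * qpoch x s k - (1 - x / (a * s)) * qpoch (x / s) s k) =
    D k + U k.
  case: k => [|k]; rewrite /D /U; first by rewrite !qpoch0 expr0; field; rewrite c_neq0 a_neq0 s_neq0.
  rewrite (qpoch_recl s (x / s)) divfK // qpochS exprS.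
  by field; rewrite c_neq0 a_neq0 s_neq0 sX_neq0.
have L k : (1 - a * b * s ^+ m.+1 / c) * (1 - c * s ^+ m) / (a * s ^+ m.+1 * (1 - c)) *
    x * (bqj_coef s a b c m k * qpoch x s k) = D k + U k.+1.
  have ck := c1_neq0 k; have := bqj_coef_div m k; rewrite -/(be k) => h.
  have -> : bqj_coef s a b c m k = be k * (1 - c) / (1 - c * s ^+ k) by rewrite h mulfK.
  have s1 : 1 - s * s ^+ k != 0.
    by rewrite -exprS subr_eq0 gt_eqF // exprn_ilt1 // ltW.
  have a1 : 1 - a * s * s ^+ k != 0.
    by rewrite subr_eq0 gt_eqF // mulr_exps_lt1.
  have -> : U k.+1 = be k * ((1 - s ^- m * s ^+ k) * (1 - a * b * s ^+ m.+1 * s ^+ k) * s /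
      ((1 - s * s ^+ k) * (1 - a * s * s ^+ k) * (1 - c * s ^+ k))) *
      ((1 - s * s ^+ k) / s + (1 - (s * s ^+ k)^-1) / (a * s)) * x * qpoch x s k.
    rewrite /U exprS; congr (_ * _ * _ * _); rewrite /be !bqj_coefE !qpochS divfK // !exprS.
    have c1 : c < 1 by exact: lt_trans ltr01.
    have n2 := qpoch_neq0 s_gt0 s_lt1 k c1.
    have n3 := qpoch_neq0 s_gt0 s_lt1 k s_lt1; have n4 := qpoch_neq0 s_gt0 s_lt1 k as_lt1.
    by field; rewrite ?n2 ?n3 ?n4 ?ck ?s1 ?a1 ?sX_neq0.
  rewrite /D exprS; move: ck s1 a1 (sX_neq0 k) (sX_neq0 m).
  move: (s ^+ k) (s ^+ m) (be k) (qpoch x s k) => u v B X ck s1 a1 u0 v0.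
  by field; rewrite ?ck ?s1 ?a1 ?u0 ?v0 ?s_neq0 ?c_neq0 ?a_neq0 ?c10.
have U0 : U m.+1 = 0.
  by rewrite /U /be bqj_coefE qpoch_negexp_eq0 // !mul0r.
rewrite !mulr_sumr -sumrB.
transitivity (\sum_(k < m.+1) (D k + U k)).
  by apply: eq_bigr => k _; rewrite -T /be; ring.
transitivity (\sum_(k < m.+1) (D k + U k.+1)); last by apply: eq_bigr => k _; rewrite L.
have tele (V : nat -> R) : V 0%N = 0 -> V m.+1 = 0 ->
    \sum_(k < m.+1) V k = \sum_(k < m.+1) V k.+1.
  by move=> V0 V1; rewrite [LHS]big_ord_recl [RHS]big_ord_recr /= V0 V1 add0r addr0.
by rewrite [LHS]big_split [RHS]big_split; congr (_ + _); exact: tele.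
Qed.

(** The squared factor is the constant of [bqj_P_contiguous_down]. The quotient of the two norms
    turns it, up to 1/(as), into the radicand of the principal series (see [G_princ]). *)
Lemma bqj_v_div m :
  bqj_v a b (c / s) s m *
    ((1 - a * b * s ^+ m.+1 / c) * (1 - c * s ^+ m) / (a * s ^+ m.+1 * (1 - c))) ^+ 2 =
  (1 - a * b * s ^+ m.+1 / c) * (1 - (c * s ^+ m)^-1) / (a * s) * bqj_v a b c s m.
Proof.
have c10 := c1_neq0 0; rewrite expr0 mulr1 in c10.
have ng (x : R) : x < 0 -> x < 1 by move=> x0; exact: lt_trans ltr01.
have abc0 n : a * b * s ^+ n.+1 / c < 0.
  by rewrite nmulr_llt0 ?invr_lt0 // !mulr_gt0 // exprn_gt0.
have asc0 : a * s / c < 0 by rewrite nmulr_llt0 ?invr_lt0 // !mulr_gt0.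
have casl : c / (a * s) < 0 by rewrite nmulr_rlt0 // invr_gt0 mulr_gt0.
rewrite /bqj_v /qpochsoo /qtheta /qpochsoo /qpochs !big_cons !big_nil !mulr1.
rewrite divfK //.
have -> : a * b * s / (c / s) = a * b * s / c * s by field; rewrite c_neq0 s_neq0.
have -> : c / s / a = c / (a * s) by field; rewrite a_neq0 s_neq0.
have -> : s / (c / (a * s)) = a * s / c * s by field; rewrite a_neq0 s_neq0 c_neq0.
have -> : s / (c / a) = a * s / c by field; rewrite a_neq0 c_neq0.
have -> : c / a = c / (a * s) * s by field; rewrite a_neq0 s_neq0.
have -> : - a * (c / s) * s ^+ 2 = - a * c * s by field.
have -> : a * b * s ^+ m.+1 / c = a * b * s / c * s ^+ m by rewrite exprS; ring.
have B0 : a * b * s / c < 0 by have := abc0 0%N; rewrite expr1.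
rewrite (qpochoo_recl s_gt0 s_lt1 (ng _ c_lt0)) (qpochoo_recl s_gt0 s_lt1 (ng _ B0)).
rewrite (qpochoo_recl s_gt0 s_lt1 (ng _ casl)) (qpochoo_recl s_gt0 s_lt1 (ng _ asc0)).
have e1 : qpoch c s m = (1 - c) * qpoch (c * s) s m / (1 - c * s ^+ m).
  by rewrite -qpoch_recl qpochS mulfK.
have Bm : 1 - a * b * s / c * s ^+ m != 0.
  by apply: neg_neq1; rewrite nmulr_rlt0 // exprn_gt0.
have B1 : 1 - a * b * s / c != 0 by exact: neg_neq1.
have e2 : qpoch (a * b * s / c * s) s m =
    qpoch (a * b * s / c) s m * (1 - a * b * s / c * s ^+ m) / (1 - a * b * s / c).
  by rewrite -qpochS qpoch_recl [RHS]mulrAC divff // mul1r.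
rewrite e1 e2.
have e3 : (- a * c * s ^+ 2) ^+ m = (- a * c * s) ^+ m * s ^+ m.
  by rewrite -exprMn; congr (_ ^+ _); ring.
rewrite e3 [s ^+ m.+1]exprS.
have cm := c1_neq0 m.
have abs1 := abs2_lt1 s_gt0 hp.
have lts (x : R) : x < 1 -> x * s < 1.
  by move=> x1; have := mulr_exps_lt1 s_gt0 s_lt1 1 x1; rewrite expr1.
have oo x : x < 1 -> qpochoo x s != 0 by exact: qpochoo_neq0.
have po x : x < 1 -> qpoch x s m != 0 by exact: qpoch_neq0.
have bs1 : b * s < 1 by case: hp.
have m1 := oo _ s_lt1; have m2 := oo _ abs1; have m3 := oo _ (lts _ (ng _ casl)).
have m4 := oo _ (lts _ (ng _ asc0)).
have m5 := po _ s_lt1; have m6 := po _ bs1; have m7 := po _ (ng _ B0).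
have m8 : (- a * c * s) ^+ m != 0 by rewrite expf_neq0 // !mulf_neq0 // oppr_eq0.
have m9 : 1 - c / (a * s) != 0 by exact: neg_neq1.
have m10 : 1 - a * s / c != 0 by exact: neg_neq1.
have m11 := sX_neq0 (m * m.-1)./2; have m12 := sX_neq0 m.
move: m1 m2 m3 m4 m5 m6 m7 m8 m11.
move: (qpochoo s s) (qpochoo (a * b * s ^+ 2) s) (qpochoo (c / (a * s) * s) s)
  (qpochoo (a * s / c * s) s) (qpochoo (a * s) s) (qpochoo (b * s) s)
  (qpochoo (c * s) s) (qpochoo (a * b * s / c * s) s) => w1 w2 w3 w4 w5 w6 w7 w8.
move: (qpoch s s m) (qpoch (b * s) s m) (qpoch (a * b * s / c) s m) (qpoch (a * s) s m)
  (qpoch (c * s) s m) ((- a * c * s) ^+ m) (s ^+ (m * m.-1)./2) (bqj_quot a b s m)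
  => v1 v2 v3 v4 v5 Z T0 Q m1 m2 m3 m4 m5 m6 m7 m8 m11.
have e9 : 1 - c / (a * s) = - (c / (a * s)) * (1 - a * s / c).
  by field; rewrite a_neq0 s_neq0 c_neq0.
rewrite e9; move: cm Bm B1 m10 m12; rewrite -[a * b * s / c * s ^+ m]mulrC.
move: (s ^+ m) (1 - a * s / c) => u z.
move: (a * b * s / c) => t cm Bm B1 m10 m12.
by field; rewrite ?m1 ?m2 ?m3 ?m4 ?m5 ?m6 ?m7 ?m8 ?m10 ?m11 ?m12 ?cm ?Bm ?B1 ?a_neq0 ?s_neq0 ?c_neq0 ?c10.
Qed.

Let G m := (1 - a * b * s ^+ m.+1 / c) * (1 - (c * s ^+ m)^-1).

Lemma sqrtr_mul_sqr (A B C D : R) : 0 <= A -> 0 <= C -> A * B = C ^+ 2 * D ->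
  Num.sqrt A * Num.sqrt B = C * Num.sqrt D.
Proof.
by move=> A0 C0 h; rewrite -sqrtrM // h sqrtrM ?sqr_ge0 // sqrtr_sqr ger0_norm.
Qed.

Lemma bqj_u_div x : x / c < 1 -> b * x / c < 1 ->
  bqj_u a b (c / s) s x * (1 - x / c) = bqj_u a b c s x * (1 - b * x / c).
Proof.
move=> h1 h2; rewrite !bqj_uE.
have -> : x / (c / s) = x / c * s by field; rewrite c_neq0 s_neq0.
have -> : b * x / (c / s) = b * x / c * s by field; rewrite c_neq0 s_neq0.
rewrite (qpochoo_recl s_gt0 s_lt1 h1) (qpochoo_recl s_gt0 s_lt1 h2).
have n1 : 1 - b * x / c != 0 by rewrite subr_eq0 gt_eqF.
have n2 : qpochoo (b * x / c * s) s != 0.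
  by rewrite qpochoo_neq0 // -[X in _ * X]expr1 mulr_exps_lt1.
(* If (x;s)_oo = 0 both sides are 0, because the inverse of 0 is 0. *)
have [->|n3] := eqVneq (qpochoo x s) 0; first by rewrite !mul0r !invr0 !mulr0 !mul0r.
move: n1 n2; move: (b * x / c) (x / c) => y t n1 n2.
by field; rewrite n1 n2 n3.
Qed.

Lemma bqj_u_divM x : x < 1 -> x / a < 1 ->
  bqj_u a b c s (x * s) * (1 - x / a) = bqj_u a b (c / s) s x * (1 - x).
Proof.
move=> h1 h2; rewrite !bqj_uE.
have -> : x / (c / s) = x * s / c by field; rewrite c_neq0 s_neq0.
have -> : b * x / (c / s) = b * (x * s) / c by field; rewrite c_neq0 s_neq0.
have -> : x * s / a = x / a * s by rewrite mulrAC.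
rewrite (qpochoo_recl s_gt0 s_lt1 h1) (qpochoo_recl s_gt0 s_lt1 h2).
have n1 : 1 - x != 0 by rewrite subr_eq0 gt_eqF.
have n2 : qpochoo (x * s) s != 0.
  by rewrite qpochoo_neq0 // -[X in _ * X]expr1 mulr_exps_lt1.
have [->|n3] := eqVneq (qpochoo (b * (x * s) / c) s) 0.
  by rewrite !mulr0 !invr0 !mulr0 !mul0r.
move: n1 n2; move: (x / a) => t n1 n2.
by field; rewrite n1 n2 n3.
Qed.

Let G_gt0 m : 0 < G m.
Proof.
have h1 : a * b * s ^+ m.+1 / c < 0.
  by rewrite nmulr_llt0 ?invr_lt0 // !mulr_gt0 // exprn_gt0.
have h2 : (c * s ^+ m)^-1 < 0 by rewrite invr_lt0 nmulr_rlt0 // exprn_gt0.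
by rewrite mulr_gt0 // subr_gt0; exact: lt_trans ltr01.
Qed.

Let v_gt0 m : 0 < bqj_v a b c s m. Proof. exact: bqj_v_gt0. Qed.
Let v'_gt0 m : 0 < bqj_v a b (c / s) s m.
Proof. by apply: bqj_v_gt0 => //; exact: bqj_params_div. Qed.
Let as_gt0 : 0 < a * s. Proof. exact: mulr_gt0. Qed.

Let Lam m := (1 - a * b * s ^+ m.+1 / c) * (1 - c * s ^+ m) / (a * s ^+ m.+1 * (1 - c)).
Let Lam_gt0 m : 0 < Lam m.
Proof.
have h1 : a * b * s ^+ m.+1 / c < 0.
  by rewrite nmulr_llt0 ?invr_lt0 // !mulr_gt0 // exprn_gt0.
have h2 : c * s ^+ m < 0 by rewrite nmulr_rlt0 // exprn_gt0.
rewrite divr_gt0 ?mulr_gt0 ?exprn_gt0 // subr_gt0; exact: lt_trans ltr01.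
Qed.

Let sqrt_v_div m : Lam m * Num.sqrt (bqj_v a b (c / s) s m) =
  Num.sqrt (G m) * Num.sqrt (bqj_v a b c s m) / Num.sqrt (a * s).
Proof.
have aux (v v' g l A : R) : 0 <= v -> 0 <= v' -> 0 <= g -> 0 <= l -> 0 <= A ->
    v' * l ^+ 2 = g / A * v -> l * Num.sqrt v' = Num.sqrt g * Num.sqrt v / Num.sqrt A.
  move=> v0 v'0 g0 l0 A0 h; rewrite -[l in LHS]ger0_norm // -sqrtr_sqr -(sqrtrM _ (sqr_ge0 l)).
  by rewrite mulrC h sqrtrM ?divr_ge0 // sqrtrM // sqrtrV // mulrAC.
by apply: aux; rewrite ?(ltW (v_gt0 m)) ?(ltW (v'_gt0 m)) ?(ltW (G_gt0 m))
  ?(ltW (Lam_gt0 m)) ?(ltW as_gt0) //; exact: bqj_v_div.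
Qed.

(** Follows from [sqrt_v_div] and the factorization G m = as (1 - 1/c) Lam m: the constants of the
    two contiguous relations multiply to the radicand, up to as. *)
Let sqrt_v_div' m : (1 - c^-1) * Num.sqrt (bqj_v a b c s m) =
  Num.sqrt (G m) * Num.sqrt (bqj_v a b (c / s) s m) / Num.sqrt (a * s).
Proof.
have sG : Num.sqrt (G m) != 0 by rewrite sqrtr_eq0 -ltNge.
have sA : Num.sqrt (a * s) != 0 by rewrite sqrtr_eq0 -ltNge.
have c10 := c1_neq0 0; rewrite expr0 mulr1 in c10.
have e : Num.sqrt (G m) * Num.sqrt (G m) =
    Num.sqrt (a * s) * Num.sqrt (a * s) * Lam m * (1 - c^-1).
  rewrite -!expr2 !sqr_sqrtr ?(ltW (G_gt0 m)) ?(ltW as_gt0) // /G /Lam exprS.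
  by field; rewrite a_neq0 s_neq0 c_neq0 sX_neq0 c10.
have aux (v v' g l A k : R) : g != 0 -> A != 0 -> l * v' = g * v / A ->
    g * g = A * A * l * k -> k * v = g * v' / A.
  move=> g0 A0 h1 h2; apply: (mulfI g0).
  have -> : g * (k * v) = k * A * (g * v / A) by field.
  have -> : g * (g * v' / A) = g * g * v' / A by ring.
  by rewrite -h1 h2; field.
exact: aux sG sA (sqrt_v_div m) e.
Qed.

Let r_factor x (c0 : R) m : 0 < bqj_v a b c0 s m ->
  bqj_r a b c0 s x m =
  Num.sqrt (`|x| * bqj_u a b c0 s x) * Num.sqrt (bqj_v a b c0 s m) * bqj_P a b c0 s m x.
Proof. by move=> v0; rewrite /bqj_r mulrC [_ * bqj_v _ _ _ _ _]mulrC sqrtrM ?(ltW v0) // [X in _ * X]mulrC mulrC. Qed.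

(** [bqj_u_div] and [bqj_u_divM] express the weights for c/s at x and x/s through the weight for c
    at x, so a common square root factors out and the polynomial relation remains. The first
    alternative is x = as, where x/s = a is off the grid and has coefficient 0. *)
Lemma bqj_r_contiguous_down x m : bqj_domain a b c x ->
  0 <= bqj_u a b c s x ->
  1 - x / (a * s) = 0 \/ x / (a * s) < 1 /\ x / s < 1 ->
  Num.sqrt ((1 - b * x / c) * (1 - x / c)) * bqj_r a b (c / s) s x m -
  Num.sqrt s * (Num.sqrt ((1 - x / (a * s)) * (1 - x / s)) *
    bqj_r a b (c / s) s (x / s) m) =
  x / Num.sqrt (a * s) *
    (Num.sqrt ((1 - a * b * s ^+ m.+1 / c) * (1 - (c * s ^+ m)^-1)) * bqj_r a b c s x m).
Proof.
case=> h1 h2 h3 h4 u0 hx.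
pose S := Num.sqrt (`|x| * bqj_u a b c s x).
have T1 : Num.sqrt ((1 - b * x / c) * (1 - x / c)) *
    Num.sqrt (`|x| * bqj_u a b (c / s) s x) = (1 - b * x / c) * S.
  apply: sqrtr_mul_sqr; rewrite ?mulr_ge0 ?subr_ge0 ?(ltW h2) ?(ltW h4) //.
  have := bqj_u_div h2 h4; set u1 := bqj_u _ _ _ _ _; set u2 := bqj_u _ _ _ _ _ => e.
  transitivity ((1 - b * x / c) * `|x| * (u1 * (1 - x / c))); first by ring.
  by rewrite e; ring.
have ss : Num.sqrt s * Num.sqrt s = s by rewrite -expr2 sqr_sqrtr // ltW.
have T2 : Num.sqrt s * (Num.sqrt ((1 - x / (a * s)) * (1 - x / s)) *
    Num.sqrt (`|x / s| * bqj_u a b (c / s) s (x / s))) = (1 - x / (a * s)) * S.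
  case: hx => [->|[h5 h6]]; first by rewrite !mul0r sqrtr0 mul0r mulr0.
  rewrite (@sqrtr_mul_sqr _ _ (1 - x / (a * s)) (s^-1 * (`|x| * bqj_u a b c s x))).
  - rewrite sqrtrM ?invr_ge0 ?(ltW s_gt0) // sqrtrV ?(ltW s_gt0) // -/S.
    have sn : Num.sqrt s != 0 by rewrite sqrtr_eq0 -ltNge.
    by rewrite mulrCA mulVKf.
  - by rewrite mulr_ge0 // subr_ge0 ltW.
  - by rewrite subr_ge0 ltW.
  have xsa : x / s / a = x / (a * s) by field; rewrite a_neq0 s_neq0.
  have h7 : x / s / a < 1 by rewrite xsa.
  have := bqj_u_divM h6 h7; rewrite divfK // normrM normfV (gtr0_norm s_gt0) xsa.
  set u1 := bqj_u _ _ _ _ _; set u2 := bqj_u _ _ _ _ _ => e.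
  transitivity ((1 - x / (a * s)) * (`|x| / s) * (u2 * (1 - x / s))); first by ring.
  by rewrite -e; ring.
rewrite !r_factor //.
transitivity (Num.sqrt (bqj_v a b (c / s) s m) *
  ((Num.sqrt ((1 - b * x / c) * (1 - x / c)) * Num.sqrt (`|x| * bqj_u a b (c / s) s x)) *
     bqj_P a b (c / s) s m x -
   (Num.sqrt s * (Num.sqrt ((1 - x / (a * s)) * (1 - x / s)) *
     Num.sqrt (`|x / s| * bqj_u a b (c / s) s (x / s)))) * bqj_P a b (c / s) s m (x / s))).
  by ring.
rewrite T1 T2.
transitivity (Num.sqrt (bqj_v a b (c / s) s m) * S *
  ((1 - b * x / c) * bqj_P a b (c / s) s m x -
   (1 - x / (a * s)) * bqj_P a b (c / s) s m (x / s))); first by ring.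
rewrite bqj_P_contiguous_down -/(Lam m).
transitivity (Lam m * Num.sqrt (bqj_v a b (c / s) s m) * S * x * bqj_P a b c s m x);
  first by ring.
by rewrite sqrt_v_div /G /S; ring.
Qed.

(** The first alternative is x = c: this is the first negative grid point for the parameter c/s but
    lies off the grid for c, and its coefficient vanishes. *)
Lemma bqj_r_contiguous_up x m : x < 1 -> x / a < 1 -> 0 <= bqj_u a b (c / s) s x ->
  1 - x / c = 0 \/ x / c < 1 /\ b * x / c < 1 ->
  Num.sqrt ((1 - b * x / c) * (1 - x / c)) * bqj_r a b c s x m -
  (Num.sqrt s)^-1 * (Num.sqrt ((1 - x / a) * (1 - x)) * bqj_r a b c s (x * s) m) =
  x / Num.sqrt (a * s) *
    (Num.sqrt ((1 - a * b * s ^+ m.+1 / c) * (1 - (c * s ^+ m)^-1)) *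
     bqj_r a b (c / s) s x m).
Proof.
move=> h1 h2 u0 hx.
pose S := Num.sqrt (`|x| * bqj_u a b (c / s) s x).
have T1 : Num.sqrt ((1 - b * x / c) * (1 - x / c)) *
    Num.sqrt (`|x| * bqj_u a b c s x) = (1 - x / c) * S.
  case: hx => [->|[h3 h4]]; first by rewrite mulr0 mul0r sqrtr0 mul0r.
  apply: sqrtr_mul_sqr; rewrite ?mulr_ge0 ?subr_ge0 ?(ltW h3) ?(ltW h4) //.
  have := bqj_u_div h3 h4; set u1 := bqj_u _ _ _ _ _; set u2 := bqj_u _ _ _ _ _ => e.
  transitivity ((1 - x / c) * `|x| * (u2 * (1 - b * x / c))); first by ring.
  by rewrite -e; ring.
have sn : Num.sqrt s != 0 by rewrite sqrtr_eq0 -ltNge.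
have T2 : (Num.sqrt s)^-1 * (Num.sqrt ((1 - x / a) * (1 - x)) *
    Num.sqrt (`|x * s| * bqj_u a b c s (x * s))) = (1 - x) * S.
  rewrite (@sqrtr_mul_sqr _ _ (1 - x) (s * (`|x| * bqj_u a b (c / s) s x))).
  - rewrite sqrtrM ?(ltW s_gt0) // -/S.
    by rewrite mulrCA mulKf.
  - by rewrite mulr_ge0 // subr_ge0 ltW.
  - by rewrite subr_ge0 ltW.
  have := bqj_u_divM h1 h2; rewrite normrM (gtr0_norm s_gt0).
  set u1 := bqj_u _ _ _ _ _; set u2 := bqj_u _ _ _ _ _ => e.
  transitivity ((1 - x) * (`|x| * s) * (u1 * (1 - x / a))); first by ring.
  by rewrite e; ring.
rewrite !r_factor //.
transitivity (Num.sqrt (bqj_v a b c s m) *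
  ((Num.sqrt ((1 - b * x / c) * (1 - x / c)) * Num.sqrt (`|x| * bqj_u a b c s x)) *
     bqj_P a b c s m x -
   ((Num.sqrt s)^-1 * (Num.sqrt ((1 - x / a) * (1 - x)) *
     Num.sqrt (`|x * s| * bqj_u a b c s (x * s)))) * bqj_P a b c s m (x * s))).
  by ring.
rewrite T1 T2.
transitivity (Num.sqrt (bqj_v a b c s m) * S *
  ((1 - x / c) * bqj_P a b c s m x - (1 - x) * bqj_P a b c s m (x * s))); first by ring.
rewrite bqj_P_contiguous_up.
transitivity ((1 - c^-1) * Num.sqrt (bqj_v a b c s m) * S * x * bqj_P a b (c / s) s m x);
  first by ring.
by rewrite sqrt_v_div' /G /S; ring.
Qed.

End Contiguity.

(** * Block unitaries *)

Section BlockSums.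
Context {R : realType} (I : choiceType).
Local Notation C := R[i].
Local Open Scope classical_set_scope.
Local Open Scope quotient_scope.

Lemma esum_sqr (x : nat -> R) : ell2 x ->
  \esum_(k in [set: nat]) (x k ^+ 2)%:E = (dot x x)%:E.
Proof.
move=> hx; rewrite -nneseries_esumT; last by move=> k; rewrite lee_fin sqr_ge0.
apply: cvg_lim => //; apply: cvg_EFin.
  by apply: nearW => n; rewrite sumEFin.
apply: eq_cvgn (ell2_dot_cvg hx hx) => n /=.
by rewrite sumEFin /series /=; apply: eq_bigr => k _; rewrite expr2.
Qed.

Lemma ell2_esum (x : nat -> R) :
  (\esum_(k in [set: nat]) (x k ^+ 2)%:E < +oo)%E -> ell2 x.
Proof.
rewrite -nneseries_esumT; last by move=> k; rewrite lee_fin sqr_ge0.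
by apply: nnseries_is_cvg => k; exact: sqr_ge0.
Qed.

Lemma le_esum_single (J : choiceType) (f : J -> \bar R) j :
  (forall i, 0 <= f i)%E -> (f j <= \esum_(i in [set: J]) f i)%E.
Proof.
move=> f0; have <- : (\esum_(i in [set j]) f i = f j)%E by exact: esum_set1.
rewrite esum_mkcond; apply: le_esum => i _.
by case: ifP.
Qed.

Section Blocks.
Context (idx : int * nat -> I) (hidx : bijective idx).
Implicit Types v : I -> C.

Definition block_re v (p : int) (k : nat) : R := complex.Re (v (idx (p, k))).
Definition block_im v (p : int) (k : nat) : R := complex.Im (v (idx (p, k))).

Lemma sqnorm_block v : sqnorm v =
  \esum_(p in [set: int]) \esum_(k in [set: nat]) (normc2 (v (idx (p, k))))%:E.
Proof.
rewrite esum_esum; last by move=> p k _ _; rewrite lee_fin normc2_ge0.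
have -> : [set: int] `*`` (fun=> [set: nat]) = [set: int * nat]%type.
  by apply/seteqP; split.
rewrite /sqnorm (reindex_esum [set: int * nat]%type _ idx); last by rewrite setTT_bijective.
by apply: eq_esum => -[p k] _.
Qed.

Lemma block_ell2 v p : square_summable v -> ell2 (block_re v p) /\ ell2 (block_im v p).
Proof.
rewrite /square_summable sqnorm_block => hv.
have h : (\esum_(k in [set: nat]) (normc2 (v (idx (p, k))))%:E < +oo)%E.
  apply: le_lt_trans hv.
  have := @le_esum_single _
    (fun r : int => \esum_(k in [set: nat]) (normc2 (v (idx (r, k))))%:E)%E p.
  by apply=> r; apply: esum_ge0 => k _; rewrite lee_fin normc2_ge0.
by split; apply: ell2_esum; apply: le_lt_trans h; apply: le_esum => k _;
  rewrite lee_fin /normc2 ?lerDl ?lerDr sqr_ge0.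
Qed.

Lemma sqnorm_dot v : (forall p, ell2 (block_re v p) /\ ell2 (block_im v p)) ->
  sqnorm v = \esum_(p in [set: int])
    (dot (block_re v p) (block_re v p) + dot (block_im v p) (block_im v p))%:E.
Proof.
move=> hv; rewrite sqnorm_block; apply: eq_esum => p _; have [h1 h2] := hv p.
rewrite EFinD -!esum_sqr // -esumD.
- by apply: eq_esum => k _.
- by move=> k _; rewrite lee_fin sqr_ge0.
- by move=> k _; rewrite lee_fin sqr_ge0.
Qed.

End Blocks.
End BlockSums.

(** * The unitary assembled from real orthogonal blocks *)

Section BlockUnitary.
Context {R : realType}.
Local Notation C := R[i].
Local Open Scope classical_set_scope.
Local Open Scope quotient_scope.

Definition swap_idx (pm : int * nat) : nat * int := (pm.2, pm.1).

Lemma swap_idx_bij : bijective swap_idx.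
Proof. by exists (fun mp : nat * int => (mp.2, mp.1)) => -[]. Qed.

Context (I : choiceType) (idx : int * nat -> I) (pos : I -> int * nat).
Context (idxK : cancel idx pos) (posK : cancel pos idx).
Context (T : int -> nat -> nat -> R).
Context (Trow : forall p, rows_orthonormal (T p)).
Context (Tcol : forall p, rows_orthonormal (fun m k => T p k m)).

Let hidx : bijective idx. Proof. by exists pos. Qed.

(** The blocks are real, so real and imaginary parts are transformed separately and the real
    sequence lemmas apply. *)
Definition block_fun (v : I -> C) (mp : nat * int) : C :=
  (mx_act (T mp.2) (block_re idx v mp.2) mp.1 +i*
   mx_act (T mp.2) (block_im idx v mp.2) mp.1)%C.

Lemma block_fun_sqnorm v : square_summable v -> sqnorm (block_fun v) = sqnorm v.
Proof.
move=> hv; have h p := block_ell2 hidx p hv.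
have hr p := mx_act_contraction (Trow p) (Tcol p).1 (h p).1.
have hi p := mx_act_contraction (Trow p) (Tcol p).1 (h p).2.
rewrite (sqnorm_dot hidx h) (sqnorm_dot swap_idx_bij); last first.
  by move=> p; split; [exact: (hr p).1|exact: (hi p).1].
apply: eq_esum => p _; congr (_ + _)%:E.
  exact: mx_act_isometry (Trow p) (Tcol p) (h p).1.
exact: mx_act_isometry (Trow p) (Tcol p) (h p).2.
Qed.

Lemma block_fun_summable (v : l2 (R := R) I) : square_summable (block_fun (val v)).
Proof. by rewrite /square_summable block_fun_sqnorm; exact: (valP v). Qed.

Definition block_op (v : l2 (R := R) I) : l2 (R := R) (nat * int)%type :=
  Sub (block_fun (val v)) (block_fun_summable v).

Lemma block_op_linear : linear block_op.
Proof.
move=> r u v; apply: val_inj; apply/funext => -[m p].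
have [u1 u2] := block_ell2 hidx p (valP u); have [v1 v2] := block_ell2 hidx p (valP v).
have E w1 w2 : val (r *: w1 + w2 : l2 (R := R) I) = r *: val w1 + val w2 by [].
have -> : val (r *: block_op u + block_op v) (m, p) =
  r * block_fun (val u) (m, p) + block_fun (val v) (m, p) by [].
rewrite [LHS]/(block_fun (val (r *: u + v)) (m, p)) E /block_fun /=.
have -> : block_re idx (r *: val u + val v) p = fun k =>
    complex.Re r * block_re idx (val u) p k +
    (- complex.Im r * block_im idx (val u) p k + block_re idx (val v) p k).
  apply/funext => k; rewrite /block_re /block_im.
  rewrite [(r *: val u + val v) _]/(r * val u (idx (p, k)) + val v (idx (p, k))).
  by case: (r) (val u _) (val v _) => a b [c d] [e f] /=; ring.
have -> : block_im idx (r *: val u + val v) p = fun k =>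
    complex.Re r * block_im idx (val u) p k +
    (complex.Im r * block_re idx (val u) p k + block_im idx (val v) p k).
  apply/funext => k; rewrite /block_re /block_im.
  rewrite [(r *: val u + val v) _]/(r * val u (idx (p, k)) + val v (idx (p, k))).
  by case: (r) (val u _) (val v _) => a b [c d] [e f] /=; ring.
have ml r0 x y : ell2 x -> ell2 y -> mx_act (T p) (fun k => r0 * x k + y k) m =
    r0 * mx_act (T p) x m + mx_act (T p) y m.
  by move=> hx hy; apply: mx_act_lin => //; exact: (@Tcol p).1.
rewrite !ml //; try exact: ell2_lin.
case: (r) => a b; rewrite /=.
by apply/eqP; rewrite eq_complex /=; apply/andP; split; apply/eqP; ring.
Qed.

Definition block_map : {linear l2 (R := R) I -> l2 (R := R) (nat * int)%type} :=
  HB.pack block_op (GRing.isLinear.Build C (l2 (R := R) I) (l2 (R := R) (nat * int)%type)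
    *:%R block_op block_op_linear).

Lemma block_op_unitary : unitary block_map.
Proof.
split=> [v|w]; first exact: block_fun_sqnorm (valP v).
have hw p := block_ell2 swap_idx_bij p (valP w).
pose B p x : nat -> R := mx_act (fun m k => T p k m) x.
(* The preimage is obtained from the transposed blocks: their contraction property makes it square
   summable, and [mx_actK] for the transposes shows that it maps to w. *)
pose v (i : I) : C := (B (pos i).1 (block_re swap_idx (val w) (pos i).1) (pos i).2 +i*
  B (pos i).1 (block_im swap_idx (val w) (pos i).1) (pos i).2)%C.
have vre p : block_re idx v p = B p (block_re swap_idx (val w) p).
  by apply/funext => k; rewrite /block_re /v idxK.
have vim p : block_im idx v p = B p (block_im swap_idx (val w) p).
  by apply/funext => k; rewrite /block_im /v idxK.
have cr p := mx_act_contraction (Tcol p) (Trow p).1 (hw p).1.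
have ci p := mx_act_contraction (Tcol p) (Trow p).1 (hw p).2.
have hv : square_summable v.
  rewrite /square_summable (sqnorm_dot hidx); last first.
    by move=> p; rewrite vre vim; split; [exact: (cr p).1|exact: (ci p).1].
  apply: le_lt_trans (valP w); rewrite (sqnorm_dot swap_idx_bij hw).
  by apply: le_esum => p _; rewrite lee_fin vre vim lerD //; [exact: (cr p).2|exact: (ci p).2].
exists (Sub v hv); apply: val_inj; apply/funext => -[m p].
rewrite [LHS]/(block_fun v (m, p)) /block_fun /= vre vim.
rewrite !(mx_actK (Tcol p) (Trow p).1) ?(hw p).1 ?(hw p).2 //.
  by rewrite /block_re /block_im /swap_idx /=; case: (val w _).
- exact: (hw p).2.
- exact: (hw p).1.
Qed.

Lemma block_op_basis p k m j :
  val (block_op (fin_l2 << idx (p, k) >>)) (m, j) = if j == p then (T p k m)%:C else 0.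
Proof.
rewrite [LHS]/(block_fun _ (m, j)) /block_fun /=.
have e k' : coeff (idx (j, k')) (<< idx (p, k) >> : fin R I) =
    ((j == p)%:R * delta_seq k k' : R)%:C.
  rewrite coeffU mul1r (can_eq idxK) xpair_eqE /delta_seq.
  rewrite [p == j]eq_sym [k == k']eq_sym.
  by case: eqP => _; case: eqP => _; rewrite ?mul1r ?mul0r.
have -> : block_re idx (fun i => coeff i (<< idx (p, k) >> : fin R I)) j =
    fun k' => (j == p)%:R * delta_seq k k' + 0.
  by apply/funext => k'; rewrite /block_re e addr0.
have -> : block_im idx (fun i => coeff i (<< idx (p, k) >> : fin R I)) j = fun=> 0.
  by apply/funext => k'; rewrite /block_im e.
rewrite mx_act_lin; [|exact: (@Tcol j).1|exact: ell2_delta|exact: ell20].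
rewrite /mx_act dot_delta dot0 addr0.
by case: eqP => [->|_]; rewrite ?mul1r ?mul0r.
Qed.

(** The m-th component of [block_op] on finite combinations. A basis vector of block p only
    contributes to e_p, so the result is finite; it is the witness that [hsum_graph] asks for. *)
Definition block_fin (m : nat) : fin R I -> fin R int :=
  fglift (fun i => (T (pos i).1 (pos i).2 m)%:C *: << (pos i).1 >>).

Lemma block_fin_basis m p k : block_fin m << idx (p, k) >> = (T p k m)%:C *: << p >>.
Proof. by rewrite /block_fin fgliftE idxK. Qed.

Lemma fin_l2_linear (A : choiceType) : linear (@fin_l2 R A).
Proof.
move=> r u v; apply: val_inj; apply/funext => i.
change (coeff i (r *: u + v) = r * coeff i u + coeff i v).
by rewrite coeffD coeffZ.
Qed.

Lemma block_op_fin u m j : val (block_op (fin_l2 u)) (m, j) = coeff j (block_fin m u).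
Proof.
move: u; apply: (@fin_ext _ I (R[i] : lmodType C)^o
  (fun u => val (block_op (fin_l2 u)) (m, j)) (fun u => coeff j (block_fin m u))).
- by move=> r u v; rewrite fin_l2_linear block_op_linear.
- by move=> r u v; rewrite /block_fin fglift_linear coeffD coeffZ.
- move=> i; rewrite -(posK i); case: (pos i) => p k.
  rewrite block_op_basis block_fin_basis coeffZ coeffU mul1r eq_sym.
  by case: eqP => _; rewrite ?mulr1 ?mulr0.
Qed.

Context (q : R) (A : urepr q (fin R I)) (S : nat -> urepr q (fin R int)).

Lemma urepr_intertwine (V W : lmodType C) (B : urepr q V) (D : urepr q W) (f : V -> W) :
  linear f -> (forall g v, f (B (uq_gen q g) v) = D (uq_gen q g) (f v)) ->
  forall X v, f (B X v) = D X (f v).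
Proof.
move=> lf hg; elim/quotW=> x.
have cst (Z : lmodType C) (H : urepr q Z) c v : H (\pi_(Uq q) (Uconst c)) v = c *: v.
  have H0 : H 0 v = 0.
    have := uactP H 1 0 0 v; rewrite scaler0 addr0 scale1r => h.
    by apply: (addrI (H 0 v)); rewrite addr0.
  have := uactP H c 1 0 v; rewrite H0 !addr0 uact1 => <-.
  by congr (H _ v); rewrite [RHS](_ : _ = uq_const q c * 1) // mulr1.
have add (Z : lmodType C) (H : urepr q Z) X Y v : H (uq_add X Y) v = H X v + H Y v.
  by have := uactP H 1 X Y v; rewrite !scale1r.
have mul (Z : lmodType C) (H : urepr q Z) X Y v : H (uq_mul X Y) v = H X (H Y v).
  exact: uactM.
elim: x => [c|g|x ihx y ihy|x ihx y ihy] v.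
- by rewrite !cst (linear_scaleE lf).
- exact: hg.
- by rewrite -uq_addE !add (linear_addE lf) ihx ihy.
- by rewrite -uq_mulE !mul ihx ihy.
Qed.

Lemma block_op_intertwiner :
  (forall g m p k, block_fin m (A (uq_gen q g) << idx (p, k) >>) =
     S m (uq_gen q g) ((T p k m)%:C *: << p >>)) ->
  unitary_intertwiner A S block_map.
Proof.
move=> hg; split; first exact: block_op_unitary.
move=> X v m; exists (block_fin m v) => j; rewrite block_op_fin //.
congr coeff; move: X v; apply: urepr_intertwine; first exact: fglift_linear.
move=> g; apply: fin_ext.
- by apply: linear_comp_of; [exact: fglift_linear|exact: uact_linear].
- by apply: linear_comp_of; [exact: uact_linear|exact: fglift_linear].
- by move=> i; rewrite -(posK i); case: (pos i) => p k; rewrite hg block_fin_basis.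
Qed.

End BlockUnitary.

(** * Matrix coefficients of the intertwiner *)

Section Coefficients.
Context {R : realType} (q : R) (hq : 0 < q < 1).
Context (k1 k2 : R) (k1_gt0 : 0 < k1) (k2_gt0 : 0 < k2) (eps : R).
Let q0 : 0 < q. Proof. by case/andP: hq. Qed.
Let q1 : q < 1. Proof. by case/andP: hq. Qed.

Definition par_a : R := q `^ (4 * k1 - 2).
Definition par_b : R := q `^ (4 * k2 - 2).
Definition par_c (p : int) : R := - q `^ (4 * k1 - 2 * p%:~R - 2 * eps - 2).
Local Notation a := par_a.
Local Notation b := par_b.
Local Notation c := par_c.
Local Notation s := (q ^+ 2).

Let qD x y : q `^ (x + y) = q `^ x * q `^ y.
Proof. by apply: powRD; rewrite (gt_eqF q0) implybT. Qed.
Let qN x : q `^ (- x) = (q `^ x)^-1. Proof. exact: powRN. Qed.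
Let q_gt0 x : 0 < q `^ x. Proof. exact: powR_gt0. Qed.
Let q_lt1 x : 0 < x -> q `^ x < 1.
Proof.
move=> x0; rewrite -(powRr0 q) /powR !gt_eqF // ltr_expR ltr_nM2r //.
by rewrite ln_lt0 // q0.
Qed.
Let qE : q = q `^ 1. Proof. by rewrite powRr1 // ltW. Qed.
Let sXE n : s ^+ n = q `^ (2 * n%:R).
Proof.
elim: n => [|n ih]; first by rewrite mulr0 powRr0.
rewrite exprSr ih expr2 {2 3}qE -!qD; congr (q `^ _).
by rewrite -natr1; ring.
Qed.
Let sE : s = q `^ 2. Proof. by rewrite -[LHS]expr1 sXE mulr1. Qed.
Let posI n : (n%:Z)%:~R = n%:R :> R. Proof. by []. Qed.

Let s_gt0 : 0 < s. Proof. by rewrite exprn_gt0. Qed.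
Let s_lt1 : s < 1. Proof. by rewrite exprn_ilt1 // ltW. Qed.
Let sqrt_s : Num.sqrt s = q. Proof. by rewrite sqrtr_sqr gtr0_norm. Qed.

Let qV1 : q `^ (- 1) = q^-1. Proof. by rewrite powRN -qE. Qed.

Ltac powers := rewrite ?sXE ?sE ?invfM; repeat (rewrite -qN || rewrite -qD);
  congr (q `^ _); rewrite ?intrD ?intrB ?posI; lra.

Lemma par_params p : bqj_params s a b (c p).
Proof.
have h (k : R) : 0 < k -> q `^ (4 * k - 2) * s < 1.
  move=> k0; have -> : q `^ (4 * k - 2) * s = q `^ (4 * k) by powers.
  by apply: q_lt1; rewrite mulr_gt0.
split; rewrite ?q_gt0 ?h //.
by rewrite oppr_lt0.
Qed.

Lemma par_cS p : c (p + 1) = c p / s.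
Proof. by rewrite /c mulNr; congr (- _); powers. Qed.

Lemma par_cP p : c p = c (p - 1) / s.
Proof. by rewrite -par_cS subrK. Qed.

Let sqrt_as : Num.sqrt (a * s) = q `^ (2 * k1).
Proof.
have -> : a * s = (q `^ (2 * k1)) ^+ 2 by rewrite [RHS]expr2 /a; powers.
by rewrite sqrtr_sqr gtr0_norm.
Qed.

Lemma Theta_minusE p n m :
  Theta_minus q k1 k2 eps p n m = bqj_r a b (c p) s (a * s ^+ n.+1) m.
Proof. by rewrite /Theta_minus; congr bqj_r; rewrite /a; powers. Qed.

Lemma Theta_plusE p n m :
  Theta_plus q k1 k2 eps p n m = (-1) ^+ n * bqj_r a b (c p) s (c p * s ^+ n.+1) m.
Proof.
rewrite /Theta_plus; congr (_ * _); congr bqj_r.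
by rewrite /c mulNr; congr (- _); powers.
Qed.

(** This identity is the origin of the parameters k1 + k2 - 1/2 + m and eps - k1 + k2 of the m-th
    summand; the plus signs come from c < 0. *)
Let G_princ p m : (1 - a * b * s ^+ m.+1 / c p) * (1 - (c p * s ^+ m)^-1) =
  (1 + q `^ (2 * p%:~R + 2 * (eps - k1 + k2) + 2 * (k1 + k2 - 2^-1 + m%:R) + 1)) *
  (1 + q `^ (2 * p%:~R + 2 * (eps - k1 + k2) - 2 * (k1 + k2 - 2^-1 + m%:R) + 1)).
Proof.
rewrite /c invrN mulrN opprK mulNr invrN opprK.
by congr ((1 + _) * (1 + _)); rewrite /a /b; powers.
Qed.

Let G_princ' p m : (1 - a * b * s ^+ m.+1 / c (p - 1)) * (1 - (c (p - 1) * s ^+ m)^-1) =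
  (1 + q `^ (2 * p%:~R + 2 * (eps - k1 + k2) + 2 * (k1 + k2 - 2^-1 + m%:R) - 1)) *
  (1 + q `^ (2 * p%:~R + 2 * (eps - k1 + k2) - 2 * (k1 + k2 - 2^-1 + m%:R) - 1)).
Proof.
rewrite /c invrN mulrN opprK mulNr invrN opprK.
by congr ((1 + _) * (1 + _)); rewrite /a /b; powers.
Qed.

Let delta := (q^-1 - q)^-1.

(** E sends f^-_{p,n} to a combination of f^-_{p+1,n} and f^-_{p+1,n-1}, which belong to the points
    x and x/s of the grid for c/s. The minus sign of the contiguous relation is the sign of
    [disc_down]. *)
Lemma Theta_minus_up p n m :
  princ_up q (k1 + k2 - 2^-1 + m%:R) (eps - k1 + k2) p * Theta_minus q k1 k2 eps p n m =
  q `^ (- (k1 + n%:R)) * princ_up q (k2 - 2^-1) (eps + k2) (n%:Z + p) *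
    Theta_minus q k1 k2 eps (p + 1) n m +
  disc_down q k1 n * (q `^ ((n%:Z + p)%:~R + (eps + k2)))^-1 *
    Theta_minus q k1 k2 eps (p + 1) n.-1 m.
Proof.
have hp := par_params p; set x := a * s ^+ n.+1.
have dom : bqj_domain a b (c p) x := bqj_domain_pos s_gt0 s_lt1 hp n.
have hx : 1 - x / (a * s) = 0 \/ x / (a * s) < 1 /\ x / s < 1.
  have e1 : x / (a * s) = s ^+ n by rewrite /x /a; powers.
  rewrite e1; case: n @x dom e1 => [|n] x dom e1; first by left; rewrite subrr.
  right; split; first by rewrite exprn_ilt1 // ltW.
  have [_ _ + _] := bqj_domain_pos s_gt0 s_lt1 hp n; congr (_ < 1).
  by rewrite /x /a; powers.
have := bqj_r_contiguous_down s_gt0 s_lt1 hp m dom (ltW (bqj_u_ge0 s_gt0 s_lt1 dom)) hx.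
rewrite -par_cS sqrt_s sqrt_as.
have -> : (1 - b * x / c p) * (1 - x / c p) =
    (1 + q `^ (2 * (n%:Z + p)%:~R + 2 * (eps + k2) + 2 * (k2 - 2^-1) + 1)) *
    (1 + q `^ (2 * (n%:Z + p)%:~R + 2 * (eps + k2) - 2 * (k2 - 2^-1) + 1)).
  rewrite /c invrN !mulrN !opprK.
  by congr ((1 + _) * (1 + _)); rewrite /x /a /b; powers.
have -> : (1 - x / (a * s)) * (1 - x / s) =
    (1 - q `^ (2 * n%:R)) * (1 - q `^ (4 * k1 + 2 * n%:R - 2)).
  by congr ((1 - _) * (1 - _)); rewrite /x /a; powers.
rewrite G_princ /princ_up /disc_down -/delta !Theta_minusE.
set S1 := Num.sqrt _; set S2 := Num.sqrt _; set S := Num.sqrt _ => H.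
(* For n = 0 the point x/s is off the grid while [n.-1] is 0, so the two values of [bqj_r] are
   unrelated; the factor S2 is then 0. *)
have e2 : S2 * bqj_r a b (c (p + 1)) s (x / s) m =
    S2 * bqj_r a b (c (p + 1)) s (a * s ^+ n.-1.+1) m.
  case: n @x dom hx @S @S1 @S2 H => [|n] x dom hx S S1 S2 H.
    by rewrite /S2 mulr0 powRr0 subrr mul0r sqrtr0 !mul0r.
  by congr (_ * bqj_r _ _ _ _ _ _); rewrite /x /a; powers.
rewrite e2 in H.
have E1 : q `^ (- 2^-1 - p%:~R - (eps - k1 + k2)) =
    q `^ (- (k1 + n%:R)) * q `^ (- 2^-1 - (n%:Z + p)%:~R - (eps + k2)) *
    (x / q `^ (2 * k1)) by rewrite /x /a; powers.
have E2 : q `^ (2^-1 - k1 - n%:R) * (q `^ ((n%:Z + p)%:~R + (eps + k2)))^-1 =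
    q `^ (- (k1 + n%:R)) * q `^ (- 2^-1 - (n%:Z + p)%:~R - (eps + k2)) * q.
  by rewrite [X in _ = _ * X]qE; powers.
rewrite E1; set B := q `^ (- (k1 + n%:R)) * q `^ (- 2^-1 - (n%:Z + p)%:~R - (eps + k2)).
rewrite -/B in E2.
transitivity (delta * B * (x / q `^ (2 * k1) * (S * bqj_r a b (c p) s x m))); first by ring.
rewrite -H.
set r1 := bqj_r _ _ _ _ x m; set r2 := bqj_r _ _ _ _ _ m.
transitivity (delta * B * S1 * r1 - delta * (B * q) * S2 * r2); first by ring.
by rewrite -E2 /B; ring.
Qed.

(** F lowers p, so the upward relation is used with c (p - 1), for which c p is c (p - 1) / s; the
    points x and xs belong to n and n + 1. *)
Lemma Theta_minus_down p n m :
  princ_down q (k1 + k2 - 2^-1 + m%:R) (eps - k1 + k2) p * Theta_minus q k1 k2 eps p n m =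
  q `^ (- (k1 + n%:R)) * princ_down q (k2 - 2^-1) (eps + k2) (n%:Z + p) *
    Theta_minus q k1 k2 eps (p - 1) n m +
  disc_up q k1 n * (q `^ ((n%:Z + p)%:~R + (eps + k2)))^-1 *
    Theta_minus q k1 k2 eps (p - 1) n.+1 m.
Proof.
have hp := par_params (p - 1); set x := a * s ^+ n.+1.
have dom' : bqj_domain a b (c p) x := bqj_domain_pos s_gt0 s_lt1 (par_params p) n.
have u0 := ltW (bqj_u_ge0 s_gt0 s_lt1 dom'); rewrite par_cP in u0.
have [h1 h2 h3 h4] : bqj_domain a b (c (p - 1)) x := bqj_domain_pos s_gt0 s_lt1 hp n.
have := bqj_r_contiguous_up s_gt0 s_lt1 hp m h3 h1 u0 (or_intror (conj h2 h4)).
rewrite -par_cP sqrt_s sqrt_as.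
have -> : (1 - b * x / c (p - 1)) * (1 - x / c (p - 1)) =
    (1 + q `^ (2 * (n%:Z + p)%:~R + 2 * (eps + k2) + 2 * (k2 - 2^-1) - 1)) *
    (1 + q `^ (2 * (n%:Z + p)%:~R + 2 * (eps + k2) - 2 * (k2 - 2^-1) - 1)).
  rewrite /c invrN !mulrN !opprK.
  by congr ((1 + _) * (1 + _)); rewrite /x /a /b; powers.
have -> : (1 - x / a) * (1 - x) =
    (1 - q `^ (2 * n%:R + 2)) * (1 - q `^ (4 * k1 + 2 * n%:R)).
  by congr ((1 - _) * (1 - _)); rewrite /x /a; powers.
have -> : x * s = a * s ^+ n.+2 by rewrite /x [in RHS]exprSr mulrA.
rewrite G_princ' /princ_down /disc_up -/delta !Theta_minusE.
set S1 := Num.sqrt _; set S2 := Num.sqrt _; set S := Num.sqrt _ => H.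
have E1 : q `^ (2^-1 - p%:~R - (eps - k1 + k2)) =
    q `^ (- (k1 + n%:R)) * q `^ (2^-1 - (n%:Z + p)%:~R - (eps + k2)) *
    (x / q `^ (2 * k1)) by rewrite /x /a; powers.
have E2 : q `^ (- 2^-1 - k1 - n%:R) * (q `^ ((n%:Z + p)%:~R + (eps + k2)))^-1 =
    q `^ (- (k1 + n%:R)) * q `^ (2^-1 - (n%:Z + p)%:~R - (eps + k2)) * q^-1.
  by rewrite -qV1; powers.
rewrite E1; set B := q `^ (- (k1 + n%:R)) * q `^ (2^-1 - (n%:Z + p)%:~R - (eps + k2)).
rewrite -/B in E2.
transitivity (- delta * B * (x / q `^ (2 * k1) * (S * bqj_r a b (c p) s x m))); first by ring.
rewrite -H.
set r1 := bqj_r _ _ _ _ x m; set r2 := bqj_r _ _ _ _ _ m.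
transitivity (- delta * B * S1 * r1 + delta * (B * q^-1) * S2 * r2); first by ring.
by rewrite -E2 /B; ring.
Qed.

Context (twoeps : int) (heps : 2 * eps = twoeps%:~R).
Let N (p : int) (n : nat) : int := twoeps - n%:Z + p.
Let NE p n : (N p n)%:~R = 2 * eps - n%:R + p%:~R :> R.
Proof. by rewrite /N intrD intrB heps. Qed.

(** The index 2 eps - n + p of the principal series factor in f^+ decreases with n, so its radicands
    contain the inverses of the powers of q in the contiguous relations. *)
Let sqrt_reflect x y : Num.sqrt ((1 + q `^ x) * (1 + q `^ y)) =
  q `^ ((x + y) / 2) * Num.sqrt ((1 + q `^ (- x)) * (1 + q `^ (- y))).
Proof.
have -> : (1 + q `^ x) * (1 + q `^ y) =
    (q `^ ((x + y) / 2)) ^+ 2 * ((1 + q `^ (- x)) * (1 + q `^ (- y))).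
  have -> : (q `^ ((x + y) / 2)) ^+ 2 = q `^ x * q `^ y.
    by rewrite expr2 -!qD; congr (q `^ _); lra.
  by rewrite !qN; field; rewrite !gt_eqF.
by rewrite sqrtrM ?sqr_ge0 // sqrtr_sqr gtr0_norm.
Qed.

(** The negative half-grid moves with p: as c (p + 1) = c p / s, the point x has index n + 1 for p +
    1, and x/s has index n. The signs from x < 0 and from (-1)^n make all coefficients positive. *)
Lemma Theta_plus_up p n m :
  princ_up q (k1 + k2 - 2^-1 + m%:R) (eps - k1 + k2) p * Theta_plus q k1 k2 eps p n m =
  q `^ ((N p n)%:~R + (- eps - k1)) * disc_up q k2 n *
    Theta_plus q k1 k2 eps (p + 1) n.+1 m +
  princ_up q (k1 - 2^-1) (- eps - k1) (N p n) * (q `^ (k2 + n%:R))^-1 *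
    Theta_plus q k1 k2 eps (p + 1) n m.
Proof.
have hp := par_params p; set x := c p * s ^+ n.+1.
pose y := q `^ (4 * k1 - 2 * p%:~R - 2 * eps - 2) * s ^+ n.+1.
have xE : x = - y by rewrite /x /c mulNr.
have y0 : 0 < y by rewrite mulr_gt0 ?exprn_gt0.
have dom : bqj_domain a b (c p) x := bqj_domain_neg s_gt0 s_lt1 hp n.
have lt1 t : 0 < t -> x / t < 1.
  by move=> t0; apply: lt_trans ltr01; rewrite xE mulNr oppr_lt0 divr_gt0.
have hx : 1 - x / (a * s) = 0 \/ x / (a * s) < 1 /\ x / s < 1.
  by right; split; apply: lt1 => //; rewrite mulr_gt0 //; exact: powR_gt0.
have := bqj_r_contiguous_down s_gt0 s_lt1 hp m dom (ltW (bqj_u_ge0 s_gt0 s_lt1 dom)) hx.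
rewrite -par_cS sqrt_s sqrt_as.
have -> : (1 - b * x / c p) * (1 - x / c p) =
    (1 - q `^ (2 * n%:R + 2)) * (1 - q `^ (4 * k2 + 2 * n%:R)).
  rewrite mulrC /x /c !(mulNr, invrN, mulrN) !opprK.
  by congr ((1 - _) * (1 - _)); rewrite /b; powers.
have -> : (1 - x / (a * s)) * (1 - x / s) =
    (1 + q `^ (2 * n%:R - 2 * p%:~R - 2 * eps)) *
    (1 + q `^ (4 * k1 - 2 * p%:~R - 2 * eps - 2 + 2 * n%:R)).
  rewrite xE !mulNr !opprK.
  by congr ((1 + _) * (1 + _)); rewrite /y /a; powers.
rewrite sqrt_reflect; set w := q `^ (_ / 2).
rewrite G_princ /princ_up /disc_up -/delta !Theta_plusE.
have -> : 2 * (N p n)%:~R + 2 * (- eps - k1) + 2 * (k1 - 2^-1) + 1 =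
  - (2 * n%:R - 2 * p%:~R - 2 * eps) by rewrite NE; lra.
have -> : 2 * (N p n)%:~R + 2 * (- eps - k1) - 2 * (k1 - 2^-1) + 1 =
  - (4 * k1 - 2 * p%:~R - 2 * eps - 2 + 2 * n%:R) by rewrite NE; lra.
have -> : x / s = c (p + 1) * s ^+ n.+1 by rewrite par_cS /x mulrAC.
have -> : c (p + 1) * s ^+ n.+2 = x.
  by rewrite par_cS /x [s ^+ n.+2]exprS mulrA divfK // gt_eqF.
set S1 := Num.sqrt _; set S2 := Num.sqrt _; set S := Num.sqrt _ => H.
have E1 : q `^ (- 2^-1 - p%:~R - (eps - k1 + k2)) =
    q `^ ((N p n)%:~R + (- eps - k1)) * q `^ (- 2^-1 - k2 - n%:R) *
    (y / q `^ (2 * k1)) by rewrite NE /y; powers.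
have E2 : q `^ (- 2^-1 - (N p n)%:~R - (- eps - k1)) * (q `^ (k2 + n%:R))^-1 =
    q `^ ((N p n)%:~R + (- eps - k1)) * q `^ (- 2^-1 - k2 - n%:R) * (q * w).
  by rewrite NE [X in _ = _ * (X * _)]qE /w; powers.
rewrite E1; set B := q `^ ((N p n)%:~R + _) * q `^ (- 2^-1 - k2 - n%:R).
rewrite -/B in E2; set r := bqj_r _ _ (c p) _ _ _ in H *.
transitivity (- delta * (-1) ^+ n * B * (x / q `^ (2 * k1) * (S * r))).
  by rewrite xE; ring.
rewrite -H.
set r1 := bqj_r _ _ _ _ x m; set r2 := bqj_r _ _ _ _ _ m.
transitivity (delta * B * S1 * ((-1) ^+ n.+1 * r1) +
  delta * (B * (q * w)) * S2 * ((-1) ^+ n * r2)).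
  by rewrite exprS; ring.
by rewrite -E2 /B; ring.
Qed.

Lemma Theta_plus_down p n m :
  princ_down q (k1 + k2 - 2^-1 + m%:R) (eps - k1 + k2) p * Theta_plus q k1 k2 eps p n m =
  q `^ ((N p n)%:~R + (- eps - k1)) * disc_down q k2 n *
    Theta_plus q k1 k2 eps (p - 1) n.-1 m +
  princ_down q (k1 - 2^-1) (- eps - k1) (N p n) * (q `^ (k2 + n%:R))^-1 *
    Theta_plus q k1 k2 eps (p - 1) n m.
Proof.
have hp := par_params (p - 1); set x := c p * s ^+ n.+1.
pose y := q `^ (4 * k1 - 2 * p%:~R - 2 * eps - 2) * s ^+ n.+1.
have xE : x = - y by rewrite /x /c mulNr.
have xE' : x = c (p - 1) * s ^+ n.
  by rewrite /x par_cP [s ^+ n.+1]exprS mulrA divfK // gt_eqF.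
have y0 : 0 < y by rewrite mulr_gt0 ?exprn_gt0.
have dom : bqj_domain a b (c p) x := bqj_domain_neg s_gt0 s_lt1 (par_params p) n.
have u0 := ltW (bqj_u_ge0 s_gt0 s_lt1 dom); rewrite par_cP in u0.
have [h1 _ h3 _] := dom.
have hx : 1 - x / c (p - 1) = 0 \/ x / c (p - 1) < 1 /\ b * x / c (p - 1) < 1.
  rewrite xE'; case: (n) => [|k].
    by left; rewrite mulr1 divff ?subrr // lt_eqF //; case: hp.
  by right; have [_ ? _ ?] := bqj_domain_neg s_gt0 s_lt1 hp k.
have := bqj_r_contiguous_up s_gt0 s_lt1 hp m h3 h1 u0 hx.
rewrite -par_cP sqrt_s sqrt_as.
have -> : (1 - b * x / c (p - 1)) * (1 - x / c (p - 1)) =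
    (1 - q `^ (2 * n%:R)) * (1 - q `^ (4 * k2 + 2 * n%:R - 2)).
  rewrite xE' mulrC /c !(mulNr, invrN, mulrN) !opprK.
  by congr ((1 - _) * (1 - _)); rewrite /b; powers.
have -> : (1 - x / a) * (1 - x) =
    (1 + q `^ (2 * n%:R - 2 * p%:~R - 2 * eps + 2)) *
    (1 + q `^ (4 * k1 - 2 * p%:~R - 2 * eps + 2 * n%:R)).
  rewrite xE !mulNr !opprK.
  by congr ((1 + _) * (1 + _)); rewrite /y /a; powers.
rewrite sqrt_reflect; set w := q `^ (_ / 2).
rewrite G_princ' /princ_down /disc_down -/delta !Theta_plusE.
have -> : 2 * (N p n)%:~R + 2 * (- eps - k1) + 2 * (k1 - 2^-1) - 1 =
  - (2 * n%:R - 2 * p%:~R - 2 * eps + 2) by rewrite NE; lra.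
have -> : 2 * (N p n)%:~R + 2 * (- eps - k1) - 2 * (k1 - 2^-1) - 1 =
  - (4 * k1 - 2 * p%:~R - 2 * eps + 2 * n%:R) by rewrite NE; lra.
have -> : x * s = c (p - 1) * s ^+ n.+1 by rewrite xE' [s ^+ n.+1]exprSr mulrA.
set S1 := Num.sqrt _; set S2 := Num.sqrt _; set S := Num.sqrt _ => H.
(* Relative to c (p - 1) the point x has index n - 1, whence the extra sign. For n = 0 it is off the
   grid, [n.-1] is a default value, and S1 = 0 makes both sides vanish. *)
have e1 : (-1) ^+ n * (S1 * bqj_r a b (c (p - 1)) s x m) =
    - (S1 * ((-1) ^+ n.-1 * bqj_r a b (c (p - 1)) s (c (p - 1) * s ^+ n.-1.+1) m)).
  rewrite xE' /S1; case: (n) => [|k] /=.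
    by rewrite mulr0 powRr0 subrr mul0r sqrtr0 !mul0r mulr0 oppr0.
  by rewrite [X in X * _]exprS; ring.
have E1 : q `^ (2^-1 - p%:~R - (eps - k1 + k2)) =
    q `^ ((N p n)%:~R + (- eps - k1)) * q `^ (2^-1 - k2 - n%:R) *
    (y / q `^ (2 * k1)) by rewrite NE /y; powers.
have E2 : q `^ (2^-1 - (N p n)%:~R - (- eps - k1)) * (q `^ (k2 + n%:R))^-1 =
    q `^ ((N p n)%:~R + (- eps - k1)) * q `^ (2^-1 - k2 - n%:R) * (q^-1 * w).
  by rewrite NE -qV1 /w; powers.
rewrite E1; set B := q `^ ((N p n)%:~R + _) * q `^ (2^-1 - k2 - n%:R).
rewrite -/B in E2; set r := bqj_r _ _ (c p) _ _ _ in H *.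
transitivity (delta * (-1) ^+ n * B * (x / q `^ (2 * k1) * (S * r))).
  by rewrite xE; ring.
rewrite -H.
set r2 := bqj_r _ _ _ _ (c (p - 1) * s ^+ n.+1) m.
transitivity (delta * B * ((-1) ^+ n * (S1 * bqj_r a b (c (p - 1)) s x m)) -
  delta * (B * (q^-1 * w)) * S2 * ((-1) ^+ n * r2)); first by ring.
by rewrite e1 -E2 /B; ring.
Qed.

End Coefficients.

(** * The intertwiner *)

Section TensorBasis.
Context {R : realType} (q : R) (hq : 0 < q < 1).

Lemma dsum_repr_inl (I J : choiceType) (T1 : urepr q (fin R I)) (T2 : urepr q (fin R J))
  X i : dsum_repr T1 T2 X << inl i >> = fin_map inl (T1 X << i >>).
Proof. by rewrite -[RHS](dsum_inl T1 T2 X) /fin_map fgliftE. Qed.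

Lemma dsum_repr_inr (I J : choiceType) (T1 : urepr q (fin R I)) (T2 : urepr q (fin R J))
  X j : dsum_repr T1 T2 X << inr j >> = fin_map inr (T2 X << j >>).
Proof. by rewrite -[RHS](dsum_inr T1 T2 X) /fin_map fgliftE. Qed.

Lemma urepr_of_shift (I : choiceType) (kap wE wF : I -> R) (f h : I -> I)
  (H : urels q (shift_gen kap wE wF f h)) (r : R) g i :
  urepr_of H (uq_gen q g) (r%:C *: << i >>) =
  match g with
  | gK => (r * kap i)%:C *: << i >>
  | gKinv => (r * (kap i)^-1)%:C *: << i >>
  | gE => (r * wE i)%:C *: << f i >>
  | gF => (r * wF i)%:C *: << h i >>
  end.
Proof.
rewrite [LHS](urep_gen H).
by case: g; rewrite /= wshiftZ wshiftE scalerA -rmorphM.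
Qed.

Lemma tens_repr_shift (I J : choiceType)
  (kap1 wE1 wF1 : I -> R) (f1 h1 : I -> I) (kap2 wE2 wF2 : J -> R) (f2 h2 : J -> J)
  (H1 : urels q (shift_gen kap1 wE1 wF1 f1 h1))
  (H2 : urels q (shift_gen kap2 wE2 wF2 f2 h2)) g i j :
  tens_repr hq (urepr_of H1) (urepr_of H2) (uq_gen q g) << (i, j) >> =
  match g with
  | gK => (kap1 i * kap2 j)%:C *: << (i, j) >>
  | gKinv => ((kap1 i)^-1 * (kap2 j)^-1)%:C *: << (i, j) >>
  | gE => (kap1 i * wE2 j)%:C *: << (i, f2 j) >> +
          (wE1 i * (kap2 j)^-1)%:C *: << (f1 i, j) >>
  | gF => (kap1 i * wF2 j)%:C *: << (i, h2 j) >> +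
          (wF1 i * (kap2 j)^-1)%:C *: << (h1 i, j) >>
  end.
Proof.
have E1 := urep_gen H1; have E2 := urep_gen H2.
rewrite [LHS]urep_gen; last exact: tens_urels.
rewrite /tens_gen /coproduct; case: g;
  rewrite ?big_cons big_nil addr0 /op_tens !fgliftE /= !E1 !E2 /= !wshiftE;
  by rewrite !(fin_tensZl, fin_tensZr, fin_tens_basis) !scalerA -!rmorphM.
Qed.

End TensorBasis.

(** * Weight spaces and the intertwining of the generators *)

Section Intertwiner.
Context {R : realType} (q : R) (hq : 0 < q < 1).
Context (k1 k2 : R) (hk1 : 0 < k1) (hk2 : 0 < k2).
Context (eps : R) (twoeps : int) (heps : 2 * eps = twoeps%:~R).
Local Open Scope quotient_scope.

(* The K-eigenspaces: for fixed [p], the vectors f^-_{p,n} sit at the even and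
   the f^+_{p,n} at the odd positions, as in [bqj_grid]. *)
Definition weight_idx (pk : int * nat) : nat * int + int * nat :=
  if odd pk.2 then inr (twoeps - pk.2./2%:Z + pk.1, pk.2./2)
  else inl (pk.2./2, pk.2./2%:Z + pk.1).

Definition weight_pos (i : nat * int + int * nat) : int * nat :=
  match i with
  | inl (n, j) => (j - n%:Z, n.*2)
  | inr (j, n) => (j - twoeps + n%:Z, n.*2.+1)
  end.

Lemma weight_idxK : cancel weight_idx weight_pos.
Proof.
case=> p k; rewrite /weight_idx /=; case: ifPn => ok /=; congr (_, _); try ring.
  by rewrite -[RHS]odd_double_half ok.
by rewrite -[RHS]odd_double_half (negbTE ok).
Qed.

Lemma weight_posK : cancel weight_pos weight_idx.
Proof.
case=> [[n j]|[j n]]; rewrite /weight_idx /= ?odd_double /= ?uphalf_double ?doubleK.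
  by congr (inl (_, _)); ring.
by congr (inr (_, _)); ring.
Qed.

Definition Theta_mx (p : int) (k m : nat) : R :=
  if odd k then Theta_plus q k1 k2 eps p k./2 m else Theta_minus q k1 k2 eps p k./2 m.

Lemma Theta_mxE p :
  Theta_mx p = bqj_mx (q ^+ 2) (par_a q k1) (par_b q k2) (par_c q k1 eps p).
Proof.
apply/funext => k; apply/funext => m.
rewrite /Theta_mx /bqj_mx /bqj_sign /bqj_grid /interleave.
by case: odd; rewrite ?Theta_plusE ?Theta_minusE ?mul1r.
Qed.

Let q2 : 0 < q ^+ 2 < 1.
Proof. by case/andP: hq => q0 q1; rewrite exprn_gt0 // exprn_ilt1 // ltW. Qed.

Lemma Theta_mx_rows p : rows_orthonormal (Theta_mx p).
Proof.
by case/andP: q2 => ? ?; rewrite Theta_mxE; apply: bqj_mx_rows => //; exact: par_params.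
Qed.

Lemma Theta_mx_cols p : rows_orthonormal (fun m k => Theta_mx p k m).
Proof.
by case/andP: q2 => ? ?; rewrite Theta_mxE; apply: bqj_mx_cols => //; exact: par_params.
Qed.

Local Notation block := (block_fin weight_pos Theta_mx).

Lemma block_inl m n j p : j = n%:Z + p ->
  block m << inl (n, j) >> = (Theta_minus q k1 k2 eps p n m)%:C *: << p >>.
Proof.
move=> ->; rewrite /block_fin fgliftE /= /Theta_mx odd_double doubleK.
by have -> : n%:Z + p - n%:Z = p by ring.
Qed.

Lemma block_inr m n j p : j = twoeps - n%:Z + p ->
  block m << inr (j, n) >> = (Theta_plus q k1 k2 eps p n m)%:C *: << p >>.
Proof.
move=> ->; rewrite /block_fin fgliftE /= /Theta_mx /= odd_double uphalf_double.
by have -> : twoeps - n%:Z + p - twoeps + n%:Z = p by ring.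
Qed.

Let qD x y : q `^ (x + y) = q `^ x * q `^ y.
Proof. by apply: powRD; case/andP: hq => q0 _; rewrite (gt_eqF q0) implybT. Qed.

Let posI n : (n%:Z)%:~R = n%:R :> R. Proof. by []. Qed.

Let finmapE (I J : choiceType) (f : I -> J) i : fin_map f (<< i >> : fin R I) = << f i >>.
Proof. exact: fgliftE. Qed.

Let finmapD (I J : choiceType) (f : I -> J) (u v : fin R I) :
  fin_map f (u + v) = fin_map f u + fin_map f v.
Proof. exact: (linear_addE (fin_map_linear f)). Qed.

Let finmapZ (I J : choiceType) (f : I -> J) c (u : fin R I) :
  fin_map f (c *: u) = c *: fin_map f u.
Proof. exact: (linear_scaleE (fin_map_linear f)). Qed.

Let blockD m u v : block m (u + v) = block m u + block m v.
Proof. exact: (linear_addE (@fglift_linear _ _ _ _)). Qed.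

Let blockZ m c u : block m (c *: u) = c *: block m u.
Proof. exact: (linear_scaleE (@fglift_linear _ _ _ _)). Qed.

Let scaleC (V : lmodType R[i]) (x y : R) (v : V) : x%:C *: (y%:C *: v) = (x * y)%:C *: v.
Proof. by rewrite scalerA rmorphM. Qed.

Let scaleDC (V : lmodType R[i]) (x y : R) (v : V) : x%:C *: v + y%:C *: v = (x + y)%:C *: v.
Proof. by rewrite -scalerDl rmorphD. Qed.

Lemma Theta_intertwines_inl g m p n :
  block m (Tprime hq hk1 hk2 eps (uq_gen q g) << inl (n, n%:Z + p) >>) =
  Ssum hq k1 k2 eps m (uq_gen q g) ((Theta_minus q k1 k2 eps p n m)%:C *: << p >>).
Proof.
rewrite dsum_repr_inl (tens_repr_shift hq (pi_minus_urels hq hk1) (pi_S_urels hq _ _)).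
rewrite [RHS](urepr_of_shift (pi_S_urels hq _ _)).
case: g; rewrite ?finmapD !finmapZ !finmapE ?blockD !blockZ.
- rewrite (block_inl m (erefl (n%:Z + p))) scaleC; congr (_%:C *: _).
  by rewrite -qD [RHS]mulrC; congr (q `^ _ * _); rewrite intrD posI; ring.
- rewrite (block_inl m (erefl (n%:Z + p))) scaleC; congr (_%:C *: _).
  by rewrite -!powRN -qD [RHS]mulrC; congr (q `^ _ * _); rewrite intrD posI; ring.
- have e : n%:Z + p + 1 = n%:Z + (p + 1) by ring.
  have -> : (disc_down q k1 n * (q `^ ((n%:Z + p)%:~R + (eps + k2)))^-1)%:C *:
      block m << inl (n.-1, n%:Z + p) >> =
    (disc_down q k1 n * (q `^ ((n%:Z + p)%:~R + (eps + k2)))^-1 *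
      Theta_minus q k1 k2 eps (p + 1) n.-1 m)%:C *: << p + 1 >>.
    (* For n = 0 the default [n.-1] = 0 yields a vector of weight index p instead of p + 1; only its
       zero coefficient makes the formula correct. *)
    case: n => [|n] in e *; first by rewrite disc_down0 !mul0r !scale0r.
    by rewrite (@block_inl m n _ (p + 1)) ?scaleC //= intS; ring.
  rewrite (block_inl m e) scaleC scaleDC; congr (_%:C *: _).
  by rewrite [RHS]mulrC Theta_minus_up.
- have e : n%:Z + p - 1 = n%:Z + (p - 1) by ring.
  have e' : n%:Z + p = n.+1%:Z + (p - 1) by rewrite intS; ring.
  rewrite (block_inl m e) (block_inl m e') !scaleC scaleDC; congr (_%:C *: _).
  by rewrite [RHS]mulrC Theta_minus_down.
Qed.

Lemma Theta_intertwines_inr g m p n :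
  block m (Tprime hq hk1 hk2 eps (uq_gen q g) << inr (twoeps - n%:Z + p, n) >>) =
  Ssum hq k1 k2 eps m (uq_gen q g) ((Theta_plus q k1 k2 eps p n m)%:C *: << p >>).
Proof.
rewrite dsum_repr_inr (tens_repr_shift hq (pi_S_urels hq _ _) (pi_plus_urels hq hk2)).
rewrite [RHS](urepr_of_shift (pi_S_urels hq _ _)).
have NE : (twoeps - n%:Z + p)%:~R = 2 * eps - n%:R + p%:~R :> R.
  by rewrite intrD intrB heps.
case: g; rewrite ?finmapD !finmapZ !finmapE ?blockD !blockZ.
- rewrite (block_inr m (erefl (twoeps - n%:Z + p))) scaleC; congr (_%:C *: _).
  by rewrite -qD [RHS]mulrC; congr (q `^ _ * _); rewrite NE; ring.
- rewrite (block_inr m (erefl (twoeps - n%:Z + p))) scaleC; congr (_%:C *: _).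
  by rewrite -!powRN -qD [RHS]mulrC; congr (q `^ _ * _); rewrite NE; ring.
- have e : twoeps - n%:Z + p = twoeps - n.+1%:Z + (p + 1) by rewrite intS; ring.
  have e' : twoeps - n%:Z + p + 1 = twoeps - n%:Z + (p + 1) by ring.
  rewrite (block_inr m e) (block_inr m e') !scaleC scaleDC; congr (_%:C *: _).
  by rewrite [RHS]mulrC (Theta_plus_up hq hk1 hk2 heps p n m).
- have e : twoeps - n%:Z + p - 1 = twoeps - n%:Z + (p - 1) by ring.
  have -> : (q `^ ((twoeps - n%:Z + p)%:~R + (- eps - k1)) * disc_down q k2 n)%:C *:
      block m << inr (twoeps - n%:Z + p, n.-1) >> =
    (q `^ ((twoeps - n%:Z + p)%:~R + (- eps - k1)) * disc_down q k2 n *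
      Theta_plus q k1 k2 eps (p - 1) n.-1 m)%:C *: << p - 1 >>.
    clear NE; case: n => [|n] in e *.
      by rewrite disc_down0 !(scale0r, mulr0, mul0r).
    by rewrite (@block_inr m n _ (p - 1)) ?scaleC //= intS; ring.
  rewrite (block_inr m e) scaleC scaleDC; congr (_%:C *: _).
  by rewrite [RHS]mulrC (Theta_plus_down hq hk1 hk2 heps p n m).
Qed.

Lemma Theta_intertwines g m p k :
  block m (Tprime hq hk1 hk2 eps (uq_gen q g) << weight_idx (p, k) >>) =
  Ssum hq k1 k2 eps m (uq_gen q g) ((Theta_mx p k m)%:C *: << p >>).
Proof.
rewrite /weight_idx /Theta_mx /=; case: odd.
  exact: Theta_intertwines_inr.
exact: Theta_intertwines_inl.
Qed.

End Intertwiner.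

Theorem theorem3p2 (R : realType) (q : R) (hq : 0 < q < 1)
    (k1 k2 : R) (hk1 : 0 < k1) (hk2 : 0 < k2)
    (eps : R) (twoeps : int) (heps : 2 * eps = twoeps%:~R) :
  unitarily_equivalent (Tprime hq hk1 hk2 eps) (Ssum hq k1 k2 eps) /\
  exists U : {linear l2 (R := R) (nat * int + int * nat)%type ->
                     l2 (R := R) (nat * int)%type},
    [/\ unitary_intertwiner (Tprime hq hk1 hk2 eps) (Ssum hq k1 k2 eps) U,
        forall (p : int) (n m : nat) (j : int),
          val (U (fin_l2 (f_minus p n))) (m, j) =
          if j == p then (Theta_minus q k1 k2 eps p n m)%:C else 0 &
        forall (p : int) (n m : nat) (j : int),
          val (U (fin_l2 (f_plus twoeps p n))) (m, j) =
          if j == p then (Theta_plus q k1 k2 eps p n m)%:C else 0].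
Proof.
set S := Ssum hq k1 k2 eps; set A := Tprime hq hk1 hk2 eps.
pose U := block_map (weight_idxK twoeps) (weight_posK twoeps)
  (Theta_mx_rows hq hk1 hk2 eps) (Theta_mx_cols hq hk1 hk2 eps).
have hU : unitary_intertwiner A S U.
  by apply: block_op_intertwiner => g m p k; exact: Theta_intertwines.
split; first by exists U.
exists U; split=> // p n m j.
(* In block p the vector f^-_{p,n} sits at position 2n, and f^+_{p,n} at position 2n + 1. *)
- have := block_op_basis (weight_idxK twoeps) (weight_posK twoeps)
    (Theta_mx_rows hq hk1 hk2 eps)
    (Theta_mx_cols hq hk1 hk2 eps) p n.*2 m j.
  by rewrite /weight_idx /Theta_mx /= odd_double doubleK.
- have := block_op_basis (weight_idxK twoeps) (weight_posK twoeps)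
    (Theta_mx_rows hq hk1 hk2 eps)
    (Theta_mx_cols hq hk1 hk2 eps) p n.*2.+1 m j.
  by rewrite /weight_idx /Theta_mx /= odd_double /= uphalf_double.
Qed.
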